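(* Let $n\ge 1$ and $a_0,\dots,a_n\in\mathbb{C}(z)$ with $a_0a_n\neq 0$, and consider the $q$-difference equation $$a_n(z)y(q^nz)+a_{n-1}(z)y(q^{n-1}z)+\cdots+a_0(z)y(z)=0 .$$ Let $G$ be the difference Galois group over the $\sigma_q$-field $\mathbb{C}(z)$ of the associated companion system $\sigma_q(Y)=AY$. Assume that one of the following holds: (i) $n\ge 2$ and $G^{\circ,der}=\mathrm{SL}_n(\mathbb{C})$; (ii) $n\ge 3$ and $G^{\circ,der}=\mathrm{SO}_n(\mathbb{C})$; (iii) $n$ is even and $G^{\circ,der}=\mathrm{Sp}_n(\mathbb{C})$. Assume that the equation admits a nonzero solution $g\in\mathbb{C}((z^* ))$. Then $g$ is $\sigma_{\mathbf{q}}$-transcendental over $\mathbb{C}(z^* )$.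
   Context: Let $q,\mathbf{q}\in\mathbb{C}^\times$ be two complex numbers with $|q|\neq1$, $|\mathbf{q}|\ne 1$, which are multiplicatively independent: for $\ell,m\in\mathbb{Z}$, $q^\ell\mathbf{q}^m=1$ implies $\ell=m=0$. Let $\mathbb{C}(z^* )=\bigcup_{j\ge1}\mathbb{C}(z^{1/j})\subset\mathbb{C}((z^* ))=\bigcup_{j\ge1}\mathbb{C}((z^{1/j}))$. Fix sequences $(q_j)_{j\ge1}$, $(\mathbf{q}_j)_{j\ge1}$ of complex numbers with $q_j^j=q$, $\mathbf{q}_j^j=\mathbf{q}$ and $q_j^l=q_k$, $\mathbf{q}_j^l=\mathbf{q}_k$ whenever $j=lk$; $\sigma_q$ and $\sigma_{\mathbf{q}}$ are the commuting automorphisms of $\mathbb{C}((z^* ))$ with $z^{1/j}\mapsto q_jz^{1/j}$ and $z^{1/j}\mapsto\mathbf{q}_jz^{1/j}$ respectively (identity on $\mathbb{C}$); $y(q^kz)$ means $\sigma_q^k(y)$. An element $f\in\mathbb{C}((z^* ))$ is $\sigma_{\mathbf{q}}$-transcendental over $\mathbb{C}(z^* )$ if $f,\sigma_{\mathbf{q}}(f),\sigma_{\mathbf{q}}^2(f),\dots$ are algebraically independent over $\mathbb{C}(z^* )$. The companion system is $\sigma_q(Y)=AY$ with $A\in\mathrm{GL}_n(\mathbb{C}(z))$ having $1$'s on the superdiagonal, last row $(-a_0/a_n,-a_1/a_n,\dots,-a_{n-1}/a_n)$, and zeros elsewhere. The difference Galois group of $\sigma_q(Y)=AY$ over $\mathbb{C}(z)$: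 let $R$ be a Picard-Vessiot ring, i.e. a $\mathbb{C}(z)$-algebra with an automorphism extending $\sigma_q$, of the form $R=\mathbb{C}(z)[U,\det(U)^{-1}]$ with $U\in\mathrm{GL}_n(R)$, $\sigma_q(U)=AU$, and having no $\sigma_q$-stable ideals other than $\{0\}$ and $R$. Let $\mathcal{Q}_R$ be its total ring of quotients. Then $G$ is the group of $\mathbb{C}(z)$-automorphisms of $\mathcal{Q}_R$ commuting with $\sigma_q$, identified with an algebraic subgroup of $\mathrm{GL}_n(\mathbb{C})$ by $\phi\mapsto C(\phi)$, $\phi(U)=UC(\phi)$. It is defined up to conjugation, and equalities such as $G^{\circ,der}=\mathrm{SL}_n(\mathbb{C})$ are meant for a suitable choice of $U$. $G^{\circ}$ is the neutral component of $G$ and $G^{\circ,der}$ its derived subgroup. $\mathrm{SO}_n(\mathbb{C})=\{C\in\mathrm{SL}_n(\mathbb{C}): C^tC=I_n\}$ and, for $n$ even, $\mathrm{Sp}_n(\mathbb{C})=\{C\in\mathrm{GL}_n(\mathbb{C}): C^tJC=J\}$ with $J=\begin{pmatrix}0&I_{n/2}\\-I_{n/2}&0\end{pmatrix}$. *)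

(* Defs.v *)
From HB Require Import structures.
From mathcomp Require Import all_boot all_order all_algebra complex.
From mathcomp Require Import all_classical all_reals topology.
(* Only the structures of mpoly are imported: its notations clash with those of
   the other libraries. *)
From mathcomp Require Import (canonicals, coercions) mpoly.
From mathcomp Require Import ring lra zify.

Set Implicit Arguments.
Unset Strict Implicit.
Unset Printing Implicit Defensive.
Import Order.TTheory GRing.Theory Num.Theory.
Local Open Scope classical_set_scope.
Local Open Scope ring_scope.

Section Puiseux.
Variable F : fieldType.
Implicit Types (f g h : rat -> F) (j N M : nat) (r x y : rat).

(* A Puiseux series sum_r f_r z^r is represented by its coefficients r |-> f_r:
   it belongs to F((z^{1/j})) when its support lies in { (m - N) / j | m : nat }
   for some N, and F((z^* )) is the union of the F((z^{1/j})), 0 < j. *)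
Definition on_grid j N r : Prop := exists m : nat, r = (m%:R - N%:R) / j%:R.

Definition supported_on j N f : Prop := forall r, f r != 0 -> on_grid j N r.

Definition is_puiseux f : Prop :=
  exists j N, (0 < j)%N /\ supported_on j N f.

(* For Puiseux series, only finitely many terms of this sum are nonzero. *)
Definition conv f g r : F := \sum_(s \in [set: rat]) f s * g (r - s).

Definition grid j N M : seq rat := [seq (m%:R - N%:R) / j%:R | m <- iota 0 M].

Lemma grid_uniq j N M : (0 < j)%N -> uniq (grid j N M).
Proof.
move=> j0; rewrite map_inj_uniq ?iota_uniq // => m1 m2 /=.
have j0' : (j%:R : rat) != 0 by rewrite pnatr_eq0 -lt0n.
by move=> /(divIf j0') /addIr /eqP; rewrite eqr_nat => /eqP.
Qed.

Lemma gridP j N M x : reflect (exists2 m, (m < M)%N & x = (m%:R - N%:R) / j%:R)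
  (x \in grid j N M).
Proof.
apply: (iffP mapP) => -[m]; first by rewrite mem_iota => mM ->; exists m.
by move=> mM ->; exists m => //; rewrite mem_iota.
Qed.

Lemma supported_on_le j k N M f : (0 < j)%N -> (0 < k)%N -> (N * k <= M)%N ->
  supported_on j N f -> supported_on (j * k) M f.
Proof.
move=> j0 k0 NM fP r /fP [m ->]; exists (m * k + (M - N * k))%N.
rewrite natrD natrB // !natrM.
have j0' : (j%:R : rat) != 0 by rewrite pnatr_eq0 -lt0n.
have k0' : (k%:R : rat) != 0 by rewrite pnatr_eq0 -lt0n.
field; by rewrite j0' k0'.
Qed.

Lemma common_grid f g : is_puiseux f -> is_puiseux g ->
  exists j N, [/\ (0 < j)%N, supported_on j N f & supported_on j N g].
Proof.
move=> [j1 [N1 [j10 fP]]] [j2 [N2 [j20 gP]]].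
exists (j1 * j2)%N, (N1 * j2 + N2 * j1)%N; split; first by rewrite muln_gt0 j10.
  by apply: supported_on_le fP => //; rewrite leq_addr.
by rewrite mulnC; apply: supported_on_le gP => //; rewrite leq_addl.
Qed.

Lemma supported_on_leN j N M f : (0 < j)%N -> (N <= M)%N ->
  supported_on j N f -> supported_on j M f.
Proof.
by move=> j0 NM fP; rewrite -[j]muln1; apply: supported_on_le fP; rewrite ?muln1.
Qed.

Lemma common_grid3 f g h : is_puiseux f -> is_puiseux g -> is_puiseux h ->
  exists j N, [/\ (0 < j)%N, supported_on j N f, supported_on j N g
    & supported_on j N h].
Proof.
move=> fP gP [j2 [N2 [j20 hP]]].
have [j1 [N1 [j10 {}fP {}gP]]] := common_grid fP gP.
exists (j1 * j2)%N, (N1 * j2 + N2 * j1)%N.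
split; first by rewrite muln_gt0 j10.
- by apply: supported_on_le fP => //; rewrite leq_addr.
- by apply: supported_on_le gP => //; rewrite leq_addr.
- by rewrite mulnC; apply: supported_on_le hP => //; rewrite leq_addl.
Qed.

Lemma convE (s : seq rat) f g r : uniq s ->
  (forall x, f x != 0 -> g (r - x) != 0 -> x \in s) ->
  conv f g r = \sum_(x <- s) f x * g (r - x).
Proof.
move=> us sP; rewrite /conv (@fsbigE _ _ _ _ _ s) //.
  by apply: eq_bigl => x; rewrite mem_set.
move=> x _; apply: contraNeq; rewrite mulf_eq0 negb_or => /andP[]; exact: sP.
Qed.

Lemma conv_grid j N1 N2 M f g r : (0 < j)%N -> supported_on j N1 f ->
  supported_on j N2 g -> r * j%:R + N1%:R + N2%:R < M%:R ->
  conv f g r = \sum_(x <- grid j N1 M) f x * g (r - x).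
Proof.
move=> j0 fP gP rM; apply: convE; first exact: grid_uniq.
have j0' : (j%:R : rat) != 0 by rewrite pnatr_eq0 -lt0n.
move=> x /fP [m ex] /gP [m' ey]; apply/gridP; exists m => //.
have er : r = (m%:R - N1%:R) / j%:R + (m'%:R - N2%:R) / j%:R.
  by rewrite -ey -ex; ring.
move: rM; rewrite er; set t := (X in X < _).
have -> : t = (m + m')%:R by rewrite /t natrD; field.
by rewrite ltr_nat; apply: leq_ltn_trans; rewrite leq_addr.
Qed.

Lemma conv_supported j N1 N2 f g : (0 < j)%N -> supported_on j N1 f ->
  supported_on j N2 g -> supported_on j (N1 + N2) (conv f g).
Proof.
move=> j0 fP gP r; apply: contra_neqP => nr.
rewrite (@convE [::]) ?big_nil // => x /fP [m ex] /gP [m' ey].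
case: nr; exists (m + m')%N.
have -> : r = x + (r - x) by ring.
by rewrite ey ex !natrD; ring.
Qed.

Lemma is_puiseux_conv f g : is_puiseux f -> is_puiseux g ->
  is_puiseux (conv f g).
Proof.
move=> fP gP; have [j [N [j0 {}fP {}gP]]] := common_grid fP gP.
by exists j, (N + N)%N; split => //; exact: conv_supported.
Qed.

Lemma exists_bound r : exists M, r < M%:R.
Proof.
exists (Num.bound `|r|); apply: le_lt_trans (ler_norm _) _.
exact/archi_boundP/normr_ge0.
Qed.

Lemma convC f g : is_puiseux f -> is_puiseux g -> conv f g = conv g f.
Proof.
move=> fP gP; have [j [N [j0 {}fP {}gP]]] := common_grid fP gP.
apply/funext => r; have [M rM] := exists_bound (r * j%:R + N%:R + N%:R).
rewrite (conv_grid j0 fP gP rM) (@convE [seq r - x | x <- grid j N M]).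
- by rewrite [RHS]big_map; apply: eq_bigr => x _; rewrite subKr mulrC.
- by rewrite map_inj_uniq ?grid_uniq // => x y; exact: subrI.
have j0' : (j%:R : rat) != 0 by rewrite pnatr_eq0 -lt0n.
move=> x /gP [m' ey] /fP [m ex]; apply/mapP; exists (r - x); last by rewrite subKr.
apply/gridP; exists m => //.
have er : r = (m%:R - N%:R) / j%:R + (m'%:R - N%:R) / j%:R.
  by rewrite -ey -ex; ring.
move: rM; rewrite er; set t := (X in X < _).
have -> : t = (m + m')%:R by rewrite /t natrD; field.
by rewrite ltr_nat; apply: leq_ltn_trans; rewrite leq_addr.
Qed.

Lemma convA f g h : is_puiseux f -> is_puiseux g -> is_puiseux h ->
  conv f (conv g h) = conv (conv f g) h.
Proof.
move=> fP gP hP; have [j [N [j0 {}fP {}gP {}hP]]] := common_grid3 fP gP hP.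
have j0' : (j%:R : rat) != 0 by rewrite pnatr_eq0 -lt0n.
apply/funext => r.
have [M rM] := exists_bound (r * j%:R + N%:R + N%:R + N%:R).
rewrite (@conv_grid j N (N + N) M) //; first last.
- by rewrite natrD !addrA.
- exact: conv_supported.
rewrite (@conv_grid j (N + N) N M) //; first last.
- by rewrite natrD !addrA.
- exact: conv_supported.
rewrite [RHS](eq_big_seq
  (fun x => \sum_(y <- grid j N M) f y * g (x - y) * h (r - x))); last first.
  move=> x /gridP [m mM ex]; rewrite (@conv_grid j N N M) ?mulr_suml //.
  have -> : x * j%:R + N%:R + N%:R = m%:R by rewrite ex natrD; field.
  by rewrite ltr_nat.
rewrite exchange_big /=; apply: eq_bigr => y _.
have [->|fy0] := eqVneq (f y) 0.
  by rewrite mul0r big1 // => x _; rewrite !mul0r.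
rewrite (@convE [seq x - y | x <- grid j (N + N) M]).
- rewrite [in LHS]big_map mulr_sumr; apply: eq_bigr => x _; rewrite mulrA.
  by congr (_ * _ * h _); ring.
- by rewrite map_inj_uniq ?grid_uniq // => x z; exact: addIr.
move=> w gw hw; apply/mapP; exists (w + y); last by ring.
have [m1 e1] := fP _ fy0; have [m2 e2] := gP _ gw; have [m3 e3] := hP _ hw.
apply/gridP; exists (m1 + m2)%N; last by rewrite e1 e2 !natrD; ring.
have er : r = (m1%:R - N%:R) / j%:R + (m2%:R - N%:R) / j%:R
   + (m3%:R - N%:R) / j%:R.
  by rewrite -e1 -e2 -e3; ring.
move: rM; rewrite er; set t := (X in X < _).
have -> : t = (m1 + m2 + m3)%:R by rewrite /t !natrD; field.
by rewrite ltr_nat; apply: leq_ltn_trans; rewrite leq_addr.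
Qed.

Lemma convDl f g h : is_puiseux f -> is_puiseux g -> is_puiseux h ->
  conv (f \+ g) h = conv f h \+ conv g h.
Proof.
move=> fP gP hP; have [j [N [j0 {}fP {}gP {}hP]]] := common_grid3 fP gP hP.
have fgP : supported_on j N (f \+ g).
  move=> r /=; have [->|/fP//] := eqVneq (f r) 0.
  by rewrite add0r => /gP.
apply/funext => r /=; have [M rM] := exists_bound (r * j%:R + N%:R + N%:R).
rewrite !(@conv_grid j N N M) // -big_split /=.
by apply: eq_bigr => x _; rewrite mulrDl.
Qed.

(* c z^s *)
Definition monom (c : F) (s : rat) : rat -> F := fun r => if r == s then c else 0.

Lemma is_puiseux_monom c s : is_puiseux (monom c s).
Proof.
exists `|denq s|%N, `|numq s|%N; split; first by rewrite absz_gt0 denq_eq0.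
move=> r; rewrite /monom; case: (eqVneq r s) => [-> _|_ /eqP//].
have [m em] : exists m : nat, numq s + `|numq s|%N%:Z = m%:Z.
  by exists (absz (numq s + `|numq s|%N%:Z)); lia.
exists m; rewrite -[LHS]divq_num_den.
have -> : (`|denq s|%N)%:R = (denq s)%:~R :> rat.
  by rewrite -[in RHS](gtz0_abs (denq_gt0 s)).
congr (_ / _); rewrite -[m%:R]/(m%:Z%:~R) -em rmorphD /=.
by rewrite -[(`|numq s|%N)%:R]/((`|numq s|%N)%:Z%:~R) addrK.
Qed.

Lemma conv_monom c s f : is_puiseux f -> conv (monom c s) f = fun r => c * f (r - s).
Proof.
move=> fP; apply/funext => r; rewrite (@convE [:: s]) //.
  by rewrite big_seq1 /monom eqxx.
by move=> x; rewrite inE /monom => + _; case: (x == s) => //; rewrite eqxx.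
Qed.

Lemma power_series_inv (c : nat -> F) : c 0%N != 0 ->
  exists b : nat -> F, forall m,
    \sum_(i < m.+1) b i * c (m - i)%N = (m == 0%N)%:R.
Proof.
move=> c0.
pose bs := fix bs m := if m is m'.+1 then
  rcons (bs m') (- (\sum_(i < m) (bs m')`_i * c (m - i)%N) / c 0%N)
  else [:: (c 0%N)^-1].
have sbs m : size (bs m) = m.+1 by elim: m => //= m IHm; rewrite size_rcons IHm.
have nbs m i : (i <= m)%N -> (bs m)`_i = (bs i)`_i.
  elim: m => [|m IHm]; first by rewrite leqn0 => /eqP ->.
  rewrite leq_eqVlt => /predU1P[-> //|im].
  by rewrite /= nth_rcons sbs im IHm.
exists (fun m => (bs m)`_m) => -[|m].
  by rewrite big_ord_recl big_ord0 addr0 /= mulVf.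
rewrite big_ord_recr /= subnn nth_rcons sbs ltnn eqxx divfK //.
apply/eqP; rewrite subr_eq0; apply/eqP; apply: eq_bigr => i _.
by rewrite (nbs m) // -ltnS.
Qed.

Lemma inv_power_series j f : (0 < j)%N -> supported_on j 0 f -> f 0 != 0 ->
  exists2 g, is_puiseux g & conv g f = monom 1 0.
Proof.
move=> j0 fP f0.
have j0' : (j%:R : rat) != 0 by rewrite pnatr_eq0 -lt0n.
have [|b bP] := @power_series_inv (fun m => f (m%:R / j%:R)).
  by rewrite mul0r.
pose g r := if r * j%:R \is a Num.nat then b (Num.truncn (r * j%:R)) else 0.
have gE m : g (m%:R / j%:R) = b m by rewrite /g divfK // natr_nat natrK.
have gP : supported_on j 0 g.
  move=> r; rewrite /g; case: ifPn => [/natrP[m em] _|_ /eqP //].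
  by exists m; rewrite subr0 -em mulfK.
exists g; first by exists j, 0%N.
apply/funext => r; rewrite /monom.
have [[m]|nr] := pselect (on_grid j 0 r); last first.
  have := conv_supported j0 gP fP (r := r).
  have [-> _|_ /(_ isT) //] := eqVneq (conv g f r) 0.
  case: eqVneq => // r0; case: nr; exists 0%N.
  by rewrite subr0 mul0r.
rewrite subr0 => er; rewrite (@conv_grid j 0 0 m.+1) //; last first.
  by rewrite !addr0 er divfK // ltr_nat.
have -> : (r == 0) = (m == 0%N).
  by rewrite er mulf_eq0 invr_eq0 (negPf j0') orbF pnatr_eq0.
transitivity ((m == 0%N)%:R : F); last by case: eqP.
rewrite -bP /grid big_map -[iota _ _]/(index_iota 0 m.+1) big_mkord.
apply: eq_bigr => i _; rewrite subr0 gE er -mulrBl natrB //.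
by rewrite -ltnS.
Qed.

Lemma puiseux_inv f : is_puiseux f -> (exists r, f r != 0) ->
  exists2 g, is_puiseux g & conv g f = monom 1 0.
Proof.
move=> fP [r0 fr0]; have [j [N [j0 fN]]] := fP.
have j0' : (j%:R : rat) != 0 by rewrite pnatr_eq0 -lt0n.
have exm : exists m : nat, f ((m%:R - N%:R) / j%:R) != 0.
  by have [m em] := fN _ fr0; exists m; rewrite -em.
case: (ex_minnP exm) => m0 fm0 minm0.
pose s := (m0%:R - N%:R) / j%:R : rat.
have [||g gP ge] := @inv_power_series j (fun r => f (r + s)) j0.
- move=> r /[dup] /fN[m em]; rewrite em => /minm0 m0m.
  exists (m - m0)%N; rewrite subr0 natrB // -[LHS](addrK s) em /s; field.
  by rewrite j0'.
- by rewrite add0r.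
exists (conv g (monom 1 (- s))).
  by apply: is_puiseux_conv => //; exact: is_puiseux_monom.
rewrite -convA //; last exact: is_puiseux_monom.
rewrite conv_monom // -[RHS]ge; congr (conv g _).
by apply/funext => r; rewrite mul1r opprK.
Qed.

End Puiseux.

Section PuiseuxField.
Variable F : fieldType.

Definition puiseux_pred : pred (rat -> F) := [pred f | `[< is_puiseux f >]].

Record puiseux := Puiseux {
  pcoef :> rat -> F;
  pcoefP : pcoef \in puiseux_pred }.

HB.instance Definition _ := [isSub for pcoef].
HB.instance Definition _ := [Choice of puiseux by <:].

Fact puiseux_zmod_closed : zmod_closed puiseux_pred.
Proof.
split=> [|f g /asboolP fP /asboolP gP]; apply/asboolP.
  by exists 1%N, 0%N; split => // r /eqP.
have [j [N [j0 {}fP {}gP]]] := common_grid fP gP.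
exists j, N; split => // r.
have [fr0|/fP //] := eqVneq (f r) 0.
have [gr0|/gP //] := eqVneq (g r) 0.
by rewrite !fctE fr0 gr0 subrr eqxx.
Qed.
HB.instance Definition _ :=
  GRing.isZmodClosed.Build (rat -> F) puiseux_pred puiseux_zmod_closed.
HB.instance Definition _ := [SubChoice_isSubZmodule of puiseux by <:].

Lemma puiseuxW (f : puiseux) : is_puiseux f.
Proof. by have /asboolP := pcoefP f. Qed.

Fact puiseuxI (f : rat -> F) : is_puiseux f -> f \in puiseux_pred.
Proof. by move=> fP; exact/asboolP. Qed.

Definition pmonom (c : F) (s : rat) : puiseux :=
  Puiseux (puiseuxI (is_puiseux_monom c s)).

Definition pmul (f g : puiseux) : puiseux :=
  Puiseux (puiseuxI (is_puiseux_conv (puiseuxW f) (puiseuxW g))).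

Fact pmulA : associative pmul.
Proof. by move=> f g h; apply/val_inj/convA; exact: puiseuxW. Qed.

Fact pmulC : commutative pmul.
Proof. by move=> f g; apply/val_inj/convC; exact: puiseuxW. Qed.

Fact pmul1l : left_id (pmonom 1 0) pmul.
Proof.
move=> f; apply/val_inj; rewrite /= conv_monom; last exact: puiseuxW.
by apply/funext => r; rewrite mul1r subr0.
Qed.

Fact pmulDl : left_distributive pmul +%R.
Proof.
by move=> f g h; apply/val_inj; rewrite /= convDl //; exact: puiseuxW.
Qed.

Fact pone_neq0 : pmonom 1 0 != 0.
Proof.
apply/eqP => /(congr1 (fun f : puiseux => f 0)) /eqP.
by rewrite /= /monom eqxx oner_eq0.
Qed.

HB.instance Definition _ :=
  GRing.Zmodule_isComNzRing.Build (puiseux) pmulA pmulC pmul1l pmulDl pone_neq0.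

Definition pinv (f : puiseux) : puiseux :=
  xget 0 [set g | g * f = 1].

Fact pmulVf (f : puiseux) : f != 0 -> pinv f * f = 1.
Proof.
move=> f0; have [|g gP ge] := puiseux_inv (puiseuxW f).
  apply: contra_neqP f0 => fr; apply/val_inj/funext => r /=.
  by apply: contra_notP fr => /eqP fr; exists r.
rewrite /pinv; case: xgetP => [h _ //|/(_ (Puiseux (puiseuxI gP)))[]].
exact/val_inj.
Qed.

Fact pinv0 : pinv 0 = 0.
Proof.
rewrite /pinv; case: xgetP => // g _ /= /eqP.
by rewrite mulr0 eq_sym oner_eq0.
Qed.

HB.instance Definition _ := GRing.ComNzRing_isField.Build (puiseux) pmulVf pinv0.
End PuiseuxField.

(* The value at z := w of x in F(z), the coefficients being mapped by c. When w
   is transcendental over the image of c, as below with q != 0 and 0 < j, the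
   denominator does not vanish, the value does not depend on the fraction
   representing x, and this is a field morphism F(z) -> L. *)
Definition ratfun_eval (F L : fieldType) (c : F -> L) (w : L)
    (x : {fraction {poly F}}) : L :=
  let r := generic_quotient.repr x in
  (map_poly c \n_r).[w] / (map_poly c \d_r).[w].

Section Operators.
Variable F : fieldType.
Local Notation K := {fraction {poly F}}.

Definition const_ratfun (c : F) : K := FracField.tofrac c%:P.

(* y(z) |-> y(qz) *)
Definition sigma_ratfun (q : F) : K -> K :=
  ratfun_eval const_ratfun (FracField.tofrac (q%:P * 'X)).

Definition const_puiseux (c : F) : puiseux F := pmonom c 0.

(* x(z) |-> x(z^{1/j}); j = 1 gives the inclusion of F(z) in F((z^* )). *)
Definition ratfun_to_puiseux (j : nat) : K -> puiseux F :=
  ratfun_eval const_puiseux (pmonom 1 j%:R^-1).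

(* F(z^* ), the union of the F(z^{1/j}) *)
Definition ratfun_star : set (puiseux F) :=
  \bigcup_(j in [set j | (0 < j)%N]) range (ratfun_to_puiseux j).

(* qs j is the chosen j-th root of q; qs 0 is irrelevant. *)
Definition root_system (q : F) (qs : nat -> F) : Prop :=
  (forall j, (0 < j)%N -> qs j ^+ j = q) /\
  (forall k l, (0 < k)%N -> (0 < l)%N -> qs (l * k)%N ^+ l = qs k).

(* q^{k/j} := (qs j)^k, which by coherence does not depend on the fraction k/j. *)
Definition root_pow (qs : nat -> F) (r : rat) : F := qs (absz (denq r)) ^ numq r.

Fact sigma_puiseux_subproof (qs : nat -> F) (f : puiseux F) :
  is_puiseux (fun r => root_pow qs r * f r).
Proof.
have [j [N [j0 fP]]] := puiseuxW f; exists j, N; split=> // r.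
by rewrite mulf_eq0 negb_or => /andP[_ /fP].
Qed.

(* The automorphism z^{1/j} |-> (qs j) z^{1/j}: sum_r f_r z^r |-> sum_r q^r f_r z^r. *)
Definition sigma_puiseux (qs : nat -> F) (f : puiseux F) : puiseux F :=
  Puiseux (puiseuxI (sigma_puiseux_subproof qs f)).

(* For every m, the series f, sigma f, ..., sigma^{m-1} f satisfy no nontrivial
   polynomial relation with coefficients in F(z^* ). *)
Definition sigma_transcendental (qs : nat -> F) (f : puiseux F) : Prop :=
  forall (m : nat) (P : mpoly.mpoly m (puiseux F)),
    (forall e, ratfun_star (mpoly.mcoeff e P)) ->
    mpoly.meval (fun i : 'I_m => iter i (sigma_puiseux qs) f) P = 0 ->
    P = 0.

Definition companion (n : nat) (a : 'I_n.+1 -> K) : 'M[K]_n :=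
  \matrix_(i < n, j < n)
    if i.+1 == n then - a (widen_ord (leqnSn n) j) / a ord_max
    else (i.+1 == j :> nat)%:R.
End Operators.

Section Galois.
Variables (F : fieldType) (q : F) (n : nat).
Local Notation K := {fraction {poly F}}.
Variable A : 'M[K]_n.

Definition is_ideal (S : comUnitAlgType K) (I : set S) : Prop :=
  I 0 /\ (forall c x y, I x -> I y -> I (c * x + y)).

(* S is the F(z)-algebra; asking for a comUnitAlgType is no restriction, as any
   commutative ring has a (classical) inversion operation. The field pv_gen says
   that S = F(z)[U, 1 / det U]. *)
Record is_picard_vessiot (S : comUnitAlgType K) (sigma : {rmorphism S -> S})
    (U : 'M[S]_n) : Prop := {
  pv_bij : bijective sigma;
  pv_ext : forall x : K, sigma x%:A = (sigma_ratfun q x)%:A;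
  pv_unit : U \in unitmx;
  pv_eq : map_mx sigma U = map_mx (in_alg S) A *m U;
  pv_gen : forall B : set S,
    (forall x : K, B x%:A) ->
    (forall x y, B x -> B y -> B (x + y)) ->
    (forall x y, B x -> B y -> B (x * y)) ->
    (forall i j, B (U i j)) -> B (\det U)^-1 ->
    B = setT;
  pv_simple : forall I : set S, is_ideal I ->
    (forall x, I x -> I (sigma x)) -> I = [set 0] \/ I = setT }.

(* Q is the localization of S at its non-zero-divisors. *)
Record is_total_quotient_ring (S Q : comUnitAlgType K)
    (iota : {lrmorphism S -> Q}) : Prop := {
  tq_inj : injective iota;
  tq_unit : forall d : S, GRing.lreg d -> iota d \is a GRing.unit;
  tq_frac : forall y : Q, exists x d : S, GRing.lreg d /\ y = iota x / iota d }.

(* The matrices C(phi) of the F(z)-automorphisms phi of Q commuting with sigma,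
   where phi(U) = U C(phi). *)
Definition galois_matrices (Q : comUnitAlgType K) (sigma : {rmorphism Q -> Q})
    (U : 'M[Q]_n) : set 'M[F]_n :=
  [set M | M \in unitmx /\ exists phi : {lrmorphism Q -> Q},
    [/\ bijective phi, forall x, phi (sigma x) = sigma (phi x)
      & map_mx phi U = U *m map_mx (fun c => (const_ratfun c)%:A) M]].

(* G is the difference Galois group of sigma_q(Y) = A Y, as realized by some
   Picard-Vessiot ring S and some choice of U; sigmaQ is the extension of sigma
   to the total ring of quotients Q of S. *)
Definition is_difference_galois_group (G : set 'M[F]_n) : Prop :=
  exists (S Q : comUnitAlgType K) (sigma : {rmorphism S -> S})
    (U : 'M[S]_n) (iota : {lrmorphism S -> Q}) (sigmaQ : {rmorphism Q -> Q}),
  [/\ is_picard_vessiot sigma U, is_total_quotient_ring iota,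
      forall x, sigmaQ (iota x) = iota (sigma x)
    & G = galois_matrices sigmaQ (map_mx iota U)].
End Galois.

(* The n x n matrices with the Zariski topology. On GL_n it induces the usual
   Zariski topology, since denominators det^k can be cleared. *)
Definition zariski (F : fieldType) (n : nat) : Type := 'M[F]_n.

Section Zariski.
Variables (F : fieldType) (n : nat).
HB.instance Definition _ := Choice.on (zariski F n).

Definition zero_locus (P : set (mpoly.mpoly (n * n) F)) : set (zariski F n) :=
  [set M | forall p, P p ->
    mpoly.meval (fun k => mxvec (M : 'M[F]_n) ord0 k) p = 0].

Definition zariski_open : set (set (zariski F n)) :=
  [set V | exists P, V = ~` zero_locus P].

Fact zariski_openT : zariski_open setT.
Proof.
exists [set 1]; apply/esym/seteqP; split=> // M _ /(_ 1 erefl) /eqP.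
by rewrite rmorph1 oner_eq0.
Qed.

Fact zariski_openI : setI_closed zariski_open.
Proof.
move=> _ _ [P ->] [Q ->]; exists [set p * q | p in P & q in Q].
rewrite -setCU; congr (~` _); apply/seteqP; split=> M.
  move=> [MP|MQ] _ [p Pp [r Qr <-]]; rewrite rmorphM /=.
    by rewrite (MP _ Pp) mul0r.
  by rewrite (MQ _ Qr) mulr0.
move=> MPQ; apply: contrapT => /not_orP[/existsNP[p /not_implyP[Pp p0]]].
move=> /existsNP[r /not_implyP[Qr r0]].
have /eqP := MPQ (p * r) (ex_intro2 _ _ p Pp (ex_intro2 _ _ r Qr erefl)).
by rewrite rmorphM /= mulf_eq0 => /orP[] /eqP.
Qed.

Fact zariski_open_bigU (I : Type) (f : I -> set (zariski F n)) :
  (forall i, zariski_open (f i)) -> zariski_open (\bigcup_i f i).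
Proof.
move=> fP; exists [set p | exists i P, f i = ~` zero_locus P /\ P p].
rewrite -[LHS]setCK; congr (~` _); rewrite setC_bigcup; apply/seteqP; split=> M.
  move=> fM p [i [P [fi Pp]]]; have := fM i Logic.I.
  by rewrite fi setCK; apply.
move=> MP i _ fiM; have [P fi] := fP i; move: (fiM); rewrite fi; apply.
by move=> p Pp; apply: MP; exists i, P.
Qed.

HB.instance Definition _ := isOpenTopological.Build (zariski F n)
  zariski_openT zariski_openI zariski_open_bigU.

Definition neutral_component (G : set 'M[F]_n) : set 'M[F]_n :=
  connected_component (G : set (zariski F n)) 1%:M.
End Zariski.

Section MatrixGroups.
Variables (F : fieldType) (n : nat).
Implicit Types (G H : set 'M[F]_n).

Definition is_matrix_group H : Prop :=
  [/\ forall M, H M -> M \in unitmx, H 1%:M,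
      forall M N, H M -> H N -> H (M *m N)
    & forall M, H M -> H (invmx M)].

Definition derived_subgroup G : set 'M[F]_n :=
  \bigcap_(H in [set H | is_matrix_group H /\ forall M N, G M -> G N ->
      H (M *m N *m invmx M *m invmx N)]) H.

Definition SL : set 'M[F]_n := [set M | \det M = 1].

Definition SO : set 'M[F]_n := [set M | \det M = 1 /\ M^T *m M = 1%:M].

(* For even n, the block matrix (0, I; -I, 0) with blocks of size n / 2. *)
Definition symplectic_form : 'M[F]_n :=
  \matrix_(i < n, j < n)
    ((j == i + n./2 :> nat)%N%:R - (i == j + n./2 :> nat)%N%:R).

Definition Sp : set 'M[F]_n := [set M | M \in unitmx /\
  M^T *m symplectic_form *m M = symplectic_form].
End MatrixGroups.

(* Main.v *)
Require Import Defs.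
From HB Require Import structures.
From mathcomp Require Import all_boot all_order all_algebra complex.
From mathcomp Require Import all_classical all_reals topology.
From mathcomp Require Import -(notations) mpoly.
From mathcomp Require Import ring lra zify.

(* Write K = C(z), L = C((z^ * )), sigma and tau for the dilations by q and the second
   parameter p, Y for the column of the sigma^i g, and Y_k = tau^k Y, A_k = tau^k A, so
   that sigma Y_k = A_k Y_k. Consider the sequences (a_k) in sl_n(K) for which every
   finite part is induced by a K-derivation delta of L: delta Y_k = a_k Y_k.
   If the tau^k g were algebraically dependent over C(z^ * ), a relation of minimal
   degree would determine such a sequence by finitely many of its terms, so that the
   sequences would form a finite-dimensional K-space. This space is not 0: unipotent
   one-parameter subgroups of the Galois group give derivations of the Picard-Vessiot
   ring, these extend to a domain containing fundamental matrices of finitely many of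
   the systems sigma X = A_k X, their K-components are realized by derivations of L,
   and brackets of the latter have trace 0. The operators
   (a_k) |-> (A_k^-1 sigma(a_k) A_k) and (a_k) |-> (tau^-1 a_(k+1)) commute on it. By
   multiplicative independence, a pair of commuting semilinear operators has an
   eigenvector for the first one, that is a nonzero a in sl_n(K) with
   sigma(a) A = mu A a. As the Lie algebra of the Galois group acts irreducibly, this
   contradicts Schur's lemma. *)

Set Implicit Arguments.
Unset Strict Implicit.
Unset Printing Implicit Defensive.
Import Order.TTheory GRing.Theory Num.Theory.
Local Open Scope classical_set_scope.
Local Open Scope ring_scope.
Local Notation mvar i := (mpolyX _ (mnm1 i)).

(** * Simple difference rings *)

(** The fundamental matrix U lives in a ring S that may have zero divisors, g lives in L, and no
    embedding relates the two. The bridge is the variable U^-1 X, on which sigma acts through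
    coefficients only: over a simple ring, the relations between the entries of Y_0, ..., Y_M are
    generated by polynomials in U^-1 X with constant coefficients. The derivation X -> (dU) U^-1 X
    kills these, and a K-linear functional applied to its matrix makes it a derivation of L. Simple
    rings of countable dimension over K have no new constants because C is uncountable. Traces must
    be 0 because a = 1 always satisfies sigma(a) A = A a. For the eigenvector, independence of q and
    p serves twice: at 0 and infinity it excludes nonzero slopes, and elsewhere it makes regularity
    at the two ends of a q-orbit equivalent. Vectors regular in this sense have, up to a common
    denominator, poles at 0 and infinity only, of bounded order along the iterates of sigma; these
    iterates thus span a finite-dimensional C-space, and the eigenvector comes from linear algebra
    over C. *)

Lemma zorn_above (T : Type) (P : set (set T)) (A0 : set T) : P A0 ->
  (forall C : set (set T), C `<=` P -> C A0 -> (forall A, C A -> A0 `<=` A) ->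
     total_on C (fun A B => A `<=` B) -> P (\bigcup_(A in C) A)) ->
  exists M, [/\ P M, A0 `<=` M & forall B, P B -> M `<=` B -> B = M].
Proof.
move=> PA0 chain.
pose U := {A : set T | P A /\ A0 `<=` A}.
pose R (s t : U) := `[< sval s `<=` sval t >].
have U_eq (s t : U) : sval s = sval t -> s = t.
  by case: s t => [s sP] [t tP] /= e; subst t; congr exist; exact: Prop_irrelevance.
have [[M [PM A0M]] maxM] : exists t : U, forall s, R t s -> s = t.
  apply: Zorn => [t|r s t /asboolP rs /asboolP st|s t /asboolP st /asboolP ts|C Ctot].
  - exact/asboolP.
  - by apply/asboolP; apply: subset_trans rs st.
  - by apply: U_eq; apply/seteqP; split.
  (* [A0] is added to the chain, so that the empty chain needs no separate case. *)
  pose C' : set (set T) := [set A | A = A0 \/ exists2 t : U, C t & A = sval t].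
  have C'0 : C' A0 by left.
  have C'ge A : C' A -> A0 `<=` A.
    by case=> [->//|[t _ ->]]; have [] := svalP t.
  have PU : P (\bigcup_(A in C') A).
    apply: chain => //.
    - by move=> A [->//|[t _ ->]]; have [] := svalP t.
    move=> A B [->|[s Cs ->]] C'B; first by left; exact: C'ge.
    case: C'B => [->|[t Ct ->]]; first by right; have [] := svalP s.
    by case: (Ctot s t Cs Ct) => /asboolP; [left|right].
  have A0U : A0 `<=` \bigcup_(A in C') A by move=> x A0x; exists A0.
  exists (exist (fun A => P A /\ A0 `<=` A) _ (conj PU A0U)) => s Cs; apply/asboolP => x sx /=.
  by exists (sval s) => //; right; exists s.
exists M; split=> // B PB MB.
have A0B : A0 `<=` B by apply: subset_trans MB.
have := maxM (exist (fun A => P A /\ A0 `<=` A) B (conj PB A0B)).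
by move=> /(_ (asboolT MB)) /(congr1 sval).
Qed.

Lemma rmorphism_pack (R T : pzRingType) (f : R -> T) :
  zmod_morphism f -> monoid_morphism f -> exists g : {rmorphism R -> T}, g =1 f.
Proof.
move=> fB fM; exists (HB.pack_for {rmorphism R -> T} f
  (GRing.isZmodMorphism.Build R T f fB) (GRing.isMonoidMorphism.Build R T f fM)).
by [].
Qed.

Definition ideal (R : comNzRingType) (I : set R) : Prop :=
  I 0 /\ (forall c x y, I x -> I y -> I (c * x + y)).

Definition sigma_simple (R : comNzRingType) (s : R -> R) : Prop :=
  forall I : set R, ideal I -> (forall x, I x -> I (s x)) ->
    (exists2 x, I x & x != 0) -> I 1.

Section IdealQuotient.
Variables (R : comNzRingType) (I : set R).
Hypotheses (idI : ideal I) (I1 : ~ I 1).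

Definition ideal_pred : R -> bool := fun x => `[< I x >].
Local Notation Ip := ideal_pred.

Fact quotient_idealr_closed : idealr_closed Ip.
Proof.
split; rewrite ?unfold_in /ideal_pred; first by apply/asboolP; case: idI.
  by apply/asboolPn.
move=> a x y; rewrite !unfold_in => /asboolP Ix /asboolP Iy; apply/asboolP.
by case: idI => _; apply.
Qed.

HB.instance Definition _ := isIdealr.Build R Ip quotient_idealr_closed.

Lemma ideal_quotient : exists (Q : comNzRingType) (f : {rmorphism R -> Q}),
  (forall y, exists x, y = f x) /\ (forall x, f x = 0 <-> I x).
Proof.
exists (Quotient.quot (Ip : idealr R)), (\pi_(Quotient.quot (Ip : idealr R)))%qT; split.
  by move=> y; exists (generic_quotient.repr y); apply/esym; exact: generic_quotient.reprK.
move=> x; set f := (X in X x = 0 <-> _).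
have E : (f x == f 0) = `[< I x >].
  by have := Quotient.idealrBE (Ip : idealr R) x 0; rewrite subr0 => <-.
have f0 : f 0 = 0 by exact: (rmorph0 (\pi_(Quotient.quot (Ip : idealr R)))%qT).
rewrite f0 in E; split; first by move=> e; apply/asboolP; rewrite -E e eqxx.
by move=> Ix; apply/eqP; rewrite E; apply/asboolP.
Qed.
End IdealQuotient.

Lemma rmorphism_factor (R Q T : comNzRingType) (h : {rmorphism R -> Q})
    (f : {rmorphism R -> T}) :
  (forall y, exists x, y = h x) -> (forall x, h x = 0 -> f x = 0) ->
  exists g : {rmorphism Q -> T}, forall x, g (h x) = f x.
Proof.
move=> hsurj hf.
have {}hf x y : h x = h y -> f x = f y.
  by move=> e; apply/eqP; rewrite -subr_eq0 -rmorphB hf // rmorphB e subrr.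
pose lift y := xget 0 [set x | y = h x].
have liftP y : y = h (lift y).
  rewrite /lift; case: xgetP => [x _ ->//|none].
  by have [x xP] := hsurj y; have := none x.
have gh x : f (lift (h x)) = f x by apply: hf; rewrite -liftP.
have [||g gE] := @rmorphism_pack Q T (f \o lift).
- by move=> x y; rewrite /= -rmorphB; apply: hf; rewrite rmorphB -!liftP.
- split=> [|x y] /=; first by rewrite -(rmorph1 h) gh rmorph1.
  by rewrite -rmorphM; apply: hf; rewrite rmorphM -!liftP.
by exists g => x; rewrite gE /= gh.
Qed.

Lemma ideal_bigcup (R : comNzRingType) (C : set (set R)) (A0 : set R) :
  (forall A, C A -> ideal A) -> C A0 -> total_on C (fun A B => A `<=` B) ->
  ideal (\bigcup_(A in C) A).
Proof.
move=> idC CA0 tot; split; first by exists A0 => //; case: (idC _ CA0).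
move=> c x y [A CA Ax] [B CB By].
case: (tot _ _ CA CB) => [AB|BA].
  by exists B => //; case: (idC _ CB) => _; apply => //; apply: AB.
by exists A => //; case: (idC _ CA) => _; apply => //; apply: BA.
Qed.

(** The quotient by a maximal proper stable ideal containing [I]: the preimage of a stable ideal of
    the quotient is stable, so by maximality it is the kernel unless it contains 1. Picard-Vessiot
    rings are constructed in this way. *)
Lemma simple_quotient (R : comNzRingType) (s : {rmorphism R -> R}) (I : set R) :
  ideal I -> (forall x, I x -> I (s x)) -> ~ I 1 ->
  exists (Q : comNzRingType) (h : {rmorphism R -> Q}) (t : {rmorphism Q -> Q}),
    [/\ forall y, exists x, y = h x, forall x, I x -> h x = 0,
        forall x, t (h x) = h (s x) & sigma_simple t].
Proof.
move=> idI sI I1.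
pose P := [set A : set R | [/\ ideal A, forall x, A x -> A (s x) & ~ A 1]].
have [M [[idM sM M1] IM maxM]] : exists M, [/\ P M, I `<=` M &
    forall B, P B -> M `<=` B -> B = M].
  apply: zorn_above => // C CP CI _ tot; split.
  - by apply: ideal_bigcup CI tot => A /CP[].
  - by move=> x [A CA Ax]; exists A => //; have [_ + _] := CP _ CA; apply.
  - by move=> [A CA A1]; have [_ _ []] := CP _ CA.
have [Q [h [hsurj hM]]] := ideal_quotient idM M1.
have [|t tE] := @rmorphism_factor R Q Q h (h \o s) hsurj.
  by move=> x /hM/sM Msx /=; apply/hM.
exists Q, h, t; split=> //; first by move=> x /IM Mx; apply/hM.
move=> J idJ tJ [y Jy y0]; apply: contrapT => J1.
have hJM : [set x | J (h x)] = M.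
  apply: maxM; last by move=> x /hM /= ->; case: idJ.
  split; last by rewrite /= rmorph1.
  - split; first by rewrite /= rmorph0; case: idJ.
    by move=> c x z /= Jx Jz; rewrite rmorphD rmorphM; case: idJ => _; apply.
  - by move=> x /= /tJ; rewrite tE.
have [x yx] := hsurj y.
have : M x by rewrite -hJM /= -yx.
by move=> /hM; rewrite -yx => y00; rewrite y00 eqxx in y0.
Qed.

Lemma size_filter_neq (T : eqType) (x : T) (l : seq T) : x \in l ->
  (size [seq y <- l | y != x] < size l)%N.
Proof.
move=> xl; rewrite size_filter -(count_predC (pred1 x) l) -[X in (X < _)%N]add0n.
by rewrite ltn_add2r -has_count has_pred1.
Qed.

Section SimpleRing.
Variables (R : comNzRingType) (s : {rmorphism R -> R}).
Hypothesis simpleR : sigma_simple s.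

(** The principal ideal of a semi-invariant is stable. *)
Lemma simple_semi_invariant_unit (c a : R) : s c = a * c -> c != 0 ->
  exists d, d * c = 1.
Proof.
move=> sc c0.
have : [set x | exists d, x = d * c] 1.
  apply: simpleR; last by exists c => //; exists 1; rewrite mul1r.
    split; first by exists 0; rewrite mul0r.
    by move=> b _ _ [d ->] [e ->]; exists (b * d + e); rewrite mulrDl mulrA.
  by move=> _ [d ->]; exists (s d * a); rewrite rmorphM sc mulrA.
by move=> [d ->]; exists d.
Qed.

(* Gaussian elimination: an element of minimal support, normalized by means of
   simplicity to have a coordinate 1, is invariant. *)
Lemma stable_submodule_generated (V : lmodType R) (J : eqType) (co : J -> V -> R)
    (supp : V -> seq J) (sV : V -> V) (W B : set V) :
  (forall i a x y, co i (a *: x + y) = a * co i x + co i y) ->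
  (forall v, (forall i, co i v = 0) -> v = 0) ->
  (forall i v, co i v != 0 -> i \in supp v) ->
  (forall i v, co i (sV v) = s (co i v)) ->
  W 0 -> (forall a x y, W x -> W y -> W (a *: x + y)) ->
  (forall x, W x -> W (sV x)) ->
  B 0 -> (forall a x y, B x -> B y -> B (a *: x + y)) ->
  (forall v, W v -> sV v = v -> B v) -> W `<=` B.
Proof.
move=> coL co_inj suppP coS W0 WL WS B0 BL WB.
have coD i x y : co i (x - y) = co i x - co i y.
  by rewrite -[x - y]addrC -scaleN1r coL mulN1r addrC.
have WD x y : W x -> W y -> W (x - y).
  by move=> Wx Wy; rewrite addrC -scaleN1r; apply: WL.
have co0 i : co i 0 = 0 by rewrite -(subrr (0 : V)) coD subrr.
pose cov (l : seq J) v := forall i, co i v != 0 -> i \in l.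
suff H k : forall w l, W w -> (size l < k)%N -> cov l w -> B w.
  by move=> w Ww; apply: (H _ w (supp w) Ww (ltnSn _)) => i; apply: suppP.
elim: k => // k IH w l Ww sl wl.
have [->//|w0] := eqVneq w 0.
(* Sizes of lists inside [l] that support a nonzero element of [W]; the element [u] reaching the
   least size has minimal support. *)
pose Q m := `[< exists u l', [/\ W u, u != 0, cov l' u, {subset l' <= l}
   & (size l' <= m)%N] >].
have exQ : exists m, Q m.
  by exists (size l); apply/asboolP; exists w, l; split.
case: (ex_minnP exQ) => m /asboolP[u [l' [Wu u0 ul' l'l sl']]] minm.
have small v i : W v -> cov l' v -> i \in l' -> co i v = 0 -> v = 0.
  move=> Wv vl' il' v0; apply/eqP; apply: contraTT isT => vn0.
  have /minm : Q (size [seq j <- l' | j != i]).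
    apply/asboolP; exists v, [seq j <- l' | j != i]; split=> //.
      move=> j cj; rewrite mem_filter vl' // andbT.
      by apply: contraNneq cj => ->; rewrite v0.
    by move=> j; rewrite mem_filter => /andP[_ /l'l].
  by rewrite leqNgt (leq_trans (size_filter_neq il') sl').
have [i il' ci] : exists2 i, i \in l' & co i u != 0.
  have : ~ (forall i, co i u = 0) by move=> /co_inj u00; rewrite u00 eqxx in u0.
  by move=> /existsNP[i /eqP ci]; exists i => //; apply: ul'.
have [w' [Ww' w'l' cw']] : [set a | exists w', [/\ W w', cov l' w' & co i w' = a]] 1.
  apply: simpleR; last by exists (co i u) => //; exists u.
    split; first by exists 0; split=> // j; rewrite co0 eqxx.
    move=> a _ _ [x [Wx xl' <-]] [y [Wy yl' <-]]; exists (a *: x + y).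
    split; rewrite ?coL //; first exact: WL.
    move=> j; rewrite coL => h; apply: contraTT isT => jl'.
    have /eqP xj : co j x == 0 by apply: contraNT jl'; apply: xl'.
    have /eqP yj : co j y == 0 by apply: contraNT jl'; apply: yl'.
    by rewrite xj yj mulr0 addr0 eqxx in h.
  move=> _ [x [Wx xl' <-]]; exists (sV x); split; rewrite ?coS //; first exact: WS.
  move=> j; rewrite coS => h; apply: xl'; apply: contraNneq h => ->.
  by rewrite rmorph0.
(* [sV w' - w'] is supported on [l'] and has coordinate 0 at [i], so minimality makes it 0. *)
have cstw' : sV w' = w'.
  apply/eqP; rewrite -subr_eq0; apply/eqP; apply: (small _ i) => //.
  - by apply: WD => //; apply: WS.
  - move=> j; rewrite coD coS => h; apply: w'l'; apply: contraNneq h => ->.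
    by rewrite rmorph0 subrr.
  - by rewrite coD coS cw' rmorph1 subrr.
(* Subtracting a multiple of the invariant [w'] removes [i] from the support of [w], and the
   induction on its size applies. *)
have -> : w = co i w *: w' + (w - co i w *: w') by rewrite addrC subrK.
apply: BL; first exact: WB.
apply: (IH _ [seq j <- l | j != i]).
- apply: WD => //; rewrite -[_ *: _]addr0; exact: WL.
- by apply: leq_trans (size_filter_neq (l'l _ il')) _; rewrite -ltnS.
move=> j; have cj : co j (w - co i w *: w') = co j w - co i w * co j w'.
  by rewrite coD -[_ *: w']addr0 coL co0 addr0.
rewrite cj mem_filter; have [->|ji] := eqVneq j i.
  by rewrite cw' mulr1 subrr eqxx.
move=> h; apply: contraTT isT => jl.
have /eqP a1 : co j w == 0 by apply: contraNT jl; apply: wl.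
have /eqP a2 : co j w' == 0 by apply: contraNT jl => /w'l'/l'l.
by rewrite a1 a2 mulr0 subrr eqxx in h.
Qed.
End SimpleRing.

(** * Picard-Vessiot extensions and constants *)

Lemma mpoly_closure n (R : comNzRingType) (B : set (mpoly n R)) :
  (forall c, B (mpolyC n c)) -> (forall i, B (mvar i)) ->
  (forall p q, B p -> B q -> B (p + q)) -> (forall p q, B p -> B q -> B (p * q)) ->
  forall p, B p.
Proof.
move=> BC BX BD BM p; elim/mpolyind: p => [|c m p _ _ Bp].
  by rewrite -(rmorph0 (@mpolyC n R)); apply: BC.
apply: BD => //; rewrite -mul_mpolyC; apply: (BM); first exact: BC.
rewrite mpolyXE_id; apply: (big_ind B).
- by rewrite -(rmorph1 (@mpolyC n R)); apply: BC.
- exact: BM.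
move=> i _; elim: (m i) => [|k IH]; first by rewrite expr0 -(rmorph1 (@mpolyC n R)); apply: BC.
by rewrite exprS; apply: (BM).
Qed.

Lemma mmap_var n (R T : comNzRingType) (f : {rmorphism R -> T}) h (i : 'I_n) :
  mmap f h (mvar i) = h i.
Proof. by rewrite mmapX mmap1U. Qed.

(** The span is described as the smallest subspace instead of by finite sums, so that the property
    passes easily to polynomial rings and their quotients; finite sums are recovered in
    [countably_spanned_fin]. *)
Definition countably_spanned (K R : comNzRingType) (j : K -> R) : Prop :=
  exists e : nat -> R, forall B : set R, B 0 ->
    (forall k x y, B x -> B y -> B (j k * x + y)) -> (forall i, B (e i)) ->
    forall x, B x.

Lemma countably_spanned_poly (K R Q : comNzRingType) (j : {rmorphism K -> R}) n
    (f : {rmorphism mpoly n R -> Q}) : (forall y, exists p, y = f p) ->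
  countably_spanned j -> countably_spanned (f \o @mpolyC n R \o j).
Proof.
move=> fsurj [e eP].
exists (fun i => if unpickle i is Some (k, m) then f (mpolyC n (e k) * mpolyX R m)
  else 0) => B B0 BL Be y.
have BD x z : B x -> B z -> B (x + z).
  by move=> Bx; move=> /(BL 1 _ _ Bx); rewrite /= !rmorph1 mul1r.
have [p ->] := fsurj y; rewrite (mpolyE p) rmorph_sum.
apply: (big_ind B) => // m _; rewrite -mul_mpolyC.
apply: (eP [set r | B (f (mpolyC n r * mpolyX R m))]) => /=.
- by rewrite rmorph0 mul0r rmorph0.
- move=> k r r' Br Br'; rewrite mpolyCD mulrDl rmorphD mpolyCM -mulrA rmorphM.
  exact: BL.
by move=> i; have := Be (pickle (i, m)); rewrite pickleK.
Qed.

Section Extension.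
Variables (K R : comNzRingType) (j : {rmorphism K -> R}) (s : {rmorphism R -> R}).

Section Universal.
Variables (n : nat) (A A' : 'M[R]_n).
Hypotheses (AA' : A *m A' = 1%:M).
Let N := (n * n + n * n)%N.
Let P := mpoly N R.
Let X : 'M[P]_n := \matrix_(k, l) mvar (lshift (n * n) (mxvec_index k l)).
Let Z : 'M[P]_n := \matrix_(k, l) mvar (rshift (n * n) (mxvec_index k l)).

Lemma universal_hom (T : comNzRingType) (f : {rmorphism R -> T}) (M1 M2 : 'M[T]_n) :
  exists g : {rmorphism P -> T}, [/\ forall c, g (mpolyC N c) = f c,
    map_mx g X = M1 & map_mx g Z = M2].
Proof.
exists (mmap f (fun i => row_mx (mxvec M1) (mxvec M2) 0 i)); split.
- by move=> c; exact: mmapC.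
- by apply/matrixP => k l; rewrite !mxE; apply: etrans (mmap_var _ _ _) _; rewrite row_mxEl mxvecE.
- by apply/matrixP => k l; rewrite !mxE; apply: etrans (mmap_var _ _ _) _; rewrite row_mxEr mxvecE.
Qed.

Let I : set P := [set p | forall J : set P, ideal J ->
  (forall k l, J ((X *m Z - 1%:M) k l)) -> J p].

Lemma ideal_sum (T : comNzRingType) (J : set T) (L : finType) (c x : L -> T) :
  ideal J -> (forall l, J (x l)) -> J (\sum_l c l * x l).
Proof.
move=> [J0 JL] Jx; apply: big_ind => // [x' y' Jx' Jy'|i _].
  by rewrite -[x']mul1r; apply: JL.
by rewrite -[_ * _]addr0; apply: JL.
Qed.

(** [P] is R[X, Z] with sigma X = [A] X and sigma Z = Z [A']; a simple quotient of it in which XZ =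
    1 adjoins a fundamental matrix and its inverse. Only finitely many generators are added, so
    countable dimension over K survives. *)
Lemma universal_extension : exists (Q : comNzRingType) (h : {rmorphism R -> Q})
    (t : {rmorphism Q -> Q}) (U V : 'M[Q]_n),
  [/\ forall x, t (h x) = h (s x), sigma_simple t,
      map_mx t U = map_mx h A *m U, U *m V = 1%:M
    & countably_spanned j -> countably_spanned (h \o j)].
Proof.
pose CC (M : 'M[R]_n) : 'M[P]_n := map_mx (@mpolyC N R) M.
have [g [gC gX gZ]] := universal_hom (@mpolyC N R \o s) (CC A *m X) (Z *m CC A').
have idI : ideal I.
  split=> [J [] //|c x y Ix Iy J idJ JE].
  by case: (idJ) => _; apply; [exact: Ix|exact: Iy].
have AA'C : CC A *m CC A' = 1%:M by rewrite /CC -map_mxM AA' map_mx1.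
have gE : map_mx g (X *m Z - 1%:M) = CC A *m (X *m Z - 1%:M) *m CC A'.
  rewrite map_mxB map_mxM map_mx1 gX gZ !mulmxBr !mulmxBl mulmx1 AA'C.
  by rewrite !mulmxA.
have gI p : I p -> I (g p).
  move=> Ip; move=> J idJ JE.
  apply: (Ip [set x | J (g x)]).
    split; first by rewrite /= rmorph0; case: idJ.
    by move=> c x y /= Jx Jy; rewrite rmorphD rmorphM; case: idJ => _; apply.
  move=> k l /=; have := congr1 (fun M : 'M_n => M k l) gE; rewrite mxE => ->.
  rewrite mxE; under eq_bigr do rewrite mulrC; apply: ideal_sum => // a.
  by rewrite mxE; apply: ideal_sum => // b.
(* The specialization X = Z = 1 sends XZ - 1 to 0, so the ideal is proper. *)
have [g1 [g1C g1X g1Z]] := universal_hom idfun (1%:M : 'M_n) (1%:M : 'M_n).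
have I1 : ~ I 1.
  move=> H; suff : g1 1 = 0 by rewrite rmorph1; apply/eqP; exact: oner_neq0.
  apply: (H [set p | g1 p = 0]).
    split; first by rewrite /= rmorph0.
    by move=> c x y /= x0 y0; rewrite rmorphD rmorphM x0 y0 mulr0 addr0.
  move=> k l /=; have -> : g1 ((X *m Z - 1%:M) k l) = map_mx g1 (X *m Z - 1%:M) k l.
    by rewrite [RHS]mxE.
  by rewrite map_mxB map_mxM map_mx1 g1X g1Z mulmx1 subrr mxE.
have [Q [h [t [hsurj hI th simpleQ]]]] := simple_quotient idI gI I1.
exists Q, (h \o @mpolyC N R), t, (map_mx h X), (map_mx h Z); split=> //.
- by move=> x /=; rewrite th gC.
- rewrite -map_mx_comp (eq_map_mx _ th) map_mx_comp gX map_mxM.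
  by rewrite -map_mx_comp.
- apply/eqP; rewrite -subr_eq0 -map_mxM -(map_mx1 h) -map_mxB; apply/eqP/matrixP => k l.
  by rewrite mxE [RHS]mxE; apply: hI => J _; apply.
exact: countably_spanned_poly.
Qed.
End Universal.
End Extension.

Section Constants.
Variables (F : closedFieldType) (K : fieldType) (c : {rmorphism F -> K})
  (sK : {rmorphism K -> K}).
Hypotheses (sKc : forall a, sK (c a) = c a)
  (sK_fix : forall x, sK x = x -> exists a, x = c a).
(** Uncountability in the form needed: a map to a countable set has an infinite fiber. *)
Hypothesis F_uncountable : forall h : F -> nat, exists N, forall m,
  exists l : seq F, [/\ uniq l, size l = m & forall a, a \in l -> h a = N].

Lemma field_sigma_simple : sigma_simple sK.
Proof.
move=> I [I0 IL] _ [x Ix x0]; rewrite -[1]addr0 -(mulVf x0); exact: IL.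
Qed.

Lemma countably_spanned_fin (R : comNzRingType) (j : {rmorphism K -> R}) :
  countably_spanned j -> exists e : nat -> R, forall x, exists N (k : 'I_N -> K),
    x = \sum_(i < N) j (k i) * e i.
Proof.
move=> [e eP]; exists e.
have : forall x, [set x | exists k : {poly K}, x = \sum_(i < size k) j k`_i * e i] x.
  have wide (k : {poly K}) N : (size k <= N)%N ->
      \sum_(i < size k) j k`_i * e i = \sum_(i < N) j k`_i * e i.
    move=> kN; rewrite (big_ord_widen N (fun i => j k`_i * e i) kN) big_mkcond /=.
    apply: eq_bigr => i _; case: ltnP => // ik.
    by rewrite nth_default // rmorph0 mul0r.
  apply: eP.
  - by exists 0; rewrite size_poly0 big_ord0.
  - move=> a _ _ [k ->] [k' ->]; exists (a *: k + k').
    set N := maxn (size k) (size k').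
    rewrite (wide k N) ?leq_maxl // (wide k' N) ?leq_maxr // (wide _ N); last first.
      apply: leq_trans (size_polyD _ _) _; rewrite geq_max leq_maxr andbT.
      by apply: leq_trans (size_scale_leq _ _) _; rewrite leq_maxl.
    rewrite mulr_sumr -big_split; apply: eq_bigr => i _.
    by rewrite coefD coefZ rmorphD rmorphM mulrDl mulrA.
  move=> i; exists 'X^i; rewrite size_polyXn big_ord_recr /= coefXn eqxx rmorph1 mul1r.
  rewrite big1 ?add0r // => k _.
  by rewrite coefXn (ltn_eqF (ltn_ord k)) rmorph0 mul0r.
move=> H x; have [k ->] := H x; exists (size k), (fun i => k`_i).
by [].
Qed.

(* If x is an invariant outside F, then the uncountably many invariants
   (x - a)^-1, a in F, are linearly dependent over K, hence over F, which makes x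
   algebraic over F. *)
Lemma simple_constants (R : comNzRingType) (j : {rmorphism K -> R})
    (s : {rmorphism R -> R}) :
  (forall k, s (j k) = j (sK k)) -> sigma_simple s -> countably_spanned j ->
  forall x, s x = x -> exists a, x = j (c a).
Proof.
move=> sj simpleR /countably_spanned_fin[e eP] x sx.
apply: contrapT => xP; pose jc := j \o c.
have xa a : x - jc a != 0.
  by apply/eqP => /eqP; rewrite subr_eq0 => /eqP xa; apply: xP; exists a.
have sxa a : s (x - jc a) = 1 * (x - jc a) by rewrite rmorphB sx /= sj sKc mul1r.
have [d dP] := choice (fun a => simple_semi_invariant_unit simpleR (sxa a) (xa a)).
have sd a : s (d a) = d a.
  have h : s (d a) * (x - jc a) = 1.
    by rewrite -[_ - _]mul1r -sxa -rmorphM dP rmorph1.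
  by rewrite -[LHS]mulr1 -(dP a) mulrCA h mulr1.
(* [hN a] is the number of generators used to write (x - a)^-1. On an infinite fiber it is a fixed
   [N], and [N.+1] of these inverses lie in a K-space spanned by [N] elements. *)
have [hN hP] := choice (fun a => eP (d a)).
have [N NP] := F_uncountable hN.
have [l [ul sl lN]] := NP N.+1.
pose al (i : 'I_N.+1) := l`_i.
have al_l i : al i \in l by rewrite mem_nth // sl.
have al_inj : injective al.
  by move=> i1 i2 /eqP; rewrite nth_uniq ?sl // => /eqP; apply: val_inj.
have dE i : exists k : 'I_N -> K, d (al i) = \sum_(m < N) j (k m) * e m.
  have [k ->] := hP (al i); have e1 := lN _ (al_l i).
  by move: k; rewrite e1 => k; exists k.
have [k kP] := choice dE.
pose W : set 'rV[K]_N.+1 := [set u | \sum_i j (u 0 i) * d (al i) = 0].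
have [u Wu u0] : exists2 u, W u & u != 0.
  pose M : 'M[K]_(N.+1, N) := \matrix_(i, m) k i m.
  have : kermx M != 0.
    rewrite -mxrank_eq0 mxrank_ker subn_eq0 -ltnNge.
    by apply: leq_ltn_trans (rank_leq_col _) _.
  case/rowV0Pn => u /sub_kermxP uM u0; exists u => //.
  rewrite /W /=; under eq_bigr do rewrite kP mulr_sumr.
  rewrite exchange_big big1 //= => m _.
  under eq_bigr do rewrite mulrA -rmorphM.
  rewrite -mulr_suml -rmorph_sum.
  have -> : \sum_i u 0 i * k i m = (u *m M) 0 m.
    by rewrite mxE; apply: eq_bigr => i _; rewrite mxE.
  by rewrite uM mxE rmorph0 mul0r.
(* The K-relations between the invariants [d (al i)] form a stable subspace; if it had no nonzero
   invariant vector, the generation lemma with [[set 0]] as target would make it 0. *)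
have [v [Wv v0 sv]] : exists v, [/\ W v, v != 0 & map_mx sK v = v].
  apply: contrapT => none; move/eqP: u0; apply.
  apply: (@stable_submodule_generated K sK field_sigma_simple 'rV[K]_N.+1 'I_N.+1
    (fun i v => v 0 i) (fun=> enum 'I_N.+1) (map_mx sK) W [set 0]) => //=.
  - by move=> i a y z; rewrite !mxE.
  - by move=> y y0; apply/rowP => i; rewrite mxE.
  - by move=> i y _; rewrite mem_enum.
  - by move=> i y; rewrite mxE.
  - by rewrite /W /= big1 // => i _; rewrite mxE rmorph0 mul0r.
  - move=> a y z Wy Wz; rewrite /W /=.
    under eq_bigr do rewrite !mxE rmorphD rmorphM mulrDl -mulrA.
    by rewrite big_split -mulr_sumr /= Wy Wz mulr0 addr0.
  - move=> y Wy; have h := congr1 s Wy; rewrite rmorph0 rmorph_sum in h.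
    apply: etrans h; apply: eq_bigr => i _.
    by rewrite mxE rmorphM sj sd.
  - by move=> a y z -> ->; rewrite scaler0 addr0.
  - by move=> y Wy sy; apply: contrapT => /eqP y0; apply: none; exists y.
have cv i : exists a, v 0 i = c a.
  by apply: sK_fix; rewrite -[in RHS]sv mxE.
have [b bP] := choice cv.
have [i0 bi0] : exists i, b i != 0.
  apply: contrapT => /forallNP none; move/eqP: v0; apply; apply/rowP => i.
  by rewrite bP mxE; have /negP := none i; rewrite negbK => /eqP ->; rewrite rmorph0.
(* The relation between the (x - al i)^-1 with denominators cleared. At [al i0] only the term of
   index [i0] survives, so [p] is not 0. *)
pose p : {poly F} := \sum_i b i *: \prod_(i' | i' != i) ('X - (al i')%:P).
have p0 : p != 0.
  suff : p.[al i0] != 0 by apply: contraNneq => ->; rewrite horner0.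
  rewrite /p horner_sum (bigD1 i0) //= [X in _ + X]big1 ?addr0 => [|i ii0].
    rewrite hornerZ mulf_neq0 // horner_prod prodf_seq_neq0; apply/allP => i _.
    apply/implyP => ii0; rewrite hornerXsubC subr_eq0; apply: contraNneq ii0.
    by move=> /al_inj ->.
  rewrite hornerZ horner_prod (bigD1 i0) 1?eq_sym //= hornerXsubC subrr.
  by rewrite mul0r mulr0.
have jcx : commr_rmorph jc x by move=> a; exact: mulrC.
have px : horner_morph jcx p = 0.
  rewrite rmorph_sum /=.
  transitivity ((\sum_i j (v 0 i) * d (al i)) * \prod_i (x - jc (al i))).
    rewrite mulr_suml; apply: eq_bigr => i _.
    rewrite -mul_polyC rmorphM /= horner_morphC bP -mulrA; congr (_ * _).
    rewrite rmorph_prod [in RHS](bigD1 i) //= [RHS]mulrA dP mul1r.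
    by apply: eq_bigr => i' _; rewrite rmorphB /= horner_morphX horner_morphC.
  by rewrite Wv mul0r.
(* As R may have zero divisors, p(x) = 0 does not single out a vanishing factor; but every factor x
   - a is invertible with inverse [d a], whence 1 = 0. *)
have [r rE] := closed_field_poly_normal p.
have lc : lead_coef p != 0 by rewrite lead_coef_eq0.
have : \prod_(a <- r) (x - jc a) = 0.
  have : jc (lead_coef p) * \prod_(a <- r) (x - jc a) = 0.
    rewrite -[RHS]px [in RHS]rE -mul_polyC rmorphM /= horner_morphC; congr (_ * _).
    rewrite rmorph_prod; apply: eq_bigr => a _.
    by rewrite rmorphB /= horner_morphX horner_morphC.
  move=> /(congr1 (fun y => jc (lead_coef p)^-1 * y)).
  by rewrite mulrA -rmorphM mulVf // rmorph1 mul1r mulr0.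
move=> /(congr1 (fun y => (\prod_(a <- r) d a) * y)).
rewrite -big_split big1 /= => [|a _]; last exact: dP.
by rewrite mulr0 => /eqP; rewrite oner_eq0.
Qed.
End Constants.

(** * Extension of derivations *)

(** The dual numbers E[eps], eps^2 = 0: d is a derivation of E if and only if x -> (x, d x) is a
    ring morphism, so derivations can be constructed and extended as morphisms. *)
Definition dual (E : Type) : Type := (E * E)%type.

Section Dual.
Variable E : comNzRingType.

HB.instance Definition _ := GRing.Zmodule.copy (dual E) (E * E)%type.

Definition dual_mul (x y : dual E) : dual E := (x.1 * y.1, x.1 * y.2 + x.2 * y.1).

Fact dual_mulA : associative dual_mul.
Proof. by move=> x y z; congr (_, _) => /=; ring. Qed.

Fact dual_mulC : commutative dual_mul.
Proof. by move=> x y; congr (_, _) => /=; ring. Qed.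

Fact dual_mul1 : left_id ((1, 0) : dual E) dual_mul.
Proof. by move=> [x y]; congr (_, _) => /=; ring. Qed.

Fact dual_mulDl : left_distributive dual_mul +%R.
Proof. by move=> [x x'] [y y'] [z z']; congr (_, _) => /=; ring. Qed.

Fact dual_one_neq0 : ((1, 0) : dual E) != 0.
Proof. by apply/eqP => -[] /eqP; rewrite oner_eq0. Qed.

HB.instance Definition _ := GRing.Zmodule_isComNzRing.Build (dual E)
  dual_mulA dual_mulC dual_mul1 dual_mulDl dual_one_neq0.

Lemma dual1 : (1 : dual E) = (1, 0).
Proof. by []. Qed.

Lemma dualM (x y : dual E) : x * y = (x.1 * y.1, x.1 * y.2 + x.2 * y.1).
Proof. by []. Qed.

Lemma dualD (x y : dual E) : x + y = (x.1 + y.1, x.2 + y.2).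
Proof. by []. Qed.

Lemma dualN (x : dual E) : - x = (- x.1, - x.2).
Proof. by []. Qed.
End Dual.

Lemma horner_nilsquare (R : comNzRingType) (p : {poly R}) (a e : R) :
  e * e = 0 -> p.[a + e] = p.[a] + p^`().[a] * e.
Proof.
move=> ee; elim/poly_ind: p => [|p c IH]; first by rewrite derivC !horner0 mul0r addr0.
rewrite !hornerMXaddC derivD derivC addr0 derivM derivX mulr1 hornerD hornerM hornerX IH.
have -> : (p.[a] + p^`().[a] * e) * (a + e) + c =
  p.[a] * a + c + (p^`().[a] * a + p.[a]) * e + p^`().[a] * (e * e) by ring.
by rewrite ee mulr0 addr0.
Qed.

Definition derivation (E : comNzRingType) (d : E -> E) : Prop :=
  (forall x y, d (x + y) = d x + d y) /\ (forall x y, d (x * y) = d x * y + x * d y).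

Section DerivationExtension.
Variable E : fieldType.
Hypothesis char0 : forall n, n.+1%:R != 0 :> E.

(* The graph of a derivation of a subring of E, inside the dual numbers. *)
Definition partial_derivation (M : set (dual E)) : Prop :=
  [/\ M 1, forall u v, M u -> M v -> M (u - v), forall u v, M u -> M v -> M (u * v)
    & forall u, M u -> u.1 = 0 -> u = 0].

Section Step.
Variable (M : set (dual E)).
Hypothesis PM : partial_derivation M.

Let M1 : M 1. Proof. by case: PM. Qed.
Let MB u v : M u -> M v -> M (u - v). Proof. by case: PM => _ + _ _; apply. Qed.
Let MM u v : M u -> M v -> M (u * v). Proof. by case: PM => _ _ + _; apply. Qed.
Let Mfun u : M u -> u.1 = 0 -> u = 0. Proof. by case: PM => _ _ _; apply. Qed.
Let M0 : M 0. Proof. by rewrite -(subrr 1); apply: MB. Qed.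
Let MD u v : M u -> M v -> M (u + v).
Proof. by move=> Mu Mv; rewrite -[v]opprK -[- v]sub0r; apply: MB => //; apply: MB. Qed.

Definition over (p : {poly dual E}) := forall i, M p`_i.

Lemma overB p q : over p -> over q -> over (p - q).
Proof. by move=> op oq i; rewrite coefB; apply: MB. Qed.

Lemma overM p q : over p -> over q -> over (p * q).
Proof. by move=> op oq i; rewrite coefM; apply: big_ind => // k _; apply: MM. Qed.

Lemma overC c : M c -> over c%:P.
Proof. by move=> Mc i; rewrite coefC; case: eqP. Qed.

Lemma overXn n : over 'X^n.
Proof. by move=> i; rewrite coefXn; case: eqP. Qed.

Lemma over_deriv p : over p -> over p^`().
Proof. move=> op i; rewrite coef_deriv; elim: {2}(i.+1) => [|k IH]; first by rewrite mulr0n.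
by rewrite mulrS; apply: MD. Qed.

Lemma over_lead p : over p -> p != 0 -> (lead_coef p).1 != 0.
Proof. by move=> op; apply: contraNneq => /(Mfun (op _)) /eqP; rewrite lead_coef_eq0. Qed.

Lemma horner_dual1 (p : {poly dual E}) x y y' : (p.[(x, y)]).1 = (p.[(x, y')]).1.
Proof.
elim/poly_ind: p => [|p c IH]; first by rewrite !horner0.
by rewrite !hornerMXaddC !dualD !dualM /= IH.
Qed.

(** If x is transcendental over the domain of the derivation, any y will do, here 0. Otherwise a
    relation p of minimal degree forces y = - p^d(x) / p'(x), where p^d has the differentiated
    coefficients and p^d(x) is the second component of [p.[(x, 0)]]; p'(x) is nonzero by minimality
    and characteristic 0. *)
Lemma adjoin_point x : exists y, forall q, over q -> (q.[(x, y)]).1 = 0 -> q.[(x, y)] = 0.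
Proof.
pose Q m := `[< exists p, [/\ over p, p != 0, (p.[(x, 0)]).1 = 0 & size p = m] >].
have [[m Qm]|none] := pselect (exists m, Q m); last first.
  exists 0 => q oq q0; have [->|qn0] := eqVneq q 0; first by rewrite horner0.
  by case: none; exists (size q); apply/asboolP; exists q.
case: (ex_minnP (ex_intro _ m Qm)) => {Qm}m /asboolP[p [op p0 px sp]] minm.
have small q : over q -> (size q < size p)%N -> (q.[(x, 0)]).1 = 0 -> q = 0.
  move=> oq sq qx; apply/eqP; apply: contraTT isT => qn0.
  have /minm : Q (size q) by apply/asboolP; exists q.
  by rewrite -sp leqNgt sq.
have l0 := over_lead op p0; set l := lead_coef p in l0.
have sp1 : (1 < size p)%N.
  rewrite ltnNge; apply/negP => /size1_polyC pC.
  move: px p0; rewrite pC hornerC => /(Mfun (op _)) ->.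
  by rewrite polyC0 eqxx.
have dp0 : (p^`().[(x, 0)]).1 != 0.
  apply: contraTneq isT => /(small _ (over_deriv op) (lt_size_deriv p0)) dp0.
  have := congr1 (fun q : {poly dual E} => (q`_(size p).-2).1) dp0.
  rewrite coef_deriv coef0 -[X in X = _]/((p`_(size p).-2.+1 *+ (size p).-2.+1).1).
  have -> : (size p).-2.+1 = (size p).-1 by case: (size p) sp1 => [|[]].
  rewrite -mulr_natr dualM /=.
  have -> n : (n%:R : dual E).1 = n%:R by elim: n => // n IH; rewrite !mulrS /= IH.
  move=> /eqP; rewrite mulf_eq0 (negPf l0) /=.
  case: (size p) sp1 => [|[|k]] //= _; by rewrite (negPf (char0 k)).
pose y := - (p.[(x, 0)]).2 / (p^`().[(x, 0)]).1; exists y.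
have pxi : p.[(x, y)] = 0.
  have -> : (x, y) = (x, 0) + (0, y) :> dual E by rewrite dualD /= addr0 add0r.
  rewrite horner_nilsquare ?dualM /= ?mul0r ?mulr0 ?addr0 // dualD /= px.
  by congr (_, _); rewrite /= ?mulr0 ?addr0 // /y mulrC mulfVK // addrN.
move=> q; move: {2}(size q).+1 (ltnSn (size q)) => k; elim: k q => // k IH q sq oq qx.
have [sqp|spq] := ltnP (size q) (size p).
  by rewrite (small q) ?horner0 // (horner_dual1 _ _ _ y).
(* Pseudo-division by [p]: the coefficients only form a ring, hence the factor [l], whose first
   component is nonzero. *)
pose q' := l%:P * q - (lead_coef q)%:P * p * 'X^(size q - size p).
have q'x : q'.[(x, y)] = l * q.[(x, y)].
  by rewrite /q' hornerD hornerN !hornerM !hornerC pxi mulr0 mul0r subr0.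
have sq' : (size q' < size q)%N.
  have q0 : (0 < size q)%N by apply: leq_trans spq; rewrite (leq_trans _ sp1).
  rewrite -[in X in (_ < X)%N](prednK q0) ltnS; apply/leq_sizeP => i.
  rewrite leq_eqVlt => /predU1P[<-|iq]; rewrite coefB -mulrA !coefCM coefMXn.
    have e1 : ((size q).-1 - (size q - size p))%N = (size p).-1 by lia.
    have e2 : ((size q).-1 < size q - size p)%N = false by lia.
    by rewrite e1 e2 -!lead_coefE -/l mulrC subrr.
  have iq' : (size q <= i)%N by rewrite -(prednK q0).
  rewrite (nth_default 0 iq') mulr0; case: ifP => _; first by rewrite mulr0 subr0.
  have ip : (size p <= i - (size q - size p))%N.
    by rewrite leq_subRL ?(leq_trans (leq_subr _ _)) // subnK.
  by rewrite (nth_default 0 ip) mulr0 subr0.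
have oq' : over q'.
  apply: overB; first by apply: overM => //; apply: overC; exact: op.
  apply: overM; last exact: overXn.
  by apply: overM => //; apply: overC; exact: oq.
have := IH q' (leq_trans sq' sq) oq'; rewrite q'x dualM /= qx mulr0 => /(_ erefl).
move=> [] /eqP; rewrite mulr0 addr0 mulf_eq0 (negPf l0) /= => /eqP q2.
by case: (q.[(x, y)]) qx q2 => a b /= -> ->.
Qed.

Lemma adjoin_partial x : exists y M', [/\ partial_derivation M', M `<=` M' & M' (x, y)].
Proof.
have [y yP] := adjoin_point x; exists y, [set u | exists2 q, over q & u = q.[(x, y)]].
split.
- split.
  + by exists 1%:P; [exact: overC|rewrite hornerC].
  + move=> _ _ [p op ->] [q oq ->]; exists (p - q); first exact: overB.
    by rewrite hornerD hornerN.
  + by move=> _ _ [p op ->] [q oq ->]; exists (p * q); [exact: overM|rewrite hornerM].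
  + by move=> _ [p op ->]; apply: yP.
- by move=> u Mu; exists u%:P; [exact: overC|rewrite hornerC].
by exists 'X; [rewrite -['X]expr1; exact: overXn|rewrite hornerX].
Qed.
End Step.

Lemma derivation_extension (M0 : set (dual E)) : partial_derivation M0 ->
  exists2 d : E -> E, derivation d & forall u, M0 u -> d u.1 = u.2.
Proof.
move=> PM0; have [M [PM M0M maxM]] : exists M, [/\ partial_derivation M, M0 `<=` M &
    forall B, partial_derivation B -> M `<=` B -> B = M].
  apply: zorn_above => // C CP CM0 _ tot; split.
  - by exists M0 => //; case: PM0.
  - move=> u v [A CA Au] [B CB Bv]; case: (tot _ _ CA CB) => sub.
      by exists B => //; case: (CP _ CB) => _ + _ _; apply=> //; apply: sub.
    by exists A => //; case: (CP _ CA) => _ + _ _; apply=> //; apply: sub.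
  - move=> u v [A CA Au] [B CB Bv]; case: (tot _ _ CA CB) => sub.
      by exists B => //; case: (CP _ CB) => _ _ + _; apply=> //; apply: sub.
    by exists A => //; case: (CP _ CA) => _ _ + _; apply=> //; apply: sub.
  - by move=> u [A CA Au]; case: (CP _ CA) => _ _ _; apply.
have total x : exists y, M (x, y).
  have [y [M' [PM' MM' M'x]]] := adjoin_partial PM x.
  by exists y; rewrite -(maxM _ PM' MM').
have [d dM] := choice total.
case: PM => M1 MB MM Mfun.
have MdE u : M u -> d u.1 = u.2.
  move=> Mu; have := Mfun _ (MB _ _ (dM u.1) Mu); rewrite dualD dualN /= subrr.
  by move=> /(_ erefl) [] /eqP; rewrite subr_eq0 => /eqP.
exists d; last by move=> u /M0M/MdE.
split=> x y.
  have M0' : M 0 by rewrite -(subrr 1); apply: MB.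
  have := MB _ _ (dM x) (MB _ _ M0' (dM y)); rewrite sub0r opprK => /MdE.
  by rewrite dualD.
by have /MdE := MM _ _ (dM x) (dM y); rewrite dualM /= addrC.
Qed.
End DerivationExtension.

(** * Residue fields at minimal primes *)

Section GenericField.

(** A quotient ring comes without an inversion; one is supplied by choice, which turns the ring into
    an [idomainType] with a fraction field. *)
Lemma domain_fraction_field (Q : comNzRingType) :
  (forall x y : Q, x * y = 0 -> x = 0 \/ y = 0) ->
  exists (E : fieldType) (f : {rmorphism Q -> E}), injective f.
Proof.
move=> dom.
pose unit : pred Q := fun x => `[< exists y, y * x = 1 >].
pose inv (x : Q) := xget x [set y | y * x = 1].
have invP : {in unit, left_inverse 1 inv *%R}.
  move=> x /asboolP[y yx]; rewrite /inv; case: xgetP => [z _ //|/(_ y)].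
  by move=> /(_ yx).
have unitP (x y : Q) : y * x = 1 -> unit x by move=> yx; apply/asboolP; exists y.
have invO : {in [predC unit], inv =1 id}.
  move=> x /asboolPn nx; rewrite /inv; case: xgetP => // y _ yx.
  by case: nx; exists y.
have domB (x y : Q) : x * y = 0 -> (x == 0) || (y == 0).
  by move=> /dom[->|->]; rewrite eqxx ?orbT.
pose m1 := GRing.ComNzRing_hasMulInverse.Build Q invP unitP invO.
pose Q1 : comUnitRingType := HB.pack_for comUnitRingType Q m1.
pose m2 := GRing.ComUnitRing_isIntegral.Build Q1 domB.
pose Q2 : idomainType := HB.pack_for idomainType Q1 m2.
have [||g gE] := @rmorphism_pack Q {fraction Q2} (@FracField.tofrac Q2).
- exact: (rmorphB (@FracField.tofrac Q2)).
- by split; [exact: (rmorph1 (@FracField.tofrac Q2))|exact: (rmorphM (@FracField.tofrac Q2))].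
exists {fraction Q2}, g => x y; rewrite !gE => e.
by have := @tofrac_eq Q2 x y; rewrite e eqxx => /esym/eqP.
Qed.

Definition mult_set (R : comNzRingType) (T : set R) : Prop :=
  [/\ T 1, forall x y, T x -> T y -> T (x * y) & ~ T 0].

Definition reduced (R : comNzRingType) : Prop := forall (x : R) n, x ^+ n = 0 -> x = 0.

(** The nilradical is a stable ideal that does not contain 1. *)
Lemma simple_reduced (R : comNzRingType) (s : {rmorphism R -> R}) :
  sigma_simple s -> reduced R.
Proof.
move=> simpleR x n xn; apply/eqP; apply: contraTT isT => x0.
have : [set y : R | exists n, y ^+ n = 0] 1.
  apply: simpleR; last by exists x => //; exists n.
    split; first by exists 1%N; rewrite expr1.
    move=> c y z [k yk] [l zl]; exists (k + l)%N.
    rewrite exprDn big1 // => i _.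
    have [il|li] := leqP l i.
      by rewrite -(subnKC il) [z ^+ _]exprD zl mul0r mulr0 mul0rn.
    have ki : (k <= k + l - i)%N by rewrite -addnBA ?leq_addr // ltnW.
    by rewrite -(subnKC ki) exprD exprMn yk mulr0 !mul0r mul0rn.
  by move=> y [k yk]; exists k; rewrite -rmorphXn yk rmorph0.
by move=> [k /eqP]; rewrite expr1n oner_eq0.
Qed.

(** The complement of a maximal multiplicative set is a minimal prime; in a reduced ring the
    localization there is a field, so every element of the prime is killed by an element outside of
    it. *)
Lemma maximal_mult_set (R : comNzRingType) (T0 : set R) : reduced R -> mult_set T0 ->
  exists T, [/\ mult_set T, T0 `<=` T & forall x, ~ T x -> exists2 t, T t & t * x = 0].
Proof.
move=> redR mT0.
have [T [mT T0T maxT]] : exists T, [/\ mult_set T, T0 `<=` T &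
    forall B, mult_set B -> T `<=` B -> B = T].
  apply: zorn_above => // C CP CT0 _ tot; split.
  - by exists T0 => //; case: mT0.
  - move=> u v [A CA Au] [B CB Bv]; case: (tot _ _ CA CB) => sub.
      by exists B => //; case: (CP _ CB) => _ + _; apply=> //; apply: sub.
    by exists A => //; case: (CP _ CA) => _ + _; apply=> //; apply: sub.
  - by move=> [A CA A0]; case: (CP _ CA).
exists T; split=> // x Tx; case: mT => T1 TM T0'.
apply: contrapT => none.
(* If no element of [T] kills [x], the monoid generated by [T] and [x] avoids 0, because t x^n = 0
   makes t x nilpotent; this contradicts maximality. *)
have TB : T `<=` [set y | exists t n, T t /\ y = t * x ^+ n].
  by move=> t Tt; exists t, 0%N; rewrite expr0 mulr1.
have mB : mult_set [set y | exists t n, T t /\ y = t * x ^+ n].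
  split; first exact: TB.
    move=> _ _ [t [n [Tt ->]]] [t' [n' [Tt' ->]]]; exists (t * t'), (n + n')%N.
    by split; [exact: TM|rewrite exprD mulrACA].
  move=> [t [n [Tt tx]]]; apply: none; exists t => //.
  have [n0|n0] := posnP n.
    by move: tx; rewrite n0 expr0 mulr1 => t0; rewrite -t0 in Tt.
  apply: (redR _ n); rewrite exprMn -(prednK n0) [t ^+ _]exprS prednK //.
  by rewrite -mulrA mulrCA -tx mulr0.
by apply: Tx; rewrite -(maxT _ mB TB); exists 1, 1%N; rewrite expr1 mul1r.
Qed.

Lemma prime_field (R : comNzRingType) (T : set R) : mult_set T ->
  (forall x, ~ T x -> exists2 t, T t & t * x = 0) ->
  exists (E : fieldType) (f : {rmorphism R -> E}), forall x, f x = 0 <-> ~ T x.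
Proof.
move=> [T1 TM T0] TP.
have TN x t : T t -> t * x = 0 -> ~ T x.
  by move=> Tt tx Tx; apply: T0; rewrite -tx; apply: TM.
have idT : ideal (~` T).
  split=> // c x y /TP[t Tt tx] /TP[u Tu uy]; apply: (TN _ (t * u)); first exact: TM.
  have -> : t * u * (c * x + y) = u * c * (t * x) + t * (u * y) by ring.
  by rewrite tx uy !mulr0 addr0.
have [Q [h [hsurj hT]]] := ideal_quotient idT (fun NT1 : (~` T) 1 => NT1 T1).
have [|E [f finj]] := @domain_fraction_field Q.
  move=> x y; have [u ->] := hsurj x; have [v ->] := hsurj y.
  rewrite -rmorphM => /hT Nuv; have [Tu|Nu] := pselect (T u).
    have [Tv|Nv] := pselect (T v); first by case: Nuv; apply: TM.
    by right; apply/hT.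
  by left; apply/hT.
exists E, (f \o h) => x; split=> [/eqP|/hT /= ->]; last exact: rmorph0.
by rewrite -(rmorph0 f) => /eqP/finj/hT.
Qed.

(** E is the residue field of R at a minimal prime, a substitute for a fraction field in the
    presence of zero divisors. Enlarging the image of a maximal multiplicative set of S makes this
    prime lie over a minimal prime of S, which gives the last property. *)
Lemma generic_field (S R : comNzRingType) (h : {rmorphism S -> R}) :
  injective h -> reduced S -> reduced R ->
  exists (E : fieldType) (f : {rmorphism R -> E}),
    forall x, f (h x) = 0 -> exists2 t, t * x = 0 & f (h t) != 0.
Proof.
move=> hinj redS redR.
have m1 : mult_set [set 1 : S].
  split=> // [x y -> ->|]; first by rewrite mulr1.
  by move=> /= /esym/eqP; rewrite oner_eq0.
have [T [[T1 TM T0] _ TP]] := maximal_mult_set redS m1.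
have m2 : mult_set [set h t | t in T].
  split; first by exists 1 => //; rewrite rmorph1.
    move=> _ _ [t Tt <-] [u Tu <-]; exists (t * u); first exact: TM.
    by rewrite rmorphM.
  by move=> [t Tt]; rewrite -(rmorph0 h) => /hinj t0; rewrite t0 in Tt.
have [T' [mT' hT' T'P]] := maximal_mult_set redR m2.
have [E [f fP]] := prime_field mT' T'P; exists E, f => x /fP Nx.
have /TP[t Tt tx] : ~ T x by move=> Tx; apply: Nx; apply: hT'; exists x.
exists t => //; apply/eqP => /fP; apply; apply: hT'; by exists t.
Qed.
End GenericField.

(** * Derivations tangent to the Galois group *)

(** S may have zero divisors, but the differences of distinct points in the image of F are units,
    which is enough to bound the number of roots there by the degree. *)
Lemma horner_image_eq0 (F : fieldType) (S : comNzRingType) (f : {rmorphism F -> S})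
    (p : {poly S}) (l : seq F) : uniq l -> (forall a, a \in l -> p.[f a] = 0) ->
  (size p <= size l)%N -> p = 0.
Proof.
elim: l p => [|a l IH] p /=; first by rewrite leqn0 size_poly_eq0 => _ _ /eqP.
case/andP=> al ul lp sp; apply/eqP; apply: contraTT isT => p0.
have /factor_theorem[q pE] : root p (f a) by rewrite rootE lp ?mem_head ?eqxx.
have q0 : q != 0 by apply: contraNneq p0 => q0; rewrite pE q0 mul0r.
have : q = 0; last by move/eqP; rewrite (negPf q0).
apply: IH => // [b bl|].
  have ab : b - a != 0 by rewrite subr_eq0; apply: contraNneq al => <-.
  have : p.[f b] = 0 by apply: lp; rewrite inE bl orbT.
  rewrite pE hornerM hornerXsubC -rmorphB => /(congr1 (fun x => x * f (b - a)^-1)).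
  by rewrite -mulrA -rmorphM mulfV // rmorph1 mulr1 mul0r.
rewrite -ltnS; apply: leq_trans sp.
by rewrite pE (size_Mmonic q0 (monicXsubC _)) size_XsubC addn2.
Qed.

Section Tangents.
Variables (F K : fieldType) (c : {rmorphism F -> K}).
Hypothesis char0 : forall n, n.+1%:R != 0 :> F.
Variables (S : comNzRingType) (j : {rmorphism K -> S}) (s : {rmorphism S -> S}).
Variables (n : nat) (U V : 'M[S]_n).
Hypothesis UV : U *m V = 1%:M.
Hypothesis genS : forall B : set S, (forall k, B (j k)) ->
  (forall x y, B x -> B y -> B (x + y)) -> (forall x y, B x -> B y -> B (x * y)) ->
  (forall k l, B (U k l)) -> (forall k l, B (V k l)) -> forall x, B x.

Definition constant_mx : 'M[F]_n -> 'M[S]_n := map_mx (j \o c).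

Definition endo_matrix (M : 'M[F]_n) : Prop := exists f : {rmorphism S -> S},
  [/\ forall k, f (j k) = j k, forall x, f (s x) = s (f x)
    & map_mx f U = U *m constant_mx M].

(** The exponential exp(t e), with e^2 / 2 as [e2]. The quadratic term is there for the orthogonal
    groups, whose tangents below satisfy e^3 = 0 but not e^2 = 0. *)
Definition curve (e e2 : 'M[F]_n) (t : F) : 'M[F]_n := 1%:M + t *: e + t ^+ 2 *: e2.

Definition tangent (e : 'M[F]_n) : Prop := exists e2,
  (forall t, endo_matrix (curve e e2 t)) /\
  (forall t, curve e e2 t *m curve e e2 (- t) = 1%:M).

Lemma poly_curve_eq0 (p : {poly S}) : (forall t, p.[(j \o c) t] = 0) -> p = 0.
Proof.
move=> pt; apply: (@horner_image_eq0 _ _ (j \o c) p [seq i%:R | i <- iota 0 (size p)]).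
- rewrite map_inj_uniq ?iota_uniq // => a b.
  have natr_inj k m : k%:R = (k + m)%:R :> F -> m = 0%N.
    case: m => // m; rewrite natrD -[X in X = _]addr0 => /addrI /esym /eqP.
    by rewrite (negPf (char0 m)).
  by have [ab|/ltnW ab] := leqP a b; [|move=> /esym]; rewrite -(subnKC ab) => /natr_inj ->;
    rewrite addn0.
- by move=> a _; exact: pt.
by rewrite size_map size_iota.
Qed.

(** Differentiation at t = 0 of the endomorphisms f_t belonging to the curve. By generation f_t x is
    a polynomial [P x] in t, unique because F is infinite; hence [P] is a ring morphism, and [D] is
    its reduction modulo t^2. *)
Lemma tangent_hom (e : 'M[F]_n) : tangent e -> exists D : {rmorphism S -> dual S},
  [/\ forall x, (D x).1 = x, forall k, (D (j k)).2 = 0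
    & map_mx (fun x => (D x).2) U = U *m constant_mx e].
Proof.
move=> [e2 [endo inv]].
have [f fP] := choice endo.
have fj t k : f t (j k) = j k by have [] := fP t.
have fU t : map_mx (f t) U = U *m constant_mx (curve e e2 t) by have [] := fP t.
have constM M M' : constant_mx (M *m M') = constant_mx M *m constant_mx M'.
  exact: map_mxM.
have fV t : map_mx (f t) V = constant_mx (curve e e2 (- t)) *m V.
  have h : map_mx (f t) V *m map_mx (f t) U = 1%:M.
    by rewrite -map_mxM (mulmx1C UV) map_mx1.
  have : map_mx (f t) V *m map_mx (f t) U *m (constant_mx (curve e e2 (- t)) *m V) =
      map_mx (f t) V.
    rewrite fU -!mulmxA (mulmxA (constant_mx _) (constant_mx _)) -constM inv.
    by rewrite /constant_mx map_mx1 mul1mx UV mulmx1.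
  by rewrite h mul1mx.
have f0 x : f 0 x = x.
  move: x; apply: genS => [k|x y ex ey|x y ex ey|k l|k l].
  - exact: fj.
  - by rewrite rmorphD ex ey.
  - by rewrite rmorphM ex ey.
  - have := congr1 (fun M : 'M_n => M k l) (fU 0).
    by rewrite /curve expr0n !scale0r !addr0 /constant_mx map_mx1 mulmx1 mxE.
  have := congr1 (fun M : 'M_n => M k l) (fV 0).
  by rewrite /curve oppr0 expr0n !scale0r !addr0 /constant_mx map_mx1 mul1mx mxE.
have polyP x : exists p : {poly S}, forall t, f t x = p.[(j \o c) t].
  move: x; apply: genS => [k|x y [p pP] [q qP]|x y [p pP] [q qP]|k l|k l].
  - by exists (j k)%:P => t; rewrite hornerC fj.
  - by exists (p + q) => t; rewrite rmorphD pP qP hornerD.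
  - by exists (p * q) => t; rewrite rmorphM pP qP hornerM.
  - exists ((U k l)%:P + ((U *m constant_mx e) k l)%:P * 'X +
      ((U *m constant_mx e2) k l)%:P * 'X ^+ 2) => t.
    have := congr1 (fun M : 'M_n => M k l) (fU t); rewrite mxE => ->.
    rewrite /constant_mx /curve !map_mxD map_mx1 !map_mxZ !mulmxDr mulmx1 -!scalemxAr.
    by rewrite !mxE !hornerE /= expr2 !rmorphM /=; ring.
  exists ((V k l)%:P - ((constant_mx e *m V) k l)%:P * 'X +
      ((constant_mx e2 *m V) k l)%:P * 'X ^+ 2) => t.
  have := congr1 (fun M : 'M_n => M k l) (fV t); rewrite mxE => ->.
  rewrite /constant_mx /curve !map_mxD map_mx1 !map_mxZ !mulmxDl mul1mx -!scalemxAl.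
  by rewrite !mxE !hornerE /= expr2 !rmorphM /= !rmorphN; ring.
have [P PP] := choice polyP.
have Peq x q : (forall t, f t x = q.[(j \o c) t]) -> P x = q.
  move=> h; apply/eqP; rewrite -subr_eq0; apply/eqP; apply: poly_curve_eq0 => t.
  by rewrite hornerD hornerN -PP h subrr.
have P0 x : (P x)`_0 = x by rewrite -horner_coef0 -[in RHS](f0 x) PP /= !rmorph0.
have [||D DE] := @rmorphism_pack S (dual S) (fun x => ((P x)`_0, (P x)`_1)).
- move=> x y; rewrite (_ : P (x - y) = P x - P y) ?coefB //.
  by apply: Peq => t; rewrite rmorphB !PP hornerD hornerN.
- split=> [|x y].
    rewrite (_ : P 1 = 1) ?coef1 //.
    by apply: Peq => t; rewrite rmorph1 hornerC.
  rewrite (_ : P (x * y) = P x * P y); last by apply: Peq => t; rewrite rmorphM !PP hornerM.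
  rewrite dualM /= !coefM !big_ord_recl !big_ord0 /= !addr0; congr (_, _).
exists D; split=> [x|k|].
- by rewrite DE P0.
- by rewrite DE /= (Peq _ (j k)%:P) ?coefC // => t; rewrite hornerC fj.
apply/matrixP => k l; rewrite mxE DE /=.
rewrite (Peq _ ((U k l)%:P + ((U *m constant_mx e) k l)%:P * 'X +
      ((U *m constant_mx e2) k l)%:P * 'X ^+ 2)).
  by rewrite !coefD !coefCM coefC coefX coefXn /= mulr1 mulr0 addr0 add0r.
move=> t; have := congr1 (fun M : 'M_n => M k l) (fU t); rewrite mxE => ->.
rewrite /constant_mx /curve !map_mxD map_mx1 !map_mxZ !mulmxDr mulmx1 -!scalemxAr.
by rewrite !mxE !hornerE /= expr2 !rmorphM /=; ring.
Qed.

(* A tangent vector acts on the generic point of S: the derivation is well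
   defined on the image of S because the kernel consists of elements that become
   0 when multiplied by an element outside of it. *)
Lemma tangent_derivation (e : 'M[F]_n) (E : fieldType) (g : {rmorphism S -> E}) :
  (forall m, m.+1%:R != 0 :> E) ->
  (forall x, g x = 0 -> exists2 t, t * x = 0 & g t != 0) -> tangent e ->
  exists d : E -> E, [/\ derivation d, forall k, d (g (j k)) = 0
    & map_mx d (map_mx g U) = map_mx g (U *m constant_mx e)].
Proof.
move=> char0E gP /tangent_hom[D [D1 Dj DU]].
pose G : set (dual E) := [set u | exists x, u = (g x, g (D x).2)].
have [|d dP dG] := @derivation_extension E char0E G.
  split.
  - by exists 1; rewrite !rmorph1 dual1 /= rmorph0.
  - by move=> _ _ [x ->] [y ->]; exists (x - y);
    rewrite dualN dualD /= -!rmorphB; congr (_, g _); rewrite (rmorphB D).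
  - move=> _ _ [x ->] [y ->]; exists (x * y).
    by rewrite rmorphM (rmorphM D) !dualM !D1 /= rmorphD !rmorphM.
  move=> _ [x ->] /= gx; rewrite gx; have [t tx gt] := gP _ gx.
  have /(congr1 (fun u : dual S => g u.2)) : D (t * x) = 0 by rewrite tx rmorph0.
  rewrite rmorphM dualM /= !D1 rmorphD !rmorphM gx mulr0 addr0 rmorph0.
  by move=> /eqP; rewrite mulf_eq0 (negPf gt) /= => /eqP ->.
have dg x : d (g x) = g (D x).2 by apply: (dG (g x, g (D x).2)); exists x.
exists d; split=> // [k|]; first by rewrite dg Dj rmorph0.
by rewrite -DU; apply/matrixP => k l; rewrite !mxE dg.
Qed.
End Tangents.

Lemma mpoly_ind_mulX n (R : comNzRingType) (B : set (mpoly n R)) : B 1 ->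
  (forall p q, B p -> B q -> B (p + q)) -> (forall c p, B p -> B (mpolyC n c * p)) ->
  (forall i p, B p -> B (mvar i * p)) -> forall p, B p.
Proof.
move=> B1 BD BC BX p; elim/mpolyind: p => [|c m p _ _ Bp].
  by rewrite -(mul0r 1) -(rmorph0 (@mpolyC n R)); apply: BC.
apply: BD => //; rewrite -mul_mpolyC; apply: BC.
rewrite mpolyXE_id; elim: (index_enum _) => [|i l IH]; first by rewrite big_nil.
rewrite big_cons; elim: (m i) => [|k IHk]; first by rewrite expr0 mul1r.
by rewrite exprS -mulrA; apply: BX.
Qed.

Lemma derivation1 (E : comNzRingType) (d : E -> E) : derivation d -> d 1 = 0.
Proof.
move=> [_ dM]; have := dM 1 1; rewrite !mulr1 mul1r => /eqP.
by rewrite -[X in X == _]addr0 (inj_eq (addrI _)) eq_sym => /eqP.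
Qed.

Lemma derivation0 (E : comNzRingType) (d : E -> E) : derivation d -> d 0 = 0.
Proof.
move=> [dD _]; have := dD 0 0; rewrite addr0 => /eqP.
by rewrite -[X in X == _]addr0 (inj_eq (addrI _)) eq_sym => /eqP.
Qed.

Lemma derivationN (E : comNzRingType) (d : E -> E) x : derivation d -> d (- x) = - d x.
Proof.
move=> dP; apply/eqP; rewrite -addr_eq0 -(proj1 dP) addNr; apply/eqP.
exact: derivation0.
Qed.

Lemma derivationB (E : comNzRingType) (d : E -> E) x y :
  derivation d -> d (x - y) = d x - d y.
Proof. by move=> dP; rewrite (proj1 dP) derivationN. Qed.

Lemma derivation_sum (E : comNzRingType) (d : E -> E) I (r : seq I) (P : pred I) f :
  derivation d -> d (\sum_(i <- r | P i) f i) = \sum_(i <- r | P i) d (f i).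
Proof.
move=> dP; apply: (big_morph d); [exact: (proj1 dP)|exact: derivation0].
Qed.

Lemma derivation_mulmx (E : comNzRingType) (d : E -> E) m n p (M : 'M_(m, n)) (N : 'M_(n, p)) :
  derivation d -> map_mx d (M *m N) = map_mx d M *m N + M *m map_mx d N.
Proof.
move=> dP; apply/matrixP => i k; rewrite !mxE derivation_sum // -big_split.
by apply: eq_bigr => l _; rewrite !mxE (proj2 dP).
Qed.

Lemma derivation_mx1 (E : comNzRingType) (d : E -> E) n :
  derivation d -> map_mx d (1%:M : 'M_n) = 0.
Proof.
move=> dP; apply/matrixP => i k; rewrite !mxE.
by case: (i == k); rewrite ?(derivation1 dP) ?(derivation0 dP).
Qed.

Section Realization.
Variables (F K L E : fieldType) (c : {rmorphism F -> K}) (sK : {rmorphism K -> K}).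
Variables (R : comNzRingType) (j : {rmorphism K -> R}) (s : {rmorphism R -> R}).
Hypotheses (sj : forall k, s (j k) = j (sK k)) (simpleR : sigma_simple s)
  (constR : forall x, s x = x -> exists a, x = j (c a)).
Variables (iota : {rmorphism K -> L}) (sL : {rmorphism L -> L}).
Hypotheses (sLi : forall k, sL (iota k) = iota (sK k))
  (char0L : forall m, m.+1%:R != 0 :> L).
Variables (N : nat) (A : 'M[K]_N) (U V : 'M[R]_N) (Y : 'cV[L]_N).
Hypotheses (sU : map_mx s U = map_mx j A *m U) (UV : U *m V = 1%:M)
  (sY : map_mx sL Y = map_mx iota A *m Y).
Variables (g : {rmorphism R -> E}) (d : E -> E).
Hypotheses (dP : derivation d) (dK : forall k, d (g (j k)) = 0).
Variable lam : {additive E -> K}.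
Hypothesis lamZ : forall k x, lam (g (j k) * x) = k * lam x.

Let PK := mpoly N K.
Let PR := mpoly N R.
Let PE := mpoly N E.
Let Yf i := Y i 0.
Let M : 'M[E]_N := map_mx d (map_mx g U) *m map_mx g V.
Let m : 'M[K]_N := map_mx lam M.

Definition linear_form (T : comNzRingType) (B : 'M[T]_N) (i : 'I_N) : mpoly N T :=
  \sum_l mpolyC N (B i l) * mvar l.

(** [lam] on coefficients, then evaluation at Y. This is not a ring morphism, but it is linear over
    K[X], where X acts on L through Y: see [Lam_X], [Lam_C] and [Lam_scale]. *)
Definition Lam_def (p : PE) : L := mmap (iota \o lam) Yf p.
Local Notation Lam := Lam_def.

Lemma Lam0 : Lam 0 = 0. Proof. exact: raddf0. Qed.

Lemma LamD p q : Lam (p + q) = Lam p + Lam q. Proof. exact: raddfD. Qed.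

Lemma Lam_sum (I : finType) (f : I -> PE) : Lam (\sum_i f i) = \sum_i Lam (f i).
Proof. exact: (big_morph Lam LamD Lam0). Qed.

Let evL : {rmorphism PK -> L} := mmap iota Yf.

Lemma Lam_monom e a : Lam (e *: mpolyX E a) = iota (lam e) * mmap1 Yf a.
Proof.
have [->|e0] := eqVneq e 0; first by rewrite scale0r Lam0 !raddf0 mul0r.
by rewrite /Lam_def /mmap msuppMCX // big_seq1 mcoeffZ mcoeffX eqxx mulr1.
Qed.

Lemma mmap1_var_add (i : 'I_N) a : mmap1 Yf (mnm_add (mnm1 i) a) = Yf i * mmap1 Yf a.
Proof.
have e b : mmap1 Yf b = mmap idfun Yf (mpolyX L b) by rewrite mmapX.
by rewrite !e mpolyXD [LHS](rmorphM (mmap idfun Yf : {rmorphism _ -> _})) /= mmap_var.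
Qed.

Lemma Lam_X i p : Lam (mvar i * p) = Yf i * Lam p.
Proof.
elim/mpolyind: p => [|e a p _ _ IH]; first by rewrite mulr0 Lam0 mulr0.
rewrite mulrDr !LamD mulrDr IH -scalerAr -mpolyXD !Lam_monom mmap1_var_add.
by rewrite mulrCA.
Qed.

Lemma Lam_C k p : Lam (mpolyC N (g (j k)) * p) = iota k * Lam p.
Proof.
elim/mpolyind: p => [|e a p _ _ IH]; first by rewrite mulr0 Lam0 mulr0.
rewrite mulrDr !LamD mulrDr IH mul_mpolyC scalerA.
by rewrite !Lam_monom lamZ rmorphM mulrA.
Qed.

Lemma Lam_scale e p : Lam (mpolyC N e * map_mpoly (g \o j) p) = iota (lam e) * evL p.
Proof.
elim/mpolyind: p => [|k a p _ _ IH]; first by rewrite !raddf0 mulr0 Lam0 mulr0.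
rewrite !raddfD mulrDr LamD mulrDr IH; congr (_ + _).
rewrite /=.
rewrite map_mpolyZ map_mpolyX mul_mpolyC scalerA mulrC /=.
rewrite Lam_monom lamZ /evL /= mmapZ mmapX rmorphM; ring.
Qed.

(** The derivation X -> m X of K[X] has to preserve the relations Q(Y) = 0. Over R[X] consider the
    derivation [nabla] along [g] with X -> M X, where dU = M U; it kills the entries of U^-1 X. In
    these variables the R-span of the relations is stable under s acting on coefficients, hence
    generated by polynomials with constant coefficients, and [nabla] kills those. [Lam] brings the
    conclusion back to K and Y. *)
Lemma realized_derivation : exists delta : L -> L,
  [/\ derivation delta, forall k, delta (iota k) = 0
    & map_mx delta Y = map_mx iota m *m Y].
Proof.
have [||f0 f0E] := @rmorphism_pack R (dual PE) (fun r => (mpolyC N (g r), mpolyC N (d (g r)))).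
- by move=> x y; rewrite dualN dualD /= !rmorphB derivationB // rmorphB.
- split=> [|x y]; first by rewrite !rmorph1 (derivation1 dP) rmorph0.
  rewrite dualM /= !rmorphM (proj2 dP) rmorphD !rmorphM; congr (_, _); ring.
have [nabla [nablaC nablaX]] : exists nabla : {rmorphism PR -> dual PE},
    (forall r, nabla (mpolyC N r) = (mpolyC N (g r), mpolyC N (d (g r)))) /\
    (forall i, nabla (mvar i) = (mvar i, linear_form M i)).
  exists (mmap f0 (fun i => (mvar i, linear_form M i))); split=> [r|i].
    by apply: etrans (f0E r); exact: mmapC.
  exact: mmap_var.
have [||h0 h0E] := @rmorphism_pack K (dual L) (fun k => (iota k, 0)).
- by move=> x y; rewrite dualN dualD /= rmorphB subrr.
- by split=> [|x y]; rewrite ?rmorph1 // dualM /= rmorphM mulr0 mul0r addr0.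
have [DK [DKC DKX]] : exists DK : {rmorphism PK -> dual L},
    (forall k, DK (mpolyC N k) = (iota k, 0)) /\
    (forall i, DK (mvar i) = (Yf i, (map_mx iota m *m Y) i 0)).
  exists (mmap h0 (fun i => (Yf i, (map_mx iota m *m Y) i 0))); split=> [k|i].
    by apply: etrans (h0E k); exact: mmapC.
  exact: mmap_var.
have DK1 p : (DK p).1 = evL p.
  move: p; apply: mpoly_closure => [k|i|p q ep eq|p q ep eq].
  - by rewrite DKC /evL /= mmapC.
  - by rewrite DKX /evL /= mmap_var.
  - by rewrite (rmorphD DK) [LHS]/= ep eq (rmorphD evL).
  - by rewrite (rmorphM DK) [LHS]/= ep eq (rmorphM evL).
have [gm gmE] : exists gm : {rmorphism PR -> PE}, gm =1 map_mpoly g by eexists.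
have nabla1 p : (nabla p).1 = map_mpoly g p.
  rewrite -gmE; move: p; apply: mpoly_closure => [k|i|p q ep eq|p q ep eq].
  - by rewrite nablaC gmE map_mpolyC.
  - by rewrite nablaX gmE map_mpolyX.
  - by rewrite (rmorphD nabla) [LHS]/= ep eq (rmorphD gm).
  - by rewrite (rmorphM nabla) [LHS]/= ep eq (rmorphM gm).
have Lam_nabla p : Lam (nabla (map_mpoly j p)).2 = (DK p).2.
  move: p; apply: mpoly_ind_mulX => [|p q ep eq|k p ep|i p ep].
  - by rewrite rmorph1 (rmorph1 nabla) (rmorph1 DK) dual1 /= Lam0.
  - by rewrite raddfD (rmorphD nabla) (rmorphD DK) !dualD /= LamD ep eq.
  - rewrite rmorphM /= map_mpolyC (rmorphM nabla) nablaC dualM /= dK rmorph0 mul0r addr0.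
    by rewrite Lam_C ep (rmorphM DK) DKC dualM /= mul0r addr0.
  rewrite rmorphM /= map_mpolyX (rmorphM nabla) nablaX dualM /= LamD Lam_X ep (rmorphM DK) DKX dualM /= DK1; congr (_ + _).
  rewrite /linear_form mulr_suml Lam_sum mxE mulr_suml; apply: eq_bigr => l _.
  rewrite nabla1 -mulrA mulrCA Lam_X.
  have -> : map_mpoly g (map_mpoly j p) = map_mpoly (g \o j) p.
    by apply/mpolyP => a; rewrite !mcoeff_map_mpoly.
  by rewrite Lam_scale !mxE mulrCA mulrA.
(* The factor [e] makes the property linear over R: Leibniz' rule for a multiple a p produces the
   extra coefficient d(g a). *)
pose Good (p : PR) := forall e, Lam (mpolyC N e * (nabla p).1) = 0 /\
  Lam (mpolyC N e * (nabla p).2) = 0.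
pose W : set PR := [set p | forall B : set PR, B 0 ->
  (forall a x y, B x -> B y -> B (a *: x + y)) ->
  (forall Q, evL Q = 0 -> B (map_mpoly j Q)) -> B p].
have W_lin a x y : W x -> W y -> W (a *: x + y).
  by move=> Wx Wy B B0 BL BQ; apply: (BL); [exact: Wx|exact: Wy].
have W_good1 p : W p -> forall e, Lam (mpolyC N e * (nabla p).1) = 0.
  move=> Wp; apply: (Wp [set p | forall e, Lam (mpolyC N e * (nabla p).1) = 0]) => /=.
  - by move=> e; rewrite (rmorph0 nabla) /= mulr0 Lam0.
  - move=> a x y ex ey e; rewrite (rmorphD nabla) dualD /= mulrDr LamD ey addr0.
    by rewrite -mul_mpolyC (rmorphM nabla) nablaC dualM /= mulrA -rmorphM; apply: ex.
  move=> Q Q0 e; rewrite nabla1.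
  have -> : map_mpoly g (map_mpoly j Q) = map_mpoly (g \o j) Q.
    by apply/mpolyP => a; rewrite !mcoeff_map_mpoly.
  by rewrite Lam_scale (_ : evL Q = 0) ?mulr0.
(* [theta B] is the substitution X -> B X. As s(U) = A U, [theta U] turns the action [sX], which
   includes X -> A X, into the action of s on coefficients alone. *)
have [theta thetaP] : exists theta : 'M[R]_N -> {rmorphism PR -> PR}, forall B,
    (forall r, theta B (mpolyC N r) = mpolyC N r) /\
    (forall i, theta B (mvar i) = linear_form B i).
  exists (fun B => mmap (@mpolyC N R) (linear_form B)) => B; split=> [r|i].
    by rewrite /= mmapC.
  exact: mmap_var.
have thetaC B r : theta B (mpolyC N r) = mpolyC N r by have [] := thetaP B.
have thetaX B i : theta B (mvar i) = linear_form B i by have [] := thetaP B.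
have theta_lin B B' i : theta B (linear_form B' i) = linear_form (B' *m B) i.
  rewrite /linear_form rmorph_sum /=.
  under eq_bigr do rewrite (rmorphM (theta B)) thetaC thetaX /linear_form mulr_sumr.
  rewrite exchange_big /=; apply: eq_bigr => l _.
  rewrite mxE rmorph_sum mulr_suml; apply: eq_bigr => k _.
  by rewrite mulrA -rmorphM.
have linear_form1 i : linear_form (1%:M : 'M[R]_N) i = mvar i.
  rewrite /linear_form (bigD1 i) //= mxE eqxx rmorph1 mul1r big1 ?addr0 // => l li.
  by rewrite mxE eq_sym (negPf li) rmorph0 mul0r.
have [sX [sXC sXX]] : exists sX : {rmorphism PR -> PR},
    (forall r, sX (mpolyC N r) = mpolyC N (s r)) /\
    (forall i, sX (mvar i) = linear_form (map_mx j A) i).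
  exists (mmap (@mpolyC N R \o s) (linear_form (map_mx j A))); split=> [r|i].
    by rewrite /= mmapC.
  exact: mmap_var.
have s_lin B i : map_mpoly s (linear_form B i) = linear_form (map_mx s B) i.
  rewrite /linear_form rmorph_sum; apply: eq_bigr => l _.
  by rewrite rmorphM /= map_mpolyC map_mpolyX mxE.
have theta_sX p : theta U (sX p) = map_mpoly s (theta U p).
  move: p; apply: mpoly_closure => [k|i|p q ep eq|p q ep eq].
  - by rewrite sXC !thetaC map_mpolyC.
  - by rewrite sXX thetaX theta_lin s_lin sU.
  - by rewrite !rmorphD ep eq.
  - by rewrite !rmorphM ep eq.
have thetaUV p : theta U (theta V p) = p.
  move: p; apply: mpoly_closure => [k|i|p q ep eq|p q ep eq].
  - by rewrite !thetaC.
  - by rewrite thetaX theta_lin (mulmx1C UV) linear_form1.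
  - by rewrite !rmorphD ep eq.
  - by rewrite !rmorphM ep eq.
have thetaVU p : theta V (theta U p) = p.
  move: p; apply: mpoly_closure => [k|i|p q ep eq|p q ep eq].
  - by rewrite !thetaC.
  - by rewrite thetaX theta_lin UV linear_form1.
  - by rewrite !rmorphD ep eq.
  - by rewrite !rmorphM ep eq.
have W_sX p : W p -> W (sX p).
  move=> Wp B B0 BL BQ; apply: (Wp [set q | B (sX q)]) => /=.
  - by rewrite rmorph0.
  - move=> a x y Bx By; rewrite rmorphD -mul_mpolyC rmorphM sXC mul_mpolyC.
    exact: BL.
  move=> Q Q0.
  clear p Wp; pose sXK : {rmorphism PK -> PK} := mmap (@mpolyC N K \o sK) (linear_form A).
  have -> : sX (map_mpoly j Q) = map_mpoly j (sXK Q).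
    move: (Q); apply: mpoly_closure => [k|i|p q ep eq|p q ep eq].
    - by rewrite map_mpolyC sXC sj /sXK /= mmapC map_mpolyC.
    - rewrite map_mpolyX sXX /sXK /= mmap_var /linear_form rmorph_sum.
      by apply: eq_bigr => l _; rewrite rmorphM /= map_mpolyC map_mpolyX mxE.
    - by rewrite !rmorphD ep eq.
    - by rewrite !rmorphM ep eq.
  apply: BQ; rewrite -(rmorph0 sL) -Q0.
  move: (Q); apply: mpoly_closure => [k|i|p q ep eq|p q ep eq].
  - by rewrite /sXK /evL /= !mmapC /= sLi.
  - rewrite /sXK /= mmap_var /linear_form rmorph_sum /=.
    transitivity (map_mx sL Y i 0); last by rewrite mxE /evL /= mmap_var.
    rewrite sY mxE; apply: eq_bigr => l _.
    by rewrite (rmorphM evL) /evL /= mmapC mmap_var mxE.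
  - by rewrite !rmorphD ep eq.
  - by rewrite !rmorphM ep eq.
have VU' : map_mx d (map_mx g V) + map_mx g V *m M = 0.
  have h : map_mx d (map_mx g V) *m map_mx g U + map_mx g V *m map_mx d (map_mx g U) = 0.
    by rewrite -derivation_mulmx // -map_mxM (mulmx1C UV) map_mx1 derivation_mx1.
  have {}h := congr1 (fun B => B *m map_mx g V) h; rewrite mul0mx mulmxDl -mulmxA in h.
  by rewrite -map_mxM UV map_mx1 mulmx1 -mulmxA in h.
(* [theta V p] is a polynomial in the entries of V X whose coefficients are invariant, hence
   constant; the derivative of V X is (dV + V M) X = 0. *)
have nabla_const p : map_mpoly s p = p -> (nabla (theta V p)).2 = 0.
  move=> sp; pose T := [set p : PR | (nabla (theta V p)).2 = 0].
  have TM p1 p2 : T p1 -> T p2 -> T (p1 * p2).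
    by move=> e1 e2; rewrite /T /= rmorphM (rmorphM nabla) dualM /= e1 e2 mulr0 mul0r addr0.
  have T1 : T 1 by rewrite /T /= rmorph1 (rmorph1 nabla).
  rewrite (mpolyE p); apply: (big_ind T).
  - by rewrite /T /= rmorph0 (rmorph0 nabla).
  - by move=> p1 p2 e1 e2; rewrite /T /= rmorphD (rmorphD nabla) dualD /= e1 e2 addr0.
  move=> a _; rewrite -mul_mpolyC; apply: (TM).
    have [b ->] : exists b, mcoeff a p = j (c b).
      by apply: constR; rewrite -mcoeff_map_mpoly sp.
    by rewrite /T /= thetaC nablaC /= dK rmorph0.
  rewrite mpolyXE_id; apply: (big_ind T); [exact: T1|exact: TM|move=> i _].
  elim: (a i) => [|k IH]; rewrite ?expr0 // exprS; apply: (TM) => //.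
  rewrite /T /= thetaX /linear_form (rmorph_sum nabla).
  have sum2 (I : finType) (G : I -> dual PE) : (\sum_k G k).2 = \sum_k (G k).2.
    by apply: (big_morph (fun u : dual PE => u.2)).
  rewrite sum2; under eq_bigr do rewrite (rmorphM nabla) nablaC nablaX dualM /=.
  rewrite big_split /=.
  have -> : \sum_l mpolyC N (g (V i l)) * linear_form M l = linear_form (map_mx g V *m M) i.
    rewrite /linear_form; under eq_bigr do rewrite mulr_sumr.
    rewrite exchange_big; apply: eq_bigr => l _ /=.
    rewrite mxE rmorph_sum mulr_suml; apply: eq_bigr => b _.
    by rewrite mulrA -mpolyCM [map_mx g V i b]mxE.
  rewrite -big_split /=; apply: big1 => l _; rewrite -mulrDl -rmorphD.
  have := congr1 (fun B : 'M_N => B i l) VU'; rewrite !mxE addrC => ->.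
  by rewrite rmorph0 mul0r.
have GoodW p : W (theta V p) -> Good (theta V p).
  move: p; apply: (@stable_submodule_generated R s simpleR PR (multinom N)
    (fun a p => mcoeff a p) (fun p => msupp p) (map_mpoly s)
    [set p | W (theta V p)] [set p | Good (theta V p)]) => /=.
  - by move=> a b x y; rewrite mcoeffD mcoeffZ.
  - by move=> v v0; apply/mpolyP => a; rewrite v0 mcoeff0.
  - by move=> a v; rewrite mcoeff_msupp.
  - by move=> a v; rewrite mcoeff_map_mpoly.
  - by rewrite rmorph0 => B.
  - move=> a x y Wx Wy; rewrite rmorphD -mul_mpolyC rmorphM thetaC mul_mpolyC.
    exact: W_lin.
  - move=> x Wx; have -> : theta V (map_mpoly s x) = sX (theta V x).
      by rewrite -[RHS]thetaVU theta_sX thetaUV.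
    exact: W_sX.
  - by rewrite rmorph0 => e; rewrite (rmorph0 nabla) /= mulr0 Lam0.
  - move=> a x y Gx Gy; rewrite rmorphD -mul_mpolyC rmorphM thetaC => e.
    rewrite (rmorphD nabla) (rmorphM nabla) nablaC dualD dualM /= !mulrDr !LamD.
    have [y1 y2] := Gy e; have [x1 _] := Gx (e * d (g a)).
    have [x1' x2] := Gx (e * g a).
    by rewrite y1 y2 !mulrA -!rmorphM x1 x1' x2 !addr0.
  move=> p Wp /nabla_const p2 e; rewrite p2 mulr0 Lam0; split=> //.
  exact: W_good1.
have DK_ker Q : evL Q = 0 -> (DK Q).2 = 0.
  move=> Q0; rewrite -Lam_nabla -[map_mpoly j Q]thetaVU.
  have /GoodW/(_ 1)[_] : W (theta V (theta U (map_mpoly j Q))).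
    by rewrite thetaVU => B _ _ BQ; apply: BQ.
  by rewrite rmorph1 mul1r.
have [|delta deltaP deltaE] := @derivation_extension L char0L [set u | exists Q, u = DK Q].
  split.
  - by exists 1; rewrite rmorph1.
  - by move=> _ _ [p ->] [q ->]; exists (p - q); rewrite rmorphB.
  - by move=> _ _ [p ->] [q ->]; exists (p * q); rewrite rmorphM.
  move=> _ [p ->]; rewrite DK1 => p0; move: (DK1 p) (DK_ker p p0); rewrite p0.
  by case: (DK p) => a b /= -> ->.
exists delta; split=> //.
  move=> k; have := deltaE (DK (mpolyC N k)); rewrite DKC /=; apply.
  by exists (mpolyC N k); rewrite DKC.
apply/matrixP => i l; rewrite ord1 mxE.
have := deltaE (DK (mvar i)); rewrite DKX /=; apply.
by exists (mvar i); rewrite DKX.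
Qed.
End Realization.

(** * Irreducible sets of matrices and semi-invariants *)

(** A matrix of maximal rank among those with row space inside [W] has [W] as its row space. *)
Lemma subspace_matrix (K : fieldType) D (W : set 'rV[K]_D) : W 0 ->
  (forall a x y, W x -> W y -> W (a *: x + y)) ->
  exists r (B : 'M[K]_(r, D)), row_free B /\ forall v, W v <-> (v <= B)%MS.
Proof.
move=> W0 WL.
pose P k := `[< exists B : 'M[K]_D, (forall v : 'rV_D, (v <= B)%MS -> W v) /\ \rank B = k >].
have exP : exists k, P k.
  exists 0%N; apply/asboolP; exists 0; split; last by rewrite mxrank0.
  by move=> v; rewrite submx0 => /eqP ->.
have ubP k : P k -> (k <= D)%N by move=> /asboolP[B [_ <-]]; exact: rank_leq_row.
case: (ex_maxnP exP ubP) => k /asboolP[B [BW rB]] maxk.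
exists (\rank B), (row_base B); split; first exact: row_base_free.
move=> v; rewrite eq_row_base; split=> [Wv|]; last exact: BW.
have /maxk : P (\rank (B + v)%MS).
  apply/asboolP; exists (B + v)%MS; split=> // x /sub_addsmxP[[u1 u2] /= ->].
  rewrite addrC [u2]mx11_scalar mul_scalar_mx; apply: WL => //.
  by apply: BW; apply: submxMl.
rewrite -rB => le; have [_] := mxrank_leqif_sup (addsmxSl B v).
rewrite eqn_leq mxrankS ?addsmxSl //= le => /esym.
by apply: submx_trans; apply: addsmxSr.
Qed.

Definition irreducible (F : fieldType) n (T : set 'M[F]_n) : Prop :=
  forall B : 'M[F]_n, (forall e, T e -> (B *m e <= B)%MS) -> B = 0 \/ row_full B.

Lemma irreducible_sub (F : fieldType) n (T T' : set 'M[F]_n) :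
  T `<=` T' -> irreducible T -> irreducible T'.
Proof. by move=> TT' irrT B stB; apply: irrT => e /TT'; apply: stB. Qed.

Section Schur.
Variables (F : closedFieldType) (n : nat) (T : set 'M[F]_n).
Hypotheses (irrT : irreducible T) (n_gt0 : (0 < n)%N).

Lemma schur (N : 'M[F]_n) : (forall e, T e -> N *m e = e *m N) -> exists a, N = a%:M.
Proof.
move=> comm; have [|a] := @closed_rootP F (char_poly N) _.
  by rewrite size_char_poly; case: (n) n_gt0.
rewrite -eigenvalue_root_char => /eigenvalueP[v vN v0]; exists a.
pose B := kermx (N - a%:M).
have [B0|fullB] : B = 0 \/ row_full B.
- apply: irrT => e Te; apply/sub_kermxP; rewrite -mulmxA.
  have -> : e *m (N - a%:M) = (N - a%:M) *m e.
    by rewrite mulmxBr mulmxBl comm // mul_scalar_mx mul_mx_scalar.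
  by rewrite mulmxA mulmx_ker mul0mx.
- have : (v <= B)%MS by apply/sub_kermxP; rewrite mulmxBr vN mul_mx_scalar subrr.
  by rewrite B0 submx0 (negPf v0).
have : ((1%:M : 'M_n) <= B)%MS by rewrite sub1mx.
by move/sub_kermxP; rewrite mul1mx => /eqP; rewrite subr_eq0 => /eqP.
Qed.

(** The kernel of N is stable under T, so N is 0 or invertible. In the second case the scalar mu = N
    e N^-1 - e has trace 0, hence mu = 0; by Schur's lemma N is then a scalar, and its trace is
    0. *)
Lemma no_semi_invariant (N : 'M[F]_n) : (forall k, k.+1%:R != 0 :> F) -> \tr N = 0 ->
  (forall e, T e -> exists mu, N *m e - e *m N = mu *: N) -> N = 0.
Proof.
move=> char0 trN semi.
have [k kE] : exists k, n = k.+1 by case: (n) n_gt0 => // k _; exists k.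
have n0 : n%:R != 0 :> F by rewrite kE.
have [K0|fullK] : kermx N = 0 \/ row_full (kermx N).
- apply: irrT => e Te; apply/sub_kermxP; rewrite -mulmxA.
  have [mu muE] := semi e Te; have -> : e *m N = N *m e - mu *: N by rewrite -muE subKr.
  by rewrite mulmxBr mulmxA mulmx_ker mul0mx -scalemxAr mulmx_ker scaler0 subrr.
- have uN : N \in unitmx.
    by rewrite -row_free_unit -kermx_eq0 K0.
  have [|a aE] := @schur N.
    move=> e Te; have [mu muE] := semi e Te.
    have : N *m e *m invmx N - e = mu%:M.
      by rewrite -[e in X in _ - X](mulmxK uN) -mulmxBl muE -scalemxAl mulmxV // scalemx1.
    move=> /(congr1 mxtrace); rewrite raddfB /= mxtrace_mulC mulKmx // subrr mxtrace_scalar.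
    move=> /esym/eqP; rewrite -mulr_natr mulf_eq0 (negPf n0) orbF => /eqP mu0.
    by apply/eqP; rewrite -subr_eq0 muE mu0 scale0r.
  move: trN; rewrite aE mxtrace_scalar => /eqP; rewrite -mulr_natr mulf_eq0 (negPf n0) orbF.
  by move=> /eqP ->; rewrite raddf0.
have : ((1%:M : 'M_n) <= kermx N)%MS by rewrite sub1mx.
by move/sub_kermxP; rewrite mul1mx.
Qed.

(** Otherwise Schur's lemma makes all elements of T scalar, and every line is stable. *)
Lemma irreducible_noncommuting : (1 < n)%N ->
  exists e e', [/\ T e, T e' & e *m e' != e' *m e].
Proof.
move=> n1; apply: contrapT => none.
have comm e e' : T e -> T e' -> e *m e' = e' *m e.
  by move=> Te Te'; apply/eqP; apply: contrapT => /negP ne; apply: none; exists e, e'.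
pose B : 'M[F]_n := delta_mx (Ordinal n_gt0) (Ordinal n_gt0).
have rB : \rank B = 1%N by rewrite mxrank_delta.
have [B0|] : B = 0 \/ row_full B.
- apply: irrT => e Te; have [a ->] := schur (fun e' Te' => comm e e' Te Te').
  by rewrite mul_mx_scalar scalemx_sub.
- by move: rB; rewrite B0 mxrank0.
by rewrite /row_full rB eq_sym => /eqP n1'; rewrite n1' in n1.
Qed.
End Schur.

(** * Linear relations and semi-invariant matrices *)

Section SolutionSpace.
Variables (F : closedFieldType) (K : fieldType) (c : {rmorphism F -> K})
  (sK : {rmorphism K -> K}).
Hypothesis char0 : forall n, n.+1%:R != 0 :> F.
Variables (S : comNzRingType) (j : {rmorphism K -> S}) (s : {rmorphism S -> S}).
Hypotheses (sj : forall k, s (j k) = j (sK k)) (simpleS : sigma_simple s)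
  (constS : forall x, s x = x -> exists a, x = j (c a)).
Variables (n : nat) (A : 'M[K]_n) (U V : 'M[S]_n).
Hypotheses (sU : map_mx s U = map_mx j A *m U) (UV : U *m V = 1%:M) (n_gt0 : (0 < n)%N).
Hypothesis irr : irreducible (tangent c j s U).

Let constant_mx := constant_mx c j.
Local Notation tangent := (tangent c j s U).

Lemma tangent_endo e : tangent e -> exists (e2 : 'M[F]_n)
    (f : F -> {rmorphism S -> S}), forall t,
  [/\ forall k, f t (j k) = j k, map_mx (f t) U = U *m map_mx (j \o c) (curve e e2 t),
      map_mx (f t) V = map_mx (j \o c) (curve e e2 (- t)) *m V
    & curve e e2 t *m curve e e2 (- t) = 1%:M].
Proof.
move=> [e2 [endo inv]]; have [f fP] := choice endo; exists e2, f => t.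
have [fj _ fU] := fP t; split=> //.
have h : map_mx (f t) V *m map_mx (f t) U = 1%:M.
  by rewrite -map_mxM (mulmx1C UV) map_mx1.
have : map_mx (f t) V *m map_mx (f t) U *m (map_mx (j \o c) (curve e e2 (- t)) *m V) =
    map_mx (f t) V.
  rewrite fU -!mulmxA (mulmxA (map_mx _ (curve _ _ _)) (map_mx _ _)) -map_mxM inv.
  by rewrite map_mx1 mul1mx UV mulmx1.
by rewrite h mul1mx.
Qed.

(* The relations span a stable submodule of S^n, which is generated by constant
   vectors; these form a subspace of F^n stable under the Galois group. *)
Lemma solution_entries_free (L : fieldType) (iota : {rmorphism K -> L})
    (sL : {rmorphism L -> L}) (Y : 'cV[L]_n) :
  (forall k, sL (iota k) = iota (sK k)) -> map_mx sL Y = map_mx iota A *m Y -> Y != 0 ->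
  forall r : 'rV[K]_n, map_mx iota r *m Y = 0 -> r = 0.
Proof.
move=> sLi sY Y0.
pose W := [set r : 'rV[K]_n | map_mx iota r *m Y = 0].
have W_lin a x y : W x -> W y -> W (a *: x + y).
  by move=> ex ey; rewrite /W /= map_mxD map_mxZ mulmxDl -scalemxAl ex ey scaler0 addr0.
have W0 : W 0 by rewrite /W /= map_mx0 mul0mx.
have W_st r : W r -> W (map_mx sK r *m A).
  move=> er; rewrite /W /= map_mxM -mulmxA -sY.
  have -> : map_mx iota (map_mx sK r) = map_mx sL (map_mx iota r).
    by apply/matrixP => k l; rewrite !mxE sLi.
  by rewrite -map_mxM er map_mx0.
pose WS := [set x : 'rV[S]_n | forall B : set 'rV[S]_n, B 0 ->
  (forall a x y, B x -> B y -> B (a *: x + y)) ->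
  (forall r, W r -> B (map_mx j r *m U)) -> B x].
have WS0 : WS 0 by move=> B.
have WS_lin a x y : WS x -> WS y -> WS (a *: x + y).
  by move=> Wx Wy B B0 BL BQ; apply: (BL); [exact: Wx|exact: Wy].
have WS_st x : WS x -> WS (map_mx s x).
  move=> Wx B B0 BL BW; apply: (Wx [set x | B (map_mx s x)]) => /=.
  - by rewrite map_mx0.
  - by move=> a y z By Bz; rewrite map_mxD map_mxZ; apply: BL.
  move=> r Wr; rewrite map_mxM sU mulmxA.
  have -> : map_mx s (map_mx j r) *m map_mx j A = map_mx j (map_mx sK r *m A).
    by rewrite map_mxM; congr (_ *m _); apply/matrixP => k l; rewrite !mxE sj.
  by apply: BW; apply: W_st.
pose C0 := [set v : 'rV[F]_n | WS (map_mx (j \o c) v)].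
have C0_0 : C0 0 by rewrite /C0 /= map_mx0.
have C0_lin a x y : C0 x -> C0 y -> C0 (a *: x + y).
  by move=> ex ey; rewrite /C0 /= map_mxD map_mxZ; apply: WS_lin.
have gen (B : set 'rV[S]_n) : B 0 -> (forall a x y, B x -> B y -> B (a *: x + y)) ->
    (forall v, C0 v -> B (map_mx (j \o c) v)) -> WS `<=` B.
  move=> B0 BL BC; apply: (@stable_submodule_generated S s simpleS 'rV[S]_n 'I_n
    (fun i v => v 0 i) (fun=> enum 'I_n) (map_mx s) WS B) => //.
  - by move=> i a y z; rewrite !mxE.
  - by move=> y y0; apply/rowP => i; rewrite mxE.
  - by move=> i y _; rewrite mem_enum.
  - by move=> i y; rewrite mxE.
  move=> v Wv sv.
  have vc i : exists a, v 0 i = j (c a) by apply: constS; rewrite -[in RHS]sv mxE.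
  have [a aP] := choice vc.
  have vE : v = map_mx (j \o c) (\row_i a i) by apply/rowP => i; rewrite !mxE aP.
  by rewrite vE; apply: BC; rewrite /C0 /= -vE.
have two0 : 2%:R != 0 :> F by exact: char0.
have C0_st v e : tangent e -> C0 v -> C0 (v *m e).
  move=> Te; have [e2 [f fP]] := tangent_endo Te; move=> Cv.
  have cur t : C0 (v *m curve e e2 t).
    have [fj fU _ inv] := fP (- t).
    rewrite opprK in inv; rewrite /C0 /= map_mxM => B B0 BL BW.
    have -> : map_mx (j \o c) v = map_mx (f (- t)) (map_mx (j \o c) v).
      by apply/rowP => k; rewrite !mxE fj.
    apply: (Cv [set x | B (map_mx (f (- t)) x *m map_mx (j \o c) (curve e e2 t))]) => /=.
    - by rewrite map_mx0 mul0mx.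
    - by move=> a x y Bx By; rewrite map_mxD map_mxZ mulmxDl -scalemxAl; apply: BL.
    move=> r Wr; rewrite map_mxM fU -!mulmxA -map_mxM inv map_mx1 mulmx1.
    have -> : map_mx (f (- t)) (map_mx j r) = map_mx j r.
      by apply/rowP => k; rewrite !mxE fj.
    exact: BW.
  (* Twice the tangent is the difference of the curve at 1 and at -1: two points of the curve
     recover e without differentiating. *)
  have -> : v *m e = 2%:R^-1 *: (v *m curve e e2 1) + ((- 2%:R^-1) *: (v *m curve e e2 (- 1)) + 0).
    rewrite addr0 /curve expr1n sqrrN expr1n !scale1r scaleN1r !mulmxDr mulmxN mulmx1.
    rewrite scaleNr -scalerBr opprD opprD opprK addrACA subrr addr0 addrACA subrr add0r.
    by rewrite -mulr2n -scaler_nat scalerA mulVf // scale1r.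
  by apply: (C0_lin); [exact: cur|apply: (C0_lin)].
have [k [B0 [_ BP]]] := subspace_matrix C0_0 C0_lin.
(* The constant vectors that generate the relations are none or all. In the first case there is no
   relation; in the second every row vector is one, and Y = 0. *)
have [z|full] : <<B0>>%MS = 0 \/ row_full <<B0>>%MS.
- apply: irr => e Te; apply/row_subP => i; rewrite row_mul genmxE; apply/BP.
  by apply: C0_st => //; apply/BP; rewrite -(genmxE B0) row_sub.
- move=> r Wr; have : [set 0] (map_mx j r *m U).
    apply: (gen [set 0]) => //= [a x y -> ->|v|]; first by rewrite scaler0 addr0.
      by move=> /BP; rewrite -(genmxE B0) z submx0 => /eqP ->; rewrite map_mx0.
    by move=> B _ _; apply.
  move=> /= /(congr1 (fun x => x *m V)); rewrite -mulmxA UV mulmx1 mul0mx => jr.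
  apply/rowP => i; have := congr1 (fun x : 'rV_n => x 0 i) jr; rewrite !mxE => ri.
  apply/eqP; apply: contraTT isT => r0.
  have := congr1 (fun x => j (r 0 i)^-1 * x) ri; rewrite mulr0 -rmorphM mulVf //.
  by rewrite rmorph1 => /eqP; rewrite oner_eq0.
have WS_all (v : 'rV[F]_n) : WS (map_mx (j \o c) v).
  by apply/BP; rewrite -(genmxE B0) submx_full.
have [m [B [_ WB]]] := subspace_matrix W0 W_lin.
exfalso; move/eqP: Y0; apply.
(* A vector z orthogonal to all relations gives V z = 0, since [WS] contains all constant rows;
   hence z = 0. *)
have fullB : row_full B.
  rewrite -col_leq_rank leqNgt; apply/negP => rB.
  have : kermx B^T != 0.
    by rewrite -mxrank_eq0 mxrank_ker mxrank_tr subn_eq0 -ltnNge.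
  case/rowV0Pn => z /sub_kermxP zB z0.
  have Bz : B *m z^T = 0 by rewrite -[B]trmxK -trmx_mul zB trmx0.
  have H x : WS x -> x *m V *m map_mx j z^T = 0.
    move=> Wx; apply: (Wx [set x | x *m V *m map_mx j z^T = 0]) => /=.
    - by rewrite !mul0mx.
    - by move=> a y y' ey ey'; rewrite !mulmxDl -!scalemxAl ey ey' scaler0 addr0.
    move=> r /WB/submxP[D ->]; rewrite -!mulmxA (mulmxA U) UV mul1mx -map_mxM.
    by rewrite -mulmxA Bz mulmx0 map_mx0.
  have Vz : V *m map_mx j z^T = 0.
    apply/row_matrixP => i; rewrite row_mul row0 rowE -mulmxA.
    by have := H _ (WS_all (delta_mx 0 i)); rewrite map_delta_mx -mulmxA.
  have jz : map_mx j z^T = 0 by rewrite -[LHS]mul1mx -UV -mulmxA Vz mulmx0.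
  move/eqP: z0; apply; apply/rowP => i.
  have := congr1 (fun x : 'cV_n => x i 0) jz; rewrite !mxE => zi.
  apply/eqP; apply: contraTT isT => zi0.
  have := congr1 (fun x => j (z 0 i)^-1 * x) zi; rewrite mulr0 -rmorphM mulVf //.
  by rewrite rmorph1 => /eqP; rewrite oner_eq0.
apply/matrixP => i l; rewrite ord1.
have : W (delta_mx 0 i) by apply/WB; rewrite submx_full.
rewrite /W /= map_delta_mx -rowE => /(congr1 (fun x : 'rV_1 => x 0 0)).
by rewrite !mxE.
Qed.

(** The five-point formula 8 (f(1) - f(-1)) - (f(2) - f(-2)) = 12 f'(0) for a quartic f. *)
Lemma quartic_linear_coef (q0 q1 q2 q3 q4 : F) :
  (forall t, q0 + t * q1 + t ^+ 2 * q2 + t ^+ 3 * q3 + t ^+ 4 * q4 = 0) -> q1 = 0.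
Proof.
move=> h; have n12 : 12%:R != 0 :> F by exact: char0.
have e : 12%:R * q1 = 0.
  transitivity (8%:R * ((q0 + 1 * q1 + 1 ^+ 2 * q2 + 1 ^+ 3 * q3 + 1 ^+ 4 * q4)
    - (q0 + -1 * q1 + (-1) ^+ 2 * q2 + (-1) ^+ 3 * q3 + (-1) ^+ 4 * q4))
    - ((q0 + 2%:R * q1 + 2%:R ^+ 2 * q2 + 2%:R ^+ 3 * q3 + 2%:R ^+ 4 * q4)
      - (q0 + (- 2%:R) * q1 + (- 2%:R) ^+ 2 * q2 + (- 2%:R) ^+ 3 * q3 + (- 2%:R) ^+ 4 * q4))).
    by ring.
  by rewrite !h !subrr mulr0 subrr.
by move/eqP: e; rewrite mulf_eq0 (negPf n12) => /eqP.
Qed.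

(** N = U^-1 M U satisfies s(N) = mu N, so a nonzero entry of N is a unit, and N is this unit times
    a constant matrix [Nc] of trace 0. The endomorphisms of a tangent curve fix [Nc], so conjugation
    by the curve maps [Nc] to its multiples; differentiation shows that the commutators of [Nc] with
    the tangents are multiples of [Nc]. *)
Lemma no_rank_one (M : 'M[K]_n) mu : \tr M = 0 -> map_mx sK M *m A = mu *: (A *m M) -> M = 0.
Proof.
move=> trM sM; have [N NdE] : exists N, N = V *m map_mx j M *m U by eexists.
have jinj : injective (j \o c).
  move=> x y /= exy; apply/eqP; rewrite -subr_eq0; apply: contraTT isT => xy0.
  have : j (c ((x - y)^-1 * (x - y))) = 0 by rewrite !rmorphM !rmorphB exy subrr mulr0.
  by rewrite mulVf // !rmorph1 => /eqP; rewrite oner_eq0.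
have MN : map_mx j M = U *m N *m V.
  by rewrite NdE !mulmxA UV mul1mx -mulmxA UV mulmx1.
have sVA : map_mx s V *m map_mx j A = V.
  rewrite -[LHS]mulmx1 -UV mulmxA -[_ *m _ *m U]mulmxA -sU -map_mxM (mulmx1C UV).
  by rewrite map_mx1 mul1mx.
have sN : map_mx s N = j mu *: N.
  rewrite NdE !map_mxM sU mulmxA.
  have -> : map_mx s (map_mx j M) = map_mx j (map_mx sK M).
    by apply/matrixP => k l; rewrite !mxE sj.
  rewrite -(mulmxA (map_mx s V)) -map_mxM sM map_mxZ map_mxM -scalemxAr mulmxA sVA.
  by rewrite -scalemxAl.
have [N0|] := pselect (N = 0).
  have jM0 : map_mx j M = 0 by rewrite MN N0 mulmx0 mul0mx.
  apply/matrixP => i l; have := congr1 (fun x : 'M_n => x i l) jM0; rewrite !mxE => ri.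
  apply/eqP; apply: contraTT isT => r0.
  have := congr1 (fun x => j (M i l)^-1 * x) ri; rewrite mulr0 -rmorphM mulVf //.
  by rewrite rmorph1 => /eqP; rewrite oner_eq0.
move=> N0; have [a [b Nab]] : exists a b, N a b != 0.
  apply: contrapT => none; apply: N0; apply/matrixP => a b; rewrite mxE.
  by apply/eqP; apply: contrapT => /negP ne; apply: none; exists a, b.
have sNk k l : s (N k l) = j mu * N k l.
  by have := congr1 (fun x : 'M_n => x k l) sN; rewrite !mxE.
have [y yN] := simple_semi_invariant_unit simpleS (sNk a b) Nab.
have sy : s y * j mu = y.
  have h : s y * j mu * N a b = 1 by rewrite -mulrA -sNk -rmorphM yN rmorph1.
  by rewrite -[LHS]mulr1 -yN mulrCA h mulr1.
have const k l : exists x, y * N k l = j (c x).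
  by apply: constS; rewrite rmorphM sNk mulrA sy.
have [N1 N1P] := choice (fun kl : 'I_n * 'I_n => const kl.1 kl.2).
have [Nc NcE] : exists Nc, map_mx (j \o c) Nc = y *: N.
  exists (\matrix_(k, l) N1 (k, l)).
  by apply/matrixP => k l; rewrite !mxE; apply/esym; exact: (N1P (k, l)).
have Nab1 : Nc a b = 1.
  apply: jinj; have := congr1 (fun x : 'M_n => x a b) NcE; rewrite !mxE yN => ->.
  by rewrite rmorph1.
have NE : N = N a b *: map_mx (j \o c) Nc by rewrite NcE scalerA mulrC yN scale1r.
suff Nc0 : Nc = 0 by move: Nab1; rewrite Nc0 mxE => /esym/eqP; rewrite oner_eq0.
apply: (no_semi_invariant irr n_gt0 char0).
  apply: jinj; rewrite rmorph0 -[LHS]trace_map_mx NcE mxtraceZ NdE mxtrace_mulC mulmxA UV mul1mx.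
  by rewrite trace_map_mx trM rmorph0 mulr0.
move=> e Te; have [e2 [f fP]] := tangent_endo Te.
have conj t : exists z, curve e e2 (- t) *m Nc *m curve e e2 t = z *: Nc.
  have [fj fU fV _] := fP t.
  have fN : map_mx (f t) N = map_mx (j \o c) (curve e e2 (- t)) *m N *m
      map_mx (j \o c) (curve e e2 t).
    rewrite NdE !map_mxM fU fV -!mulmxA; congr (_ *m (_ *m (_ *m _))).
    by apply/matrixP => k l; rewrite !mxE fj.
  have fNc : map_mx (f t) N = f t (N a b) *: map_mx (j \o c) Nc.
    by rewrite {1}NE map_mxZ; congr (_ *: _); apply/matrixP => k l; rewrite !mxE fj.
  set P := _ *m Nc *m _.
  have PE : map_mx (j \o c) P = (y * f t (N a b)) *: map_mx (j \o c) Nc.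
    rewrite -scalerA -fNc fN NE -!(scalemxAr, scalemxAl) scalerA yN scale1r.
    by rewrite !map_mxM.
  clearbody P; exists (P a b); apply/matrixP => k l; apply: jinj.
  have := congr1 (fun x : 'M_n => x a b) PE; rewrite !mxE Nab1 rmorph1 mulr1 => Pab.
  have := congr1 (fun x : 'M_n => x k l) PE; rewrite !mxE => ->.
  by rewrite -Pab -rmorphM.
exists ((Nc *m e - e *m Nc) a b); apply/matrixP => k l; rewrite [RHS]mxE.
(* [q] measures at (k, l) the failure to be proportional to [Nc], whose entry (a, b) is 1. It
   vanishes along the conjugates of [Nc] by the curve, which are quartic in t with the commutator as
   linear coefficient. *)
pose q (P : 'M[F]_n) := P k l - P a b * Nc k l.
have qD P Q : q (P + Q) = q P + q Q by rewrite /q !mxE; ring.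
have qZ z P : q (z *: P) = z * q P by rewrite /q !mxE; ring.
suff : q (Nc *m e - e *m Nc) = 0 by move=> /eqP; rewrite subr_eq0 => /eqP.
apply: (@quartic_linear_coef (q Nc) _ (q (Nc *m e2 - e *m Nc *m e + e2 *m Nc))
  (q (e2 *m Nc *m e - e *m Nc *m e2)) (q (e2 *m Nc *m e2))) => t.
rewrite -!qZ -!qD; have [z zE] := conj t.
have -> : Nc + t *: (Nc *m e - e *m Nc) + t ^+ 2 *: (Nc *m e2 - e *m Nc *m e + e2 *m Nc) +
   t ^+ 3 *: (e2 *m Nc *m e - e *m Nc *m e2) + t ^+ 4 *: (e2 *m Nc *m e2) =
   curve e e2 (- t) *m Nc *m curve e e2 t.
  rewrite /curve sqrrN !mulmxDl !mulmxDr !mul1mx !mulmx1.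
  rewrite -!(scalemxAl, scalemxAr) !scalerA.
  move: (Nc *m e) (e *m Nc) (Nc *m e2) (e *m Nc *m e) (e2 *m Nc) (e2 *m Nc *m e)
    (e *m Nc *m e2) (e2 *m Nc *m e2) => P1 P2 P3 P4 P5 P6 P7 P8.
  by apply/matrixP => k' l'; rewrite !mxE; ring.
by rewrite zE qZ /q Nab1 mul1r subrr mulr0.
Qed.
End SolutionSpace.

(** * Unipotent tangents of the classical groups *)

Section Families.
Lemma tr_mxD (R : nzRingType) m n (A B : 'M[R]_(m, n)) : (A + B)^T = A^T + B^T.
Proof. exact: linearD. Qed.

Lemma tr_mxB (R : nzRingType) m n (A B : 'M[R]_(m, n)) : (A - B)^T = A^T - B^T.
Proof. exact: linearB. Qed.

Lemma tr_mxZ (R : nzRingType) m n a (A : 'M[R]_(m, n)) : (a *: A)^T = a *: A^T.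
Proof. exact: linearZ. Qed.

Variables (F : fieldType) (n : nat).
Implicit Types (e : 'M[F]_n) (u v w : 'cV[F]_n).

(** The equations say that [e2] is e^2 / 2 and that e^3 = 0, so that the curve is the one-parameter
    subgroup exp(t e). *)
Definition unipotent_tangents (G : set 'M[F]_n) : set 'M[F]_n :=
  [set e | exists e2, [/\ e *m e = e2 *+ 2, e *m e2 = 0, e2 *m e = 0 & e2 *m e2 = 0] /\
    forall t, G (curve e e2 t)].

Lemma curve_add e e2 s t : e *m e = e2 *+ 2 -> e *m e2 = 0 -> e2 *m e = 0 ->
  e2 *m e2 = 0 -> curve e e2 s *m curve e e2 t = curve e e2 (s + t).
Proof.
move=> h1 h2 h3 h4; rewrite /curve !mulmxDl !mulmxDr !mul1mx !mulmx1.
rewrite -!(scalemxAl, scalemxAr) h1 h2 h3 h4 !scaler0 !addr0.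
by apply/matrixP => k l; rewrite !mxE; ring.
Qed.

Lemma curve0 e e2 : curve e e2 0 = 1%:M.
Proof. by rewrite /curve expr0n !scale0r !addr0. Qed.

Lemma irreducible_vectors (T : set 'M[F]_n) :
  (forall B : 'M[F]_n, (forall e, T e -> (B *m e <= B)%MS) ->
    forall v : 'rV_n, v != 0 -> (v <= B)%MS -> forall i, ((delta_mx 0 i : 'rV[F]_n) <= B)%MS) ->
  irreducible T.
Proof.
move=> h B stB; have [->|/rowV0Pn[v vB v0]] := eqVneq B 0; first by left.
right; rewrite -sub1mx; apply/row_subP => i; rewrite row1.
exact: h vB i.
Qed.

Lemma stable_sub (B : 'M[F]_n) e m (v : 'M_(m, n)) :
  (B *m e <= B)%MS -> (v <= B)%MS -> (v *m e <= B)%MS.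
Proof. by move=> st vB; apply: submx_trans st; apply: submxMr. Qed.

Lemma mul_row_delta (v : 'rV[F]_n) i l : v *m delta_mx i l = v 0 i *: (delta_mx 0 l : 'rV_n).
Proof.
apply/rowP => k; rewrite !mxE (bigD1 i) //= big1 => [|m mi].
  by rewrite !mxE !eqxx addr0.
by rewrite !mxE (negPf mi) mulr0.
Qed.

Lemma rV_neq0 (v : 'rV[F]_n) : v != 0 -> exists i, v 0 i != 0.
Proof.
move=> v0; apply: contrapT => /forallNP none; move/eqP: v0; apply; apply/rowP => i.
by rewrite mxE; have /negP := none i; rewrite negbK => /eqP.
Qed.

(** Transvections 1 + t E_il: a vector with nonzero coordinate at i is sent by E_il to a nonzero
    multiple of the l-th basis vector, and E_li leads back to the i-th. *)
Lemma SL_irreducible : (1 < n)%N -> irreducible (unipotent_tangents (@SL F n)).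
Proof.
move=> n1.
have T_delta (i l : 'I_n) : i != l -> unipotent_tangents (@SL F n) (delta_mx i l).
  move=> il; exists 0; split.
    by split; rewrite ?mulmx0 ?mul0mx // mul0rn mul_delta_mx_cond eq_sym (negPf il) mulr0n.
  move=> t; rewrite /SL /= /curve scaler0 addr0.
  (* Up to transposition the matrix is lower triangular with diagonal entries 1. *)
  wlog li : i l il / (l < i)%N.
    move=> W; move: (il); rewrite neq_ltn => /orP[lt_il|lt_li]; last exact: W.
    rewrite -det_tr tr_mxD trmx1 tr_mxZ trmx_delta.
    by apply: W => //; rewrite eq_sym.
  rewrite det_trig.
    rewrite big1 // => k _; rewrite !mxE eqxx.
    have [->|ki] := eqVneq k i; first by rewrite (negPf il) mulr0 addr0.
    by rewrite mulr0 addr0.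
  apply/is_trig_mxP => a b ab; rewrite !mxE.
  have -> : (a == b) = false by rewrite -val_eqE /= ltn_eqF.
  rewrite mulr0n add0r; case: eqP => [ai|]; last by rewrite mulr0.
  case: eqP => [bl|]; last by rewrite mulr0.
  by move: (ltn_trans ab (eq_ind_r (fun x : 'I_n => (x < i)%N) li bl)); rewrite ai ltnn.
apply: irreducible_vectors => B stB v /rV_neq0[i vi] vB.
have dB l : l != i -> ((delta_mx 0 l : 'rV[F]_n) <= B)%MS.
  move=> li; have := stable_sub (stB _ (@T_delta i l _)) vB.
  rewrite eq_sym => /(_ li); rewrite mul_row_delta => /(scalemx_sub (v 0 i)^-1).
  by rewrite scalerA mulVf // scale1r.
have [l li] : exists l : 'I_n, l != i.
  have [->|] := eqVneq i (Ordinal n1); last by exists (Ordinal n1); rewrite eq_sym.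
  by exists (Ordinal (ltnW n1)); rewrite -val_eqE.
move=> k; have [->|/dB//] := eqVneq k i.
have := stable_sub (stB _ (T_delta l i li)) (dB l li).
by rewrite mul_delta_mx.
Qed.

Hypothesis two_neq0 : 2%:R != 0 :> F.

Section Symplectic.
Hypothesis n_even : ~~ odd n.
Let J := symplectic_form F n.

Lemma symplectic_formT : J^T = - J.
Proof. by apply/matrixP => i l; rewrite !mxE opprB. Qed.

Lemma symplectic_form_sq : J *m J = - 1%:M.
Proof.
have nE : n = (n./2 + n./2)%N by rewrite addnn -[LHS]odd_double_half (negPf n_even).
apply/matrixP => i k; rewrite !mxE.
have [ih|hi] := ltnP i n./2.
  have lt : (i + n./2 < n)%N by rewrite [X in (_ < X)%N]nE ltn_add2r.
  rewrite (bigD1 (Ordinal lt)) //= !mxE /= big1 ?addr0 => [|l lP].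
    rewrite eqxx eqn_add2r (_ : (i == i + n./2 + n./2 :> nat)%N = false); last by lia.
    rewrite (_ : (k == i + n./2 + n./2 :> nat)%N = false); last by have := ltn_ord k; lia.
    by rewrite subr0 mul1r sub0r val_eqE.
  rewrite !mxE (_ : (l == i + n./2 :> nat)%N = false); last first.
    by apply: contraNF lP => /eqP e; apply/eqP/val_inj.
  by rewrite (_ : (i == l + n./2 :> nat)%N = false) ?subr0 ?mul0r //; lia.
have lt : (i - n./2 < n)%N by rewrite (leq_ltn_trans (leq_subr _ _)).
rewrite (bigD1 (Ordinal lt)) //= !mxE /= big1 ?addr0 => [|l lP].
  rewrite subnK // eqxx.
  rewrite (_ : (i - n./2 == i + n./2 :> nat)%N = false); last by have := ltn_ord i; lia.
  rewrite (_ : (i - n./2 == k + n./2 :> nat)%N = false); last by have := ltn_ord i; lia.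
  by rewrite subr0 sub0r mulN1r -val_eqE /= [in LHS]eq_sym.
rewrite !mxE (_ : (i == l + n./2 :> nat)%N = false); last first.
  by apply: contraNF lP => /eqP e; apply/eqP/val_inj => /=; rewrite e addnK.
by rewrite (_ : (l == i + n./2 :> nat)%N = false) ?subr0 ?mul0r //; have := ltn_ord l; lia.
Qed.

Lemma symplectic_alternating v : v^T *m J *m v = 0.
Proof.
have h : (v^T *m J *m v)^T = - (v^T *m J *m v).
  by rewrite !trmx_mul trmxK symplectic_formT mulNmx mulmxN mulmxA.
apply/matrixP => a b; rewrite !ord1.
have : (v^T *m J *m v) 0 0 = - (v^T *m J *m v) 0 0.
  by have := congr1 (fun M : 'M_1 => M 0 0) h; rewrite [LHS]mxE [RHS]mxE.
move/eqP; rewrite [RHS]mxE.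
by rewrite -addr_eq0 -mulr2n -mulr_natl mulf_eq0 (negPf two_neq0) => /eqP.
Qed.

(** Symplectic transvections 1 + t w w^T J. A row v is sent to (v w) w^T J, so w^T J is reached when
    v w is nonzero; any other w is a difference of two vectors with this property, and J is
    invertible. *)
Lemma Sp_irreducible : irreducible (unipotent_tangents (@Sp F n)).
Proof.
have T_v v : unipotent_tangents (@Sp F n) (v *m v^T *m J).
  have alt := symplectic_alternating v.
  have sq : v *m v^T *m J *m (v *m v^T *m J) = 0.
    have -> : v *m v^T *m J *m (v *m v^T *m J) = v *m (v^T *m J *m v) *m v^T *m J.
      by rewrite !mulmxA.
    by rewrite alt mulmx0 !mul0mx.
  exists 0; split; first by split; rewrite ?sq ?mulmx0 ?mul0mx ?mul0rn.
  move=> t; split.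
    have [|] := mulmx1_unit (_ : curve (v *m v^T *m J) 0 t *m curve (v *m v^T *m J) 0 (- t) = 1%:M) => //.
    by rewrite curve_add ?addrN ?curve0 // ?sq ?mulmx0 ?mul0mx ?mul0rn.
  have XJ : (v *m v^T *m J)^T *m J = - (J *m (v *m v^T *m J)).
    by rewrite !trmx_mul trmxK symplectic_formT !mulNmx !mulmxA.
  rewrite -/J /curve scaler0 addr0; move: (v *m v^T *m J) sq XJ => X sq XJ.
  rewrite tr_mxD tr_mxZ trmx1 mulmxDl mul1mx -scalemxAl XJ mulmxDr mulmx1 mulmxDl.
  rewrite -!(scalemxAl, scalemxAr) mulNmx -mulmxA sq mulmx0 oppr0 !scaler0 addr0.
  by rewrite scalerN subrK.
apply: irreducible_vectors => B stB v v0 vB.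
have some w : v *m w != 0 -> (w^T *m J <= B)%MS.
  move=> vw; have := stable_sub (stB _ (T_v w)) vB.
  rewrite !mulmxA [v *m w]mx11_scalar -mulmxA mul_scalar_mx.
  move=> /(scalemx_sub ((v *m w) 0 0)^-1); rewrite scalerA mulVf ?scale1r //.
  by apply: contraNneq vw => h; rewrite [v *m w]mx11_scalar h raddf0.
have [i vi] := rV_neq0 v0.
have v_i : v *m (delta_mx i 0 : 'cV_n) != 0.
  rewrite -colE; apply: contraNneq vi => /(congr1 (fun M : 'M_1 => M 0 0)).
  by rewrite !mxE => ->.
have all w : (w^T *m J <= B)%MS.
  have [vw|/some//] := eqVneq (v *m w) 0.
  have -> : w = (w + delta_mx i 0) - delta_mx i 0 by rewrite addrK.
  rewrite tr_mxB mulmxBl addmx_sub ?eqmx_opp ?some //.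
  by rewrite mulmxDr vw add0r.
move=> k; have := all ((delta_mx 0 k *m - J)^T).
by rewrite trmxK -mulmxA mulNmx symplectic_form_sq opprK mulmx1.
Qed.
End Symplectic.

Section Orthogonal.
Variable iu : F.
Hypothesis iuP : iu * iu = -1.

(** Tangents u w^T - w u^T with u isotropic and w a unit vector orthogonal to u: their square is - u
    u^T and their cube is 0. Here u = e_i + a e_l with a^2 = -1, and w is a third basis vector,
    which exists because n >= 3. *)
Lemma SO_irreducible : (2 < n)%N -> irreducible (unipotent_tangents (@SO F n)).
Proof.
move=> n2.
have T_uw u w : u^T *m u = 0 -> u^T *m w = 0 -> w^T *m w = 1%:M ->
    unipotent_tangents (@SO F n) (u *m w^T - w *m u^T).
  move=> uu uw ww.
  have wu : w^T *m u = 0 by rewrite -[LHS]trmxK trmx_mul trmxK uw trmx0.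
  set e := _ - _; pose e2 : 'M[F]_n := (- 2%:R^-1) *: (u *m u^T).
  have eu : e *m u = 0.
    by rewrite /e mulmxBl -!mulmxA wu uu !mulmx0 subrr.
  have ue : u^T *m e = 0.
    by rewrite /e mulmxBr !mulmxA uu uw !mul0mx subrr.
  have h1 : e *m e = e2 *+ 2.
    have ew : e *m w = u by rewrite /e mulmxBl -!mulmxA ww uw mulmx1 mulmx0 subr0.
    rewrite {2}/e mulmxBr !mulmxA eu ew mul0mx sub0r.
    by rewrite /e2 -scaler_nat scalerA mulrN mulfV // scaleN1r.
  have h2 : e *m e2 = 0 by rewrite /e2 -scalemxAr mulmxA eu mul0mx scaler0.
  have h3 : e2 *m e = 0 by rewrite /e2 -scalemxAl -mulmxA ue mulmx0 scaler0.
  have h4 : e2 *m e2 = 0.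
    by rewrite /e2 -scalemxAl -scalemxAr -mulmxA (mulmxA u^T) uu mul0mx mulmx0 !scaler0.
  have tr t : (curve e e2 t)^T = curve e e2 (- t).
    have eT : e^T = - e by rewrite /e tr_mxB !trmx_mul !trmxK opprB.
    have e2T : e2^T = e2 by rewrite {1}/e2 tr_mxZ trmx_mul trmxK.
    rewrite /curve 2!tr_mxD (tr_mxZ t e) (tr_mxZ (t ^+ 2) e2) eT e2T trmx1 sqrrN.
    by rewrite scalerN scaleNr.
  have orth t : (curve e e2 t)^T *m curve e e2 t = 1%:M.
    by rewrite tr curve_add // addNr curve0.
  exists e2; split=> // t; split; last exact: orth.
  (* Orthogonality alone leaves the sign of the determinant open; the curve at t is the square of
     the curve at t / 2. *)
  have -> : t = t / 2%:R + t / 2%:R by rewrite -mulrDl -mulr2n -[t *+ 2]mulr_natr mulfK.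
  rewrite -curve_add // det_mulmx -[X in X * _]det_tr -det_mulmx.
  by rewrite orth det1.
pose ucol (i l : 'I_n) a : 'cV[F]_n := delta_mx i 0 + a *: delta_mx l 0.
have dd (i l : 'I_n) : (delta_mx i 0 : 'cV[F]_n)^T *m delta_mx l 0 = (i == l)%:R%:M.
  rewrite trmx_delta mul_delta_mx_cond; apply/matrixP => x y; rewrite !ord1 !mxE eqxx.
  by case: eqP => _; rewrite ?mulr0n ?mulr1n mxE ?eqxx.
have uu (i l : 'I_n) a b : i != l -> (ucol i l a)^T *m ucol i l b = (1 + a * b)%:M.
  move=> il; rewrite /ucol tr_mxD tr_mxZ mulmxDl !mulmxDr -!(scalemxAl, scalemxAr) !dd.
  rewrite !eqxx (eq_sym l i) (negPf il) /= mulr1n mulr0n raddf0 !scaler0 addr0 add0r.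
  by rewrite scalerA scalemx1 -raddfD.
apply: irreducible_vectors => B stB.
(* Applying the tangent twice sends v to - (v u) u^T. *)
have step (v : 'rV[F]_n) (i l : 'I_n) (a : F) : i != l -> a * a = -1 -> (v <= B)%MS -> v *m ucol i l a != 0 ->
    ((ucol i l a)^T <= B)%MS.
  move=> il aa vB vu.
  have [k ki kl] : exists2 k : 'I_n, k != i & k != l.
    have [k] : exists k : 'I_n, k \notin [:: i; l].
      apply: contrapT => none; have : (size (enum 'I_n) <= size [:: i; l])%N.
        apply: uniq_leq_size (enum_uniq _) _ => k _.
        by apply: contrapT => /negP kn; apply: none; exists k.
      by rewrite size_enum_ord leqNgt n2.
    by rewrite !inE negb_or => /andP[ki kl]; exists k.
  have Tuk : unipotent_tangents (@SO F n)
      (ucol i l a *m (delta_mx k 0)^T - delta_mx k 0 *m (ucol i l a)^T).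
    apply: T_uw.
    - by rewrite uu // aa addrN raddf0.
    - rewrite /ucol tr_mxD tr_mxZ mulmxDl -scalemxAl !dd.
      by rewrite (eq_sym i) (negPf ki) (eq_sym l) (negPf kl) /= mulr0n raddf0 scaler0 addr0.
    - by rewrite dd eqxx.
  have := stable_sub (stB _ Tuk) (stable_sub (stB _ Tuk) vB).
  have [e2 [[h1 _ _ _] _]] := Tuk; set w := delta_mx k 0 in Tuk h1 *.
  have ww : w^T *m w = 1%:M by rewrite dd eqxx.
  have uw : (ucol i l a)^T *m w = 0.
    rewrite /ucol tr_mxD tr_mxZ mulmxDl -scalemxAl !dd.
    by rewrite (eq_sym i) (negPf ki) (eq_sym l) (negPf kl) /= mulr0n raddf0 scaler0 addr0.
  have wu : w^T *m ucol i l a = 0 by rewrite -[LHS]trmxK trmx_mul trmxK uw trmx0.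
  have uu0 : (ucol i l a)^T *m ucol i l a = 0 by rewrite uu // aa addrN raddf0.
  move: vu uw wu uu0; set u := ucol i l a => vu uw wu uu0.
  rewrite -mulmxA.
  have -> : (u *m w^T - w *m u^T) *m (u *m w^T - w *m u^T) = - (u *m u^T).
    rewrite mulmxBl !mulmxBr !mulmxA.
    rewrite -![_ *m w^T *m u]mulmxA wu mulmx0 mul0mx sub0r.
    rewrite -[u *m w^T *m w]mulmxA ww mulmx1.
    rewrite -![_ *m u^T *m _]mulmxA uu0 uw !mulmx0 !mul0mx subrr subr0 //.
  rewrite mulmxN eqmx_opp mulmxA [v *m u]mx11_scalar mul_scalar_mx.
  move=> /(scalemx_sub ((v *m u) 0 0)^-1); rewrite scalerA mulVf ?scale1r //.
  by apply: contraNneq vu => h; rewrite [v *m u]mx11_scalar h raddf0.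
move=> v /rV_neq0[i vi] vB.
have aiu : (- iu) * (- iu) = -1 by rewrite mulrNN.
have iu0 : iu != 0 by apply: contraTneq isT => h; move: iuP; rewrite h mulr0 => /eqP;
  rewrite eq_sym oppr_eq0 oner_eq0.
(* The product of e_i + a e_l with e_i - a e_l is 1 - a^2 = 2, so the second vector is reached from
   the first; together they span e_i and e_l. *)
have pair (l : 'I_n) (a : F) : i != l -> a * a = -1 -> ((ucol i l a)^T <= B)%MS ->
    ((delta_mx 0 i : 'rV[F]_n) <= B)%MS && ((delta_mx 0 l : 'rV[F]_n) <= B)%MS.
  move=> il aa uB.
  have a0 : a != 0 by apply: contraTneq isT => h; move: aa; rewrite h mulr0 => /eqP;
    rewrite eq_sym oppr_eq0 oner_eq0.
  have u'B : ((ucol i l (- a))^T <= B)%MS.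
    apply: (step (ucol i l a)^T) => //; first by rewrite mulrNN.
    rewrite uu // mulrN aa opprK; apply: contraNneq two_neq0 => /(congr1 (fun M : 'M_1 => M 0 0)).
    by rewrite !mxE eqxx mulr1n => h; apply/eqP; exact: h.
  have trE b : (ucol i l b)^T = delta_mx 0 i + b *: (delta_mx 0 l : 'rV_n).
    by rewrite /ucol tr_mxD tr_mxZ !trmx_delta.
  have h1 : (delta_mx 0 i : 'rV[F]_n) = 2%:R^-1 *: ((ucol i l a)^T + (ucol i l (- a))^T).
    rewrite !trE scaleNr addrACA subrr addr0 -mulr2n -scaler_nat scalerA mulVf //.
    by rewrite scale1r.
  have h2 : (delta_mx 0 l : 'rV_n) = a^-1 *: ((ucol i l a)^T - delta_mx 0 i).
    by rewrite trE addrC addKr scalerA mulVf // scale1r.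
  have iB : ((delta_mx 0 i : 'rV[F]_n) <= B)%MS by rewrite h1 scalemx_sub // addmx_sub.
  by rewrite iB h2 scalemx_sub // addmx_sub // eqmx_opp.
(* The products of v with e_i + iu e_l and e_i - iu e_l add up to 2 v_i, so one of them is
   nonzero. *)
have both (l : 'I_n) : i != l -> ((delta_mx 0 i : 'rV[F]_n) <= B)%MS && ((delta_mx 0 l : 'rV[F]_n) <= B)%MS.
  move=> il; have [v1|v1] := eqVneq (v *m ucol i l iu) 0; last first.
    by apply: (pair l iu) => //; apply: (step v).
  apply: (pair l (- iu)) => //; apply: (step v) => //.
  have e : v *m ucol i l iu + v *m ucol i l (- iu) = (2%:R * v 0 i)%:M.
    rewrite -mulmxDr /ucol scaleNr addrACA subrr addr0 -mulr2n -scaler_nat -scalemxAr.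
    rewrite -colE; apply/matrixP => x y; rewrite !ord1 !mxE eqxx mulr1n //.
  apply: contraNneq vi => h; move: e; rewrite v1 h addr0 => /(congr1 (fun M : 'M_1 => M 0 0)).
  by rewrite !mxE eqxx mulr1n => /esym/eqP; rewrite mulf_eq0 (negPf two_neq0).
move=> k; have [<-|/both/andP[]//] := eqVneq i k.
have [l il] : exists l : 'I_n, i != l.
  have n1 : (1 < n)%N by apply: ltnW.
  have [->|] := eqVneq i (Ordinal n1); last by exists (Ordinal n1).
  by exists (Ordinal (ltnW n1)); rewrite -val_eqE.
by have /andP[] := both l il.
Qed.
End Orthogonal.
End Families.

(** * Brackets of derivations *)

Lemma additive_pack (A B : zmodType) (f : A -> B) : zmod_morphism f ->
  exists g : {additive A -> B}, g =1 f.
Proof.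
by move=> fB; exists (HB.pack_for {additive A -> B} f (GRing.isZmodMorphism.Build A B f fB)).
Qed.

Section Functionals.
Variables (K E : fieldType) (f : {rmorphism K -> E}).

(** A subspace that is maximal among those containing V and avoiding x is a hyperplane; the
    functional is the coordinate along x modulo it. *)
Lemma functional_exists (V : set E) x : V 0 ->
  (forall k y z, V y -> V z -> V (f k * y + z)) -> ~ V x ->
  exists lam : {additive E -> K}, [/\ forall k y, lam (f k * y) = k * lam y,
    forall y, V y -> lam y = 0 & lam x = 1].
Proof.
move=> V0 VL Vx.
pose P := [set W : set E | [/\ W 0, forall k y z, W y -> W z -> W (f k * y + z) & ~ W x]].
have [W [[W0 WL Wx] VW maxW]] : exists W, [/\ P W, V `<=` W &
    forall B, P B -> W `<=` B -> B = W].
  apply: zorn_above => // C CP CV _ tot; split.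
  - by exists V.
  - move=> k u v [A CA Au] [B CB Bv]; case: (tot _ _ CA CB) => sub.
      by exists B => //; case: (CP _ CB) => _ + _; apply=> //; apply: sub.
    by exists A => //; case: (CP _ CA) => _ + _; apply=> //; apply: sub.
  - by move=> [A CA Ax]; case: (CP _ CA).
have WB y z : W y -> W z -> W (y - z).
  by move=> Wy Wz; rewrite addrC -mulN1r -(rmorphN1 f); apply: WL.
have WZ k y : W y -> W (f k * y) by move=> Wy; rewrite -[_ * _]addr0; apply: WL.
have decomp y : exists k, W (y - f k * x).
  have [Wy|Wy] := pselect (W y); first by exists 0; rewrite rmorph0 mul0r subr0.
  pose B := [set z | exists k w, W w /\ z = f k * y + w].
  have WsB : W `<=` B by move=> w Ww; exists 0, w; rewrite rmorph0 mul0r add0r.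
  have [k [w [Ww xE]]] : B x.
    apply: contrapT => Bx; apply: Wy; rewrite -(maxW B) //.
      by exists 1, 0; rewrite rmorph1 mul1r addr0.
    split=> //; first exact: WsB.
    move=> k _ _ [a [u [Wu ->]]] [b [v [Wv ->]]]; exists (k * a + b), (f k * u + v).
    split; first exact: WL.
    by rewrite rmorphD rmorphM; ring.
  have k0 : k != 0 by apply: contra_notN Wx => /eqP k0; rewrite xE k0 rmorph0 mul0r add0r.
  exists k^-1; rewrite xE mulrDr mulrA -rmorphM mulVf // rmorph1 mul1r opprD addrA subrr.
  by rewrite sub0r -mulNr -rmorphN; apply: WZ.
have [k kP] := choice decomp.
have uniq a y : W (y - f a * x) -> k y = a.
  move=> Wa; apply/eqP; rewrite -subr_eq0; apply: contra_notT Wx => d0.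
  have -> : x = f (k y - a)^-1 * ((y - f a * x) - (y - f (k y) * x)).
    have -> : (y - f a * x) - (y - f (k y) * x) = f (k y - a) * x by rewrite rmorphB; ring.
    by rewrite mulrA -rmorphM mulVf // rmorph1 mul1r.
  by apply: WZ; apply: WB.
have [|lam lamE] := @additive_pack E K k.
  move=> y z; apply: uniq; rewrite rmorphB.
  have -> : y - z - (f (k y) - f (k z)) * x = (y - f (k y) * x) - (z - f (k z) * x) by ring.
  exact: WB.
exists lam; split=> [a y|y Vy|]; rewrite lamE ?lamE; apply: uniq.
- by rewrite rmorphM -mulrA -mulrBr; apply: WZ.
- by rewrite rmorph0 mul0r subr0; apply: VW.
by rewrite rmorph1 mul1r subrr.
Qed.

(** A family [b] generating the span of [xs], with coordinate functions defined on all of E. They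
    split identities over E into identities over K. *)
Lemma dual_decomposition (xs : seq E) : exists r (b : 'I_r -> E)
    (lam : 'I_r -> {additive E -> K}),
  (forall i k y, lam i (f k * y) = k * lam i y) /\
  forall x, x \in xs -> x = \sum_i f (lam i x) * b i.
Proof.
elim: xs => [|x xs [r [b [lam [lamZ lamE]]]]].
  by exists 0%N, (fun=> 0), (fun=> \0); split=> // -[].
pose V := [set y | forall B : set E, B 0 ->
  (forall k y z, B y -> B z -> B (f k * y + z)) -> (forall z, z \in xs -> B z) -> B y].
have lin k y z : y = \sum_i f (lam i y) * b i -> z = \sum_i f (lam i z) * b i ->
    f k * y + z = \sum_i f (lam i (f k * y + z)) * b i.
  move=> ey ez; rewrite {1}ey {1}ez mulr_sumr -big_split; apply: eq_bigr => i _.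
  by rewrite raddfD /= lamZ rmorphD rmorphM mulrDl mulrA.
have [Vx|Vx] := pselect (V x).
  exists r, b, lam; split=> // y; rewrite inE => /predU1P[->|/lamE//].
  apply: (Vx [set y | y = \sum_i f (lam i y) * b i]) => //=.
    by rewrite big1 // => i _; rewrite raddf0 rmorph0 mul0r.
have [||l0 [l0Z l0V l0x]] := @functional_exists V x _ _ Vx.
- by move=> B.
- by move=> k y z Vy Vz B B0 BL Bxs; apply: (BL); [exact: Vy|exact: Vz].
pose lam' (i : 'I_r.+1) := if unlift ord0 i is Some i' then lam i' else l0.
pose b' (i : 'I_r.+1) := if unlift ord0 i is Some i' then b i' else
  x - \sum_i f (lam i x) * b i.
have sumE y : \sum_i f (lam' i y) * b' i =
    f (l0 y) * (x - \sum_i f (lam i x) * b i) + \sum_i f (lam i y) * b i.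
  rewrite big_ord_recl /lam' /b' unlift_none; congr (_ + _).
  by apply: eq_bigr => i _; rewrite !liftK.
exists r.+1, b', lam'; split.
  by move=> i k y; rewrite /lam'; case: unlift.
move=> y; rewrite inE sumE => /predU1P[->|yxs].
  by rewrite l0x rmorph1 mul1r subrK.
rewrite l0V ?rmorph0 ?mul0r ?add0r; first exact: lamE.
by move=> B _ _; apply.
Qed.
End Functionals.

(** * Block-diagonal systems *)

Section BlockDiagonal.
Variables (m n : nat).

Definition unblk (k : 'I_(m * n)) : 'I_m * 'I_n :=
  enum_val (cast_ord (esym (mxvec_cast m n)) k).

Lemma unblkK (a : 'I_m) (i : 'I_n) : unblk (mxvec_index a i) = (a, i).
Proof. by rewrite /unblk /mxvec_index cast_ordK enum_rankK. Qed.

Lemma blk_indexP k : exists (a : 'I_m) (i : 'I_n), k = mxvec_index a i.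
Proof. by case/mxvec_indexP: k => a i; exists a, i. Qed.

Lemma sum_blk (R : nmodType) (f : 'I_(m * n) -> R) :
  \sum_k f k = \sum_a \sum_i f (mxvec_index a i).
Proof.
rewrite pair_big /= (reindex (fun x : 'I_m * 'I_n => mxvec_index x.1 x.2)) //=.
by exists unblk => [[a i] _|k _] /=; [rewrite unblkK|case: (blk_indexP k) => a [i ->]; rewrite unblkK].
Qed.

(** Several systems are merged into one, so that a single derivation of L acts on all their
    solutions at once. *)
Definition blk (R : nmodType) (B : nat -> 'M[R]_n) : 'M[R]_(m * n) :=
  \matrix_(k, l) if (unblk k).1 == (unblk l).1 then B (unblk k).1 (unblk k).2 (unblk l).2
    else 0.

Definition blk_col (R : nmodType) (Y : nat -> 'cV[R]_n) : 'cV[R]_(m * n) :=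
  \col_k Y (unblk k).1 (unblk k).2 0.

Lemma blkE (R : nmodType) (B : nat -> 'M[R]_n) (a : 'I_m) i (b : 'I_m) l :
  blk B (mxvec_index a i) (mxvec_index b l) = if a == b then B a i l else 0.
Proof. by rewrite mxE !unblkK. Qed.

Lemma blk_colE (R : nmodType) (Y : nat -> 'cV[R]_n) (a : 'I_m) i :
  blk_col Y (mxvec_index a i) 0 = Y a i 0.
Proof. by rewrite mxE !unblkK. Qed.

Lemma mul_blk (R : comNzRingType) (B C : nat -> 'M[R]_n) :
  blk B *m blk C = blk (fun a => B a *m C a).
Proof.
apply/matrixP => k l; have [a [i ->]] := blk_indexP k; have [b [h ->]] := blk_indexP l.
rewrite mxE sum_blk blkE (bigD1 a) //= [X in _ + X]big1 ?addr0 => [|a' a'a].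
  rewrite mxE; under eq_bigr do rewrite !blkE eqxx.
  by case: eqP => // _; rewrite big1 // => x _; rewrite mulr0.
by apply: big1 => x _; rewrite blkE eq_sym (negPf a'a) mul0r.
Qed.

Lemma mul_blk_col (R : comNzRingType) (B : nat -> 'M[R]_n) (Y : nat -> 'cV[R]_n) :
  blk B *m blk_col Y = blk_col (fun a => B a *m Y a).
Proof.
apply/matrixP => k l; have [a [i ->]] := blk_indexP k; rewrite ord1.
rewrite mxE sum_blk blk_colE (bigD1 a) //= [X in _ + X]big1 ?addr0 => [|a' a'a].
  by rewrite mxE; apply: eq_bigr => x _; rewrite blkE blk_colE eqxx.
by apply: big1 => x _; rewrite blkE eq_sym (negPf a'a) mul0r.
Qed.

Lemma map_blk (R T : nmodType) (f : R -> T) (B : nat -> 'M[R]_n) : f 0 = 0 ->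
  map_mx f (blk B) = blk (fun a => map_mx f (B a)).
Proof. by move=> f0; apply/matrixP => k l; rewrite !mxE; case: eqP. Qed.

Lemma map_blk_col (R T : nmodType) (f : R -> T) (Y : nat -> 'cV[R]_n) :
  map_mx f (blk_col Y) = blk_col (fun a => map_mx f (Y a)).
Proof. by apply/matrixP => k l; rewrite !mxE. Qed.

Lemma eq_blk (R : nmodType) (B C : nat -> 'M[R]_n) :
  (forall a, (a < m)%N -> B a = C a) -> blk B = blk C.
Proof. by move=> BC; apply/matrixP => k l; rewrite !mxE BC. Qed.

Lemma eq_blk_col (R : nmodType) (B C : nat -> 'cV[R]_n) :
  (forall a, (a < m)%N -> B a = C a) -> blk_col B = blk_col C.
Proof. by move=> BC; apply/matrixP => k l; rewrite !mxE BC. Qed.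

Lemma blk_col_inj (R : nmodType) (B C : nat -> 'cV[R]_n) : blk_col B = blk_col C ->
  forall a, (a < m)%N -> B a = C a.
Proof.
move=> e a am; apply/matrixP => i l; rewrite ord1.
have := congr1 (fun M : 'cV_(m * n) => M (mxvec_index (Ordinal am) i) 0) e.
by rewrite !blk_colE.
Qed.

Lemma blk1 (R : comNzRingType) : blk (fun=> 1%:M : 'M[R]_n) = 1%:M.
Proof.
apply/matrixP => k l; have [a [i ->]] := blk_indexP k; have [b [h ->]] := blk_indexP l.
have -> : (1%:M : 'M[R]_(m * n)) (mxvec_index a i) (mxvec_index b h) =
    ((a == b) && (i == h))%:R.
  rewrite mxE; congr (nat_of_bool _)%:R.
  apply/eqP/andP => [/(congr1 unblk)|[/eqP -> /eqP ->] //].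
  by rewrite !unblkK => -[-> ->].
by rewrite blkE mxE; case: (a == b).
Qed.
End BlockDiagonal.

Section Tower.
Variables (F : closedFieldType) (K : fieldType) (c : {rmorphism F -> K})
  (sK : {rmorphism K -> K}).
Variables (S : comNzRingType) (j : {rmorphism K -> S}) (s : {rmorphism S -> S}).
Hypotheses (sj : forall k, s (j k) = j (sK k)) (simpleS : sigma_simple s)
  (countS : countably_spanned j).
Variables (n : nat) (A A' : nat -> 'M[K]_n) (U V : 'M[S]_n).
Hypotheses (AA' : forall i, A i *m A' i = 1%:M)
  (sU : map_mx s U = map_mx j (A 0%N) *m U) (UV : U *m V = 1%:M).

(** The tower starts with S itself, which keeps the matrix U on which the Galois group acts; each
    further step adjoins a fundamental matrix of the next system. *)
Lemma fundamental_tower M : exists (R : comNzRingType) (h : {rmorphism S -> R})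
    (t : {rmorphism R -> R}) (Us Vs : nat -> 'M[R]_n),
  [/\ forall x, t (h x) = h (s x), sigma_simple t, countably_spanned (h \o j),
      Us 0%N = map_mx h U /\ Vs 0%N = map_mx h V
    & forall i, (i <= M)%N ->
        map_mx t (Us i) = map_mx (h \o j) (A i) *m Us i /\ Us i *m Vs i = 1%:M].
Proof.
elim: M => [|M [R [h [t [Us [Vs [th simpleR countR [U0 V0] UVP]]]]]]].
  exists S, idfun, s, (fun=> U), (fun=> V); split=> //=.
    by split; apply/matrixP => a b; rewrite mxE.
  by move=> i; rewrite leqn0 => /eqP ->; split; rewrite ?sU.
have AA : map_mx (h \o j) (A M.+1) *m map_mx (h \o j) (A' M.+1) = 1%:M.
  by rewrite -map_mxM AA' map_mx1.
have [Q [g [t' [U' [V' [t'g simpleQ sU' UV' countQ]]]]]] :=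
  universal_extension (h \o j : {rmorphism K -> R}) t AA.
exists Q, (g \o h), t'.
exists (fun i => if i == M.+1 then U' else map_mx g (Us i)).
exists (fun i => if i == M.+1 then V' else map_mx g (Vs i)); split=> //.
- by move=> x /=; rewrite t'g th.
- exact: countQ.
- by rewrite /= U0 V0 -!map_mx_comp.
move=> i; rewrite leq_eqVlt => /predU1P[->|iM].
  rewrite eqxx; split=> //; rewrite sU'; congr (_ *m _).
  by apply/matrixP => a b; rewrite !mxE.
rewrite ltn_eqF //; have [sUi UVi] := UVP i iM; split.
  have -> : map_mx t' (map_mx g (Us i)) = map_mx g (map_mx t (Us i)).
    by apply/matrixP => a b; rewrite !mxE t'g.
  by rewrite sUi map_mxM; congr (_ *m _); apply/matrixP => a b; rewrite !mxE.
by rewrite -map_mxM UVi map_mx1.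
Qed.
End Tower.

Lemma derivation_bracket (E : comNzRingType) (d1 d2 : E -> E) : derivation d1 ->
  derivation d2 -> derivation (fun x => d1 (d2 x) - d2 (d1 x)).
Proof.
move=> [D1 M1] [D2 M2]; split=> x y; first by rewrite D2 D1 D1 D2; ring.
by rewrite M2 D1 !M1 D2 !M2; ring.
Qed.

Section LieAlgebra.
Variables (F : closedFieldType) (K : fieldType) (c : {rmorphism F -> K})
  (sK : {rmorphism K -> K}).
Hypotheses (char0 : forall n, n.+1%:R != 0 :> F)
  (sKc : forall a, sK (c a) = c a) (sK_fix : forall x, sK x = x -> exists a, x = c a).
Hypothesis F_uncountable : forall h : F -> nat, exists N, forall m,
  exists l : seq F, [/\ uniq l, size l = m & forall a, a \in l -> h a = N].
Variables (S : comNzRingType) (j : {rmorphism K -> S}) (s : {rmorphism S -> S}).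
Hypotheses (sj : forall k, s (j k) = j (sK k)) (simpleS : sigma_simple s)
  (countS : countably_spanned j).
Variables (n : nat) (A A' : nat -> 'M[K]_n) (U V : 'M[S]_n).
Hypotheses (AA' : forall i, A i *m A' i = 1%:M)
  (sU : map_mx s U = map_mx j (A 0%N) *m U) (UV : U *m V = 1%:M).
Hypothesis genS : forall B : set S, (forall k, B (j k)) ->
  (forall x y, B x -> B y -> B (x + y)) -> (forall x y, B x -> B y -> B (x * y)) ->
  (forall k l, B (U k l)) -> (forall k l, B (V k l)) -> forall x, B x.
Variables (L : fieldType) (iota : {rmorphism K -> L}) (sL : {rmorphism L -> L})
  (Y : nat -> 'cV[L]_n).
Hypotheses (sLi : forall k, sL (iota k) = iota (sK k))
  (sY : forall i, map_mx sL (Y i) = map_mx iota (A i) *m Y i).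
Variables (e1 e2 : 'M[F]_n).
Hypotheses (Te1 : tangent c j s U e1) (Te2 : tangent c j s U e2)
  (e12 : e1 *m e2 != e2 *m e1).

Lemma char0_rmorphism (E : fieldType) (f : {rmorphism F -> E}) m : m.+1%:R != 0 :> E.
Proof. by rewrite -(rmorph_nat f) fmorph_eq0. Qed.

(** A tangent e and a K-linear map lam : E -> K yield a derivation with first matrix lam(U e U^-1).
    Brackets of such derivations have trace 0, and one of them has a nonzero first matrix because e1
    and e2 do not commute. *)
Lemma lie_algebra_nonzero M : exists (m : nat -> 'M[K]_n) (delta : L -> L),
  [/\ derivation delta, forall k, delta (iota k) = 0,
      forall i, (i <= M)%N -> map_mx delta (Y i) = map_mx iota (m i) *m Y i,
      forall i, \tr (m i) = 0 & m 0%N != 0].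
Proof.
have [R [h [t [Us [Vs [th simpleR countR [U0 V0] UVP]]]]]] :=
  fundamental_tower simpleS countS AA' sU UV M.
have hinj : injective h.
  move=> x y exy; apply/eqP; rewrite -subr_eq0; apply: contraTT isT => xy0.
  have : [set z | h z = 0] 1.
    apply: simpleS; last by exists (x - y); rewrite //= rmorphB exy subrr.
      split; first exact: rmorph0.
      by move=> a u v /= hu hv; rewrite rmorphD rmorphM hu hv mulr0 addr0.
    by move=> u /= hu; rewrite -th hu rmorph0.
  by rewrite /= rmorph1 => /eqP; rewrite oner_eq0.
have [E [g gP]] := generic_field hinj (simple_reduced simpleS) (simple_reduced simpleR).
pose jR : {rmorphism K -> R} := h \o j.
have tj k : t (jR k) = jR (sK k) by rewrite /jR /= th sj.
have constR x : t x = x -> exists a, x = jR (c a).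
  exact: (simple_constants sKc sK_fix F_uncountable tj simpleR countR).
have char0E : forall m, m.+1%:R != 0 :> E.
  exact: (char0_rmorphism (g \o h \o j \o c : {rmorphism F -> E})).
have char0L : forall m, m.+1%:R != 0 :> L.
  exact: (char0_rmorphism (iota \o c : {rmorphism F -> L})).
pose m1 := M.+1.
have UVb : blk m1 Us *m blk m1 Vs = 1%:M.
  rewrite mul_blk -blk1; apply: eq_blk => a am.
  by have [] := UVP a am.
have sUb : map_mx t (blk m1 Us) = map_mx jR (blk m1 A) *m blk m1 Us.
  rewrite !map_blk ?rmorph0 // mul_blk; apply: eq_blk => a am.
  by have [-> _] := UVP a am.
have sYb : map_mx sL (blk_col m1 Y) = map_mx iota (blk m1 A) *m blk_col m1 Y.
  rewrite map_blk_col map_blk ?rmorph0 // mul_blk_col; apply: eq_blk_col => a am.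
  exact: sY.
pose P (e : 'M[F]_n) : 'M[E]_n := map_mx g (map_mx h U) *m map_mx (g \o jR \o c) e *m
  map_mx g (map_mx h V).
have realize e : tangent c j s U e -> forall lam : {additive E -> K},
    (forall k x, lam (g (jR k) * x) = k * lam x) ->
    exists (m : nat -> 'M[K]_n) (delta : L -> L), [/\ derivation delta,
      forall k, delta (iota k) = 0,
      forall i, (i <= M)%N -> map_mx delta (Y i) = map_mx iota (m i) *m Y i
    & m 0%N = map_mx lam (P e)].
  move=> Te lam lamZ.
  have [|d [dP dK dU]] := @tangent_derivation F K c char0 S j s n U V UV genS e E
    (g \o h : {rmorphism S -> E}) char0E _ Te.
    by move=> x /gP[u ux gu]; exists u.
  have dK' k : d (g (jR k)) = 0 by exact: dK.
  have [delta [deltaP deltaK deltaY]] := realized_derivation tj simpleR constR sLi char0L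
    sUb UVb sYb dP dK' lamZ.
  exists (fun a => map_mx lam (map_mx d (map_mx g (Us a)) *m map_mx g (Vs a))), delta.
  split=> //.
    move: deltaY; rewrite map_blk_col.
    rewrite (map_blk _ _ (rmorph0 g)) (map_blk _ _ (rmorph0 g)).
    rewrite (map_blk _ _ (derivation0 dP)) mul_blk (map_blk _ _ (raddf0 lam)).
    rewrite (map_blk _ _ (rmorph0 iota)) mul_blk_col => /blk_col_inj H i iM.
    exact: H.
  rewrite U0 V0 /P; congr (map_mx lam (_ *m _)).
  have -> : map_mx g (map_mx h U) = map_mx (g \o h) U by apply/matrixP => a b; rewrite !mxE.
  rewrite dU map_mxM; congr (_ *m _).
  by apply/matrixP => a b; rewrite !mxE.
have gUV : map_mx g (map_mx h V) *m map_mx g (map_mx h U) = 1%:M.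
  by rewrite -!map_mxM (mulmx1C UV) !map_mx1.
have PP e e' : P e *m P e' = P (e *m e').
  rewrite /P map_mxM; move: gUV; move: (map_mx g _) (map_mx g _) => X Y' gUV.
  by rewrite -!mulmxA (mulmxA Y' X) gUV mul1mx.
have ncomm : P e1 *m P e2 != P e2 *m P e1.
  apply: contraNneq e12 => eq12; rewrite !PP in eq12.
  have := congr1 (fun B => map_mx g (map_mx h V) *m B *m map_mx g (map_mx h U)) eq12.
  rewrite /P; move: gUV; move: (map_mx g _) (map_mx g _) => X Y' gUV.
  rewrite !mulmxA gUV !mul1mx -!(mulmxA _ Y' X) gUV !mulmx1.
  move=> eq'; apply/eqP/matrixP => a b.
  apply: (fmorph_inj (g \o jR \o c : {rmorphism F -> E})).
  by have := congr1 (fun B : 'M_n => B a b) eq'; rewrite [LHS]mxE [RHS]mxE.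
pose xs := [seq P e1 a b | a <- enum 'I_n, b <- enum 'I_n] ++ [seq P e2 a b | a <- enum 'I_n, b <- enum 'I_n].
have [r [b [lam [lamZ lamE]]]] := dual_decomposition (g \o jR : {rmorphism K -> E}) xs.
have xs1 x y : P e1 x y \in xs.
  by rewrite mem_cat; apply/orP; left; apply: allpairs_f; rewrite mem_enum.
have xs2 x y : P e2 x y \in xs.
  by rewrite mem_cat; apply/orP; right; apply: allpairs_f; rewrite mem_enum.
have dec e : (forall x y, P e x y \in xs) ->
    P e = \sum_i b i *: map_mx (g \o jR) (map_mx (lam i) (P e)).
  move=> xsP; apply/matrixP => x y; rewrite {1}(lamE _ (xsP x y)) summxE.
  by apply: eq_bigr => i _; rewrite !mxE mulrC.
(* [P e1] and [P e2] are E-combinations of their components over K; if all the components commuted,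
   so would they. *)
have [i1 [i2 ne]] : exists i1 i2, map_mx (lam i1) (P e1) *m map_mx (lam i2) (P e2) !=
    map_mx (lam i2) (P e2) *m map_mx (lam i1) (P e1).
  apply: contrapT => none; move/eqP: ncomm; apply.
  rewrite (dec _ xs1) (dec _ xs2).
  have expand (m1' m2' : 'I_r -> 'M[K]_n) :
      (\sum_i b i *: map_mx (g \o jR) (m1' i)) *m (\sum_i b i *: map_mx (g \o jR) (m2' i)) =
      \sum_i \sum_l (b i * b l) *: map_mx (g \o jR) (m1' i *m m2' l).
    rewrite mulmx_suml; apply: eq_bigr => i _; rewrite mulmx_sumr; apply: eq_bigr => l _.
    by rewrite -scalemxAl -scalemxAr scalerA map_mxM.
  rewrite !expand [RHS]exchange_big; apply: eq_bigr => i _; apply: eq_bigr => l _ /=.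
  rewrite mulrC; congr (_ *: map_mx _ _).
  by apply/eqP; apply: contrapT => /negP ne; apply: none; exists i, l.
have [m1' [d1 [d1P d1K d1Y m10]]] := realize _ Te1 _ (lamZ i1).
have [m2' [d2 [d2P d2K d2Y m20]]] := realize _ Te2 _ (lamZ i2).
have dkY (d : L -> L) (B : 'M[K]_n) (y : 'cV[L]_n) : derivation d ->
    (forall k, d (iota k) = 0) -> map_mx d (map_mx iota B *m y) = map_mx iota B *m map_mx d y.
  move=> dP dK; rewrite derivation_mulmx // (_ : map_mx d (map_mx iota B) = 0).
    by rewrite mul0mx add0r.
  by apply/matrixP => x y'; rewrite !mxE dK.
(* The order is reversed because d1 is K-linear: d1 (d2 Y) = m2' (d1 Y) = m2' m1' Y. *)
exists (fun i => m2' i *m m1' i - m1' i *m m2' i), (fun x => d1 (d2 x) - d2 (d1 x)).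
split.
- exact: derivation_bracket.
- by move=> k; rewrite d2K d1K (derivation0 d1P) (derivation0 d2P) subrr.
- move=> i iM.
  have -> : map_mx (fun x => d1 (d2 x) - d2 (d1 x)) (Y i) =
      map_mx d1 (map_mx d2 (Y i)) - map_mx d2 (map_mx d1 (Y i)).
    by apply/matrixP => x y; rewrite !mxE.
  rewrite d1Y // d2Y // !dkY // d1Y // d2Y // map_mxB !map_mxM mulmxBl.
  by rewrite -!mulmxA.
- by move=> i; rewrite raddfB /= mxtrace_mulC subrr.
by rewrite m10 m20 subr_eq0 eq_sym.
Qed.
End LieAlgebra.

(** * Puiseux series and characters *)

Section Characters.
Variable F : fieldType.

(** The model is r -> q^r on rational exponents; working with characters treats both parameters and
    their inverses alike. *)
Definition character (chi : rat -> F) : Prop :=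
  chi 0 = 1 /\ forall r s, chi (r + s) = chi r * chi s.

Definition faithful (chi : rat -> F) : Prop := forall r, chi r = 1 -> r = 0.

Lemma character_neq0 chi r : character chi -> chi r != 0.
Proof.
move=> [chi0 chiD]; apply: contraTneq isT => h.
by have := chiD r (- r); rewrite subrr chi0 h mul0r => /eqP; rewrite oner_eq0.
Qed.

Lemma characterN chi r : character chi -> chi (- r) = (chi r)^-1.
Proof.
move=> ch; have [chi0 chiD] := ch; apply: (mulfI (character_neq0 r ch)).
by rewrite -chiD subrr chi0 mulfV // character_neq0.
Qed.

Lemma characterX chi r n : character chi -> chi r ^+ n = chi (r * n%:R).
Proof.
move=> [chi0 chiD]; elim: n => [|n IH]; first by rewrite mulr0 chi0.
by rewrite exprS IH -chiD -natr1 mulrDr mulr1 addrC.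
Qed.

Lemma characterV chi : character chi -> character (fun r => (chi r)^-1).
Proof. by move=> [chi0 chiD]; split=> [|r s]; rewrite ?chi0 ?invr1 // chiD invfM. Qed.

Lemma faithfulV chi : faithful chi -> faithful (fun r => (chi r)^-1).
Proof. by move=> fc r h; apply: fc; rewrite -[LHS]invrK h invr1. Qed.

Lemma faithful_inj chi r s : character chi -> faithful chi -> chi r = chi s -> r = s.
Proof.
move=> ch fc rs; apply/eqP; rewrite -subr_eq0; apply/eqP/fc.
by rewrite (proj2 ch) characterN // rs mulfV // character_neq0.
Qed.
End Characters.

Section PuiseuxBasics.
Variable F : fieldType.
Local Notation L := (puiseux F).
Implicit Types (f g : L) (a b r s : rat).

Lemma puiseuxP f g : (forall r, f r = g r) -> f = g.
Proof. by move=> fg; apply/val_inj/funext. Qed.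

Lemma puiseux_coefD f g r : (f + g) r = f r + g r. Proof. by []. Qed.
Lemma puiseux_coefN f r : (- f) r = - f r. Proof. by []. Qed.
Lemma puiseux_coef0 r : (0 : L) r = 0. Proof. by []. Qed.

Lemma puiseux_coef_sum (I : Type) (l : seq I) (h : I -> L) r :
  (\sum_(i <- l) h i) r = \sum_(i <- l) h i r.
Proof. by apply: (big_morph (fun f : L => f r)). Qed.

Lemma puiseux_coefM f g r : (f * g) r = conv f g r. Proof. by []. Qed.

Definition val_ge f a : Prop := forall r, r < a -> f r = 0.

Lemma val_ge_le f a b : b <= a -> val_ge f a -> val_ge f b.
Proof. by move=> ba fa r rb; apply: fa; apply: lt_le_trans ba. Qed.

Lemma val_ge0 a : val_ge 0 a. Proof. by []. Qed.

Lemma val_geD f g a : val_ge f a -> val_ge g a -> val_ge (f + g) a.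
Proof. by move=> fa ga r ra; rewrite puiseux_coefD fa // ga // addr0. Qed.

Lemma val_ge_sum (I : Type) (l : seq I) (h : I -> L) a :
  (forall i, val_ge (h i) a) -> val_ge (\sum_(i <- l) h i) a.
Proof. move=> ha; apply: (big_ind (fun f : L => val_ge f a)) => [|f g|i _].
- exact: val_ge0.
- exact: val_geD.
exact: ha. Qed.

Lemma coefM_low f g a b r : val_ge f a -> val_ge g b -> r <= a + b ->
  (f * g) r = f a * g (r - a).
Proof.
move=> fa gb rab; rewrite puiseux_coefM (@convE _ [:: a]) ?big_seq1 // => x fx gx.
rewrite inE eq_le; apply/andP; split; last first.
  by rewrite leNgt; apply: contraNN fx => /fa ->.
rewrite leNgt; apply: contraNN gx => ax; rewrite gb //.
by rewrite ltrBlDr; apply: le_lt_trans rab _; rewrite addrC ltrD2l.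
Qed.

Lemma val_geM f g a b : val_ge f a -> val_ge g b -> val_ge (f * g) (a + b).
Proof.
move=> fa gb r rab; rewrite (coefM_low fa gb) ?ltW // gb ?mulr0 //.
by rewrite ltrBlDr addrC.
Qed.

Lemma exists_val_ge f : exists a, val_ge f a.
Proof.
have [j [N [j0 fP]]] := puiseuxW f; exists (- N%:R / j%:R) => r rN.
apply/eqP; apply: contraTT rN => /fP[m ->]; rewrite -leNgt ler_pM2r ?invr_gt0 ?ltr0n //.
by rewrite lerBrDr addNr.
Qed.

Lemma exists_val f : f != 0 -> exists a, f a != 0 /\ val_ge f a.
Proof.
move=> f0; have [j [N [j0 fP]]] := puiseuxW f.
have j0' : 0 < j%:R :> rat by rewrite ltr0n.
have [r fr] : exists r, f r != 0.
  apply: contrapT => /forallNP none; move/eqP: f0; apply; apply: puiseuxP => r.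
  by have /negP := none r; rewrite negbK => /eqP.
have exm : exists m : nat, f ((m%:R - N%:R) / j%:R) != 0.
  by have [m em] := fP _ fr; exists m; rewrite -em.
case: (ex_minnP exm) => m fm minm; exists ((m%:R - N%:R) / j%:R); split=> // r' rm.
apply/eqP; apply: contraTT rm => fr'; have [m' em] := fP _ fr'.
rewrite -leNgt em ler_pM2r ?invr_gt0 // lerD2r ler_nat.
by apply: minm; rewrite -em.
Qed.

Lemma pmonomM_coef c s f r : (pmonom c s * f) r = c * f (r - s).
Proof. by rewrite puiseux_coefM /= conv_monom //; exact: puiseuxW. Qed.

Lemma pmonom_coef (c : F) s r : pmonom c s r = if r == s then c else 0.
Proof. by []. Qed.

Lemma pmonomM (c c' : F) s s' : pmonom c s * pmonom c' s' = pmonom (c * c') (s + s').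
Proof.
apply: puiseuxP => r; rewrite pmonomM_coef !pmonom_coef subr_eq addrC.
by case: eqP; rewrite ?mulr0.
Qed.

Lemma pmonom_neq0 (c : F) s : c != 0 -> pmonom c s != 0.
Proof.
move=> c0; apply: contraNneq c0 => /(congr1 (fun f : L => f s)).
by rewrite pmonom_coef eqxx => ->.
Qed.

Lemma val_ge_pmonomM c s f a : val_ge f a -> val_ge (pmonom c s * f) (s + a).
Proof.
by move=> fa r rs; rewrite pmonomM_coef fa ?mulr0 // ltrBlDr addrC.
Qed.

Lemma twist_morphism (chi : rat -> F) : character chi ->
  exists s : {rmorphism L -> L}, forall f r, s f r = chi r * f r.
Proof.
move=> [chi0 chiD].
have twP f : is_puiseux (fun r => chi r * f r).
  have [j [N [j0 fP]]] := puiseuxW f; exists j, N; split=> // r.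
  by rewrite mulf_eq0 negb_or => /andP[_ /fP].
pose tw f := Puiseux (puiseuxI (twP f)).
have [||s sE] := @rmorphism_pack L L tw.
- by move=> f g; apply: puiseuxP => r; rewrite /= mulrBr.
- split=> [|f g].
    apply: puiseuxP => r; rewrite /= /monom; case: eqP => [->|_]; last by rewrite mulr0.
    by rewrite chi0 mulr1.
  apply: puiseuxP => r; rewrite puiseux_coefM /=.
  have [j [N [j0 fN gN]]] := common_grid (puiseuxW f) (puiseuxW g).
  have tN h : supported_on j N h -> supported_on j N (fun r => chi r * h r).
    by move=> hN x; rewrite mulf_eq0 negb_or => /andP[_ /hN].
  have [M rM] := exists_bound (r * j%:R + N%:R + N%:R).
  rewrite (conv_grid j0 fN gN rM) (conv_grid j0 (tN _ fN) (tN _ gN) rM) mulr_sumr.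
  by apply: eq_bigr => x _; rewrite mulrACA -chiD addrCA subrr addr0.
by exists s => f r; rewrite sE.
Qed.
End PuiseuxBasics.

Section Twist.
Variables (F : fieldType) (chi : rat -> F).
Hypothesis ch : character chi.
Local Notation L := (puiseux F).
Variable sg : {rmorphism L -> L}.
Hypothesis sgE : forall (f : L) r, sg f r = chi r * f r.

Lemma twist_val_ge f a : val_ge f a -> val_ge (sg f) a.
Proof. by move=> fa r ra; rewrite sgE fa ?mulr0. Qed.

Lemma twist_iter k f r : iter k sg f r = chi r ^+ k * f r.
Proof.
elim: k => [|k IH]; first by rewrite expr0 mul1r.
by rewrite iterS sgE IH exprS mulrA.
Qed.

Lemma twist_monom c s : sg (pmonom c s) = pmonom (chi s * c) s.
Proof.
by apply: puiseuxP => r; rewrite sgE !pmonom_coef; case: eqP => [->//|_]; rewrite mulr0.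
Qed.

Lemma twist_bijective : exists2 sg' : {rmorphism L -> L},
  cancel sg sg' /\ cancel sg' sg & forall f r, sg' f r = (chi r)^-1 * f r.
Proof.
have [sg' sgE'] := twist_morphism (characterV ch); exists sg' => //.
split=> f; apply: puiseuxP => r; rewrite ?(sgE, sgE') ?(sgE, sgE') mulrA.
  by rewrite mulVf ?mul1r ?character_neq0.
by rewrite mulfV ?mul1r ?character_neq0.
Qed.

(** As operators, (lam sg)^i is [twisted_power lam i] times sg^i; this is the factor that a gauge
    change by a solution of sg y = lam y puts on the coefficient of index i. *)
Definition twisted_power (lam : L) i : L := \prod_(k < i) iter k sg lam.

Lemma twisted_powerS lam i : twisted_power lam i.+1 = lam * sg (twisted_power lam i).
Proof.
rewrite /twisted_power big_ord_recl /= rmorph_prod; congr (_ * _).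
Qed.

(** [e i] is chi(s)^(i(i-1)/2). It does not depend on c, so that the characteristic equation below
    is polynomial in c. *)
Lemma twisted_power_monom s : exists e : nat -> F, (forall i, e i != 0) /\
  forall c i, twisted_power (pmonom c s) i = pmonom (c ^+ i * e i) (i%:R * s).
Proof.
exists (fix e i := if i is i'.+1 then chi (i'%:R * s) * e i' else 1); split.
  by elim=> [|i IH]; rewrite ?oner_neq0 // mulf_neq0 // character_neq0.
move=> c; elim=> [|i IH]; first by rewrite /twisted_power big_ord0 expr0 mulr1 mul0r.
rewrite twisted_powerS IH twist_monom pmonomM exprS -natr1 mulrDl mul1r addrC.
by congr pmonom; ring.
Qed.
End Twist.

(** * Right factors of order one *)

Lemma recursion_solve (F : fieldType) (a : nat -> nat -> F) :
  (forall m, (0 < m)%N -> a m m != 0) ->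
  exists h : nat -> F, h 0%N = 1 /\
    forall m, (0 < m)%N -> \sum_(k < m.+1) a m k * h k = 0.
Proof.
move=> a0.
pose bs := fix bs m := if m is m'.+1 then
  rcons (bs m') (- (\sum_(i < m) a m i * (bs m')`_i) / a m m) else [:: 1].
have sbs m : size (bs m) = m.+1 by elim: m => //= m IHm; rewrite size_rcons IHm.
have nbs m i : (i <= m)%N -> (bs m)`_i = (bs i)`_i.
  elim: m => [|m IHm]; first by rewrite leqn0 => /eqP ->.
  rewrite leq_eqVlt => /predU1P[-> //|im].
  by rewrite /= nth_rcons sbs im IHm.
exists (fun m => (bs m)`_m); split=> // -[//|m] _.
rewrite big_ord_recr /= nth_rcons sbs ltnn eqxx mulrC divfK ?a0 //.
apply/eqP; rewrite subr_eq0; apply/eqP; apply: eq_bigr => i _.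
by rewrite (nbs m) // -ltnS.
Qed.

Lemma seq_max (T : eqType) (l : seq T) (f : T -> rat) x0 : x0 \in l ->
  exists2 x, x \in l & forall y, y \in l -> f y <= f x.
Proof.
elim: l x0 => // y l IH x0 _; case: l IH => [|z l] IH.
  by exists y; rewrite ?mem_head // => x; rewrite inE => /eqP ->.
have [x xl xmax] := IH z (mem_head _ _).
have [yx|xy] := leP (f y) (f x).
  exists x; first by rewrite inE xl orbT.
  by move=> t; rewrite inE => /predU1P[->//|]; exact: xmax.
exists y; rewrite ?mem_head // => t; rewrite inE => /predU1P[->//|/xmax tx].
by apply: le_trans tx (ltW xy).
Qed.

Lemma injective_avoids (T : eqType) (u : nat -> T) (l : seq T) : injective u ->
  exists B, forall m, (B <= m)%N -> u m \notin l.
Proof.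
move=> uinj; elim: l => [|x l [B BP]]; first by exists 0%N.
have [[m0 um0]|none] := pselect (exists m, u m = x).
  exists (maxn B m0.+1) => m; rewrite geq_max => /andP[Bm m0m].
  rewrite inE negb_or BP // andbT -um0 (inj_eq uinj).
  by apply: contraTneq m0m => ->; rewrite ltnn.
exists B => m Bm; rewrite inE negb_or BP // andbT.
by apply/eqP => um; apply: none; exists m.
Qed.

Section Grid.
Variable F : fieldType.
Local Notation L := (puiseux F).

Lemma common_grid_family n (f : 'I_n -> L) : (forall i, val_ge (f i) 0) ->
  exists2 j, (0 < j)%N & forall i, supported_on j 0 (f i).
Proof.
move=> f0.
have [jj jP] := choice (fun i => puiseuxW (f i)).
have [NN {}jP] := choice jP.
exists (\prod_i jj i)%N; first by apply: prodn_gt0 => i; have [] := jP i.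
move=> i; have [j0 fN] := jP i.
rewrite (bigD1 i) //=; set k := (X in (_ * X)%N).
have k0 : (0 < k)%N by apply: prodn_gt0 => i'; have [] := jP i'.
have fM := @supported_on_le F (jj i) k (NN i) (NN i * k) (f i) j0 k0 (leqnn _) fN.
move=> r fr; have [m em] := fM _ fr.
have r0 : 0 <= r by rewrite leNgt; apply: contraNN fr => /f0 ->.
have J0 : 0 < (jj i * k)%N%:R :> rat by rewrite ltr0n muln_gt0 j0.
have mN : (NN i * k <= m)%N.
  by move: r0; rewrite em pmulr_lge0 ?invr_gt0 // subr_ge0 ler_nat.
by exists (m - NN i * k)%N; rewrite em subr0 natrB.
Qed.

Lemma series_puiseux j (h : nat -> F) : (0 < j)%N -> exists2 f : L,
  supported_on j 0 f & forall m : nat, f (m%:R / j%:R) = h m.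
Proof.
move=> j0; have j0' : (j%:R : rat) != 0 by rewrite pnatr_eq0 -lt0n.
pose g (r : rat) := if r * j%:R \is a Num.nat then h (Num.truncn (r * j%:R)) else 0.
have gP : supported_on j 0 g.
  move=> r; rewrite /g; case: ifPn => [/natrP[m em] _|_ /eqP //].
  by exists m; rewrite subr0 -em mulfK.
have gL : is_puiseux g by exists j, 0%N.
by exists (Puiseux (puiseuxI gL)) => // m; rewrite /= /g divfK // natr_nat natrK.
Qed.
End Grid.

Section Scalar.
Variables (F : closedFieldType) (chi : rat -> F).
Hypotheses (ch : character chi) (fc : faithful chi).
Local Notation L := (puiseux F).
Variable sg : {rmorphism L -> L}.
Hypothesis sgE : forall (f : L) r, sg f r = chi r * f r.

(** Frobenius' method: 1 is a root of the indicial polynomial, while no chi(m/j) with m > 0 is, so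
    the coefficients of a solution with constant term 1 are determined recursively. *)
Lemma power_solution d j (b : 'I_d.+1 -> L) : (0 < j)%N ->
  (forall i, supported_on j 0 (b i)) -> \sum_i b i 0 = 0 ->
  (forall m, (0 < m)%N -> \sum_i b i 0 * chi (m%:R / j%:R) ^+ i != 0) ->
  exists2 h : L, h != 0 & \sum_i b i * iter i sg h = 0.
Proof.
move=> j0 bj b0 bm; have j0' : (j%:R : rat) != 0 by rewrite pnatr_eq0 -lt0n.
pose a m k := \sum_i b i ((m - k)%N%:R / j%:R) * chi (k%:R / j%:R) ^+ i.
have [h [h0 hP]] : exists h : nat -> F, h 0%N = 1 /\
    forall m, (0 < m)%N -> \sum_(k < m.+1) a m k * h k = 0.
  by apply: recursion_solve => m m0; rewrite /a subnn mul0r; apply: bm.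
have [f fj fh] := series_puiseux h j0.
exists f.
  apply: contraTneq isT => f0; have := fh 0%N; rewrite f0 h0 mul0r => /esym/eqP.
  by rewrite oner_eq0.
have sfj i : supported_on j 0 (iter i sg f).
  by move=> r; rewrite (twist_iter sgE) mulf_eq0 negb_or => /andP[_ /fj].
apply: puiseuxP => r; rewrite puiseux_coef_sum puiseux_coef0.
have [[m]|nr] := pselect (on_grid j 0 r); last first.
  apply: big1 => i _; apply/eqP; apply: contra_notT nr => nz.
  by have := conv_supported j0 (bj i) (sfj i) nz.
rewrite subr0 => er.
have coefE i : (b i * iter i sg f) r =
    \sum_(k < m.+1) b i ((m - k)%N%:R / j%:R) * chi (k%:R / j%:R) ^+ i * h k.
  rewrite mulrC puiseux_coefM (@conv_grid _ j 0 0 m.+1) //; last first.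
    by rewrite !addr0 er divfK // ltr_nat.
  rewrite /grid big_map -[iota _ _]/(index_iota 0 m.+1) big_mkord.
  apply: eq_bigr => k _; rewrite subr0 (twist_iter sgE) fh er -mulrBl -natrB.
    by rewrite -[RHS]mulrA [RHS]mulrC.
  by rewrite -ltnS.
under eq_bigr do rewrite coefE.
rewrite exchange_big /=; case: (posnP m) => [m0|m0].
  rewrite m0 big_ord_recl big_ord0 addr0 /= -mulr_suml.
  rewrite mul0r; under eq_bigr do rewrite (proj1 ch) expr1n mulr1.
  by rewrite b0 mul0r.
rewrite -[RHS](hP m m0); apply: eq_bigr => k _.
by rewrite /a mulr_suml.
Qed.

(* Newton polygon: the slope s is chosen so that all terms of the twisted
   operator have valuation at least that of the term of index 0, with equality
   for another index; c is a root of the resulting characteristic polynomial such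
   that no c chi(m/j) with m > 0 is a root. *)
Lemma right_factor d (al : 'I_d.+1 -> L) : (0 < d)%N -> al ord0 != 0 ->
  al ord_max != 0 -> exists (c : F) (s : rat) (h : L), [/\ c != 0, h != 0
    & \sum_i al i * twisted_power sg (pmonom c s) i * iter i sg h = 0].
Proof.
move=> d0 al0 ald.
have exv i : exists v, al i != 0 -> al i v != 0 /\ val_ge (al i) v.
  have [->|/exists_val[v vP]] := eqVneq (al i) 0; first by exists 0; rewrite eqxx.
  by exists v.
have [v vP] := choice exv.
pose l := [seq i : 'I_d.+1 <- enum 'I_d.+1 | (0 < i)%N && (al i != 0)].
have lmax : ord_max \in l by rewrite mem_filter d0 ald mem_enum.
have [k kl kmax] := seq_max (fun i : 'I_d.+1 => (v ord0 - v i) / i%:R) lmax.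
set s := (v ord0 - v k) / k%:R in kmax.
move: kl; rewrite mem_filter => /andP[/andP[k0 alk] _].
have [e [e0 eP]] := twisted_power_monom ch sgE s.
(* The twisted coefficients without the powers of c, divided by z^(v ord0). By the choice of s they
   have no negative exponents, and the constant terms of index 0 and k are nonzero. *)
pose g (i : 'I_d.+1) := pmonom (e i) (i%:R * s - v ord0) * al i.
have g_ge i : val_ge (g i) 0.
  have [ali|ali] := eqVneq (al i) 0.
    by rewrite /g ali mulr0; exact: val_ge0.
  have [_ vi] := vP _ ali.
  have h := @val_ge_pmonomM F (e i) (i%:R * s - v ord0) (al i) (v i) vi.
  apply: (@val_ge_le F (g i) _ 0 _ h).
  rewrite addrAC subr_ge0 -lerBlDr.
  have [i0|i0] := posnP i.
    have -> : i = ord0 by apply: val_inj.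
    by rewrite mul0r subrr.
  have := kmax i; rewrite mem_filter i0 ali mem_enum => /(_ isT).
  by rewrite ler_pdivrMr ?ltr0n // mulrC.
have [j j0 gj] := common_grid_family g_ge.
have gcoef (i : 'I_d.+1) : v ord0 - i%:R * s = v i -> g i 0 = e i * al i (v i).
  by move=> ei; rewrite /g pmonomM_coef sub0r opprB ei.
have g00 : g ord0 0 != 0.
  by rewrite gcoef ?mul0r ?subr0 // mulf_neq0 ?e0 //; case: (vP _ al0).
have gk0 : g k 0 != 0.
  rewrite gcoef; first by rewrite mulf_neq0 ?e0 //; case: (vP _ alk).
  by rewrite mulrC divfK ?subKr // pnatr_eq0 -lt0n.
(* The terms of index 0 and k > 0 provide a nonzero root. *)
pose P0 := \poly_(i < d.+1) g (inord i) 0.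
have P0E x : P0.[x] = \sum_i g i 0 * x ^+ i.
  rewrite horner_poly; apply: eq_bigr => i _; by rewrite inord_val.
have P0k : P0`_k = g k 0 by rewrite coef_poly ltn_ord inord_val.
have P0n0 : P0 != 0 by apply: contraNneq gk0 => P00; rewrite -P0k P00 coef0.
have [|c0 rc0] := @closed_rootP F P0 _.
  apply: contraNneq gk0 => s1; rewrite -P0k nth_default //.
  by rewrite s1.
have c0n0 : c0 != 0.
  apply: contraTneq rc0 => ->; rewrite rootE P0E big_ord_recl big1 ?addr0 => [|i _].
    by rewrite mulr1.
  by rewrite expr0n mulr0.
have j0' : (j%:R : rat) != 0 by rewrite pnatr_eq0 -lt0n.
pose u m := c0 * chi (m%:R / j%:R).
have uinj : injective u.
  move=> m m' /(mulfI c0n0)/(faithful_inj ch fc)/(mulIf (invr_neq0 j0'))/eqP.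
  by rewrite eqr_nat => /eqP.
have [rs rsE] := closed_field_poly_normal P0.
have [B BP] := injective_avoids rs uinj.
have rootB m : root P0 (u m) -> (m <= B)%N.
  move=> rm; rewrite leqNgt; apply: contraL rm => /ltnW /BP; apply: contraNN.
  rewrite rsE rootZ ?lead_coef_eq0 //; by rewrite root_prod_XsubC.
have exroot : exists m, root P0 (u m).
  by exists 0%N; rewrite /u mul0r (proj1 ch) mulr1.
case: (ex_maxnP exroot rootB) => m rm maxm.
pose c := u m.
have cn0 : c != 0 by rewrite mulf_neq0 // character_neq0.
have bcoef (i : 'I_d.+1) : (pmonom (c ^+ i) 0 * g i) 0 = c ^+ i * g i 0.
  by rewrite pmonomM_coef subrr.
have [|||h h0 hP] := @power_solution d j (fun i : 'I_d.+1 => pmonom (c ^+ i) 0 * g i) j0.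
- by move=> i r; rewrite pmonomM_coef subr0 mulf_eq0 negb_or => /andP[_ /gj].
- under eq_bigr do rewrite bcoef mulrC.
  by rewrite -P0E; apply/eqP; exact: rm.
- move=> m' m'0; under eq_bigr do rewrite bcoef mulrAC mulrC -exprMn.
  rewrite -P0E; apply: contraTneq m'0 => r0.
  have /maxm : root P0 (u (m + m')).
    rewrite rootE /u natrD mulrDl (proj2 ch) mulrA; apply/eqP; exact: r0.
  by rewrite -[X in (_ <= X)%N]addn0 leq_add2l leqn0 => /eqP ->.
exists c, s, h; split=> //.
have := congr1 (fun x => pmonom 1 (v ord0) * x) hP; rewrite mulr0 mulr_sumr => H.
apply: etrans H; apply: eq_bigr => i _.
rewrite mulrA; congr (_ * _); rewrite eP /g !mulrA !pmonomM [RHS]mulrC.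
by rewrite mul1r addr0 (addrC (v ord0) (_ - _)) subrK.
Qed.
End Scalar.

(** * Bounded orbits *)

Section MinimalDependence.
Variables (L : fieldType) (r : nat) (B : set 'rV[L]_r).
Hypotheses (B0 : B 0) (BL : forall a x y, B x -> B y -> B (a *: x + y)).

(** A shortest relation modulo [B], normalized at its last term. As [u 0] is not in [B], it has at
    least two terms, whence the bounds [m.+2] and [m.+1]. *)
Lemma minimal_dependence (u : nat -> 'rV[L]_r) : ~ B (u 0%N) ->
  exists m (a : nat -> L), [/\ a m.+1 = 1, B (\sum_(k < m.+2) a k *: u k)
    & forall b : nat -> L, B (\sum_(k < m.+1) b k *: u k) ->
      forall k, (k < m.+1)%N -> b k = 0].
Proof.
move=> Bu0.
pose P d := `[< exists a : nat -> L, (exists2 k, (k < d.+1)%N & a k != 0) /\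
  B (\sum_(k < d.+1) a k *: u k) >].
have exP : exists d, P d.
  exists r; apply/asboolP.
  pose M : 'M[L]_(r.+1, r) := \matrix_(k < r.+1) u k.
  have : kermx M != 0.
    by rewrite -mxrank_eq0 mxrank_ker subn_eq0 -ltnNge; apply: leq_ltn_trans (rank_leq_col _) _.
  case/rowV0Pn => x /sub_kermxP xM x0.
  exists (fun k => x 0 (inord k)); split.
    apply: contrapT => none; move/eqP: x0; apply; apply/rowP => k; rewrite mxE.
    apply/eqP; apply: contrapT => /negP xk; apply: none; exists k => //.
    by rewrite inord_val.
  have -> : \sum_(k < r.+1) x 0 (inord k) *: u k = x *m M.
    by rewrite mulmx_sum_row; apply: eq_bigr => k _; rewrite inord_val rowK.
  by rewrite xM.
case: (ex_minnP exP) => d /asboolP[a [[k kd ak] Ba]] mind.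
have indep m (b : nat -> L) : (m < d)%N -> B (\sum_(k < m.+1) b k *: u k) ->
    forall k, (k < m.+1)%N -> b k = 0.
  move=> md Bb k' km; apply/eqP; apply: contraTT md => bk; rewrite -leqNgt.
  by apply: mind; apply/asboolP; exists b; split=> //; exists k'.
case: d kd mind indep Ba {exP} => [|m] kd mind indep Ba.
  exfalso; apply: Bu0; rewrite big_ord_recl big_ord0 addr0 /= in Ba.
  move: ak; move: kd; rewrite ltnS leqn0 => /eqP -> a0.
  by have := BL (a 0%N)^-1 Ba B0; rewrite addr0 scalerA mulVf // scale1r.
have am : a m.+1 != 0.
  apply: contraTneq isT => am0; rewrite big_ord_recr /= am0 scale0r addr0 in Ba.
  have := indep m a (ltnSn _) Ba k; move: kd; rewrite ltnS leq_eqVlt => /predU1P[ek|->].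
    by rewrite ek am0 eqxx in ak.
  by move=> /(_ isT) ak0; rewrite ak0 eqxx in ak.
exists m, (fun k => (a m.+1)^-1 * a k); split; first by rewrite mulVf.
  under eq_bigr do rewrite -scalerA; rewrite -scaler_sumr -[_ *: _]addr0.
  exact: BL.
by move=> b Bb; apply: indep.
Qed.
End MinimalDependence.

Section Orbits.
Variables (F : closedFieldType) (chi : rat -> F).
Hypotheses (ch : character chi) (fc : faithful chi).
Local Notation L := (puiseux F).
Variables (sg : {rmorphism L -> L}) (r : nat) (P : 'M[L]_r).
Hypothesis sgE : forall (f : L) x, sg f x = chi x * f x.

Definition semilinear (v : 'rV[L]_r) : 'rV[L]_r := map_mx sg v *m P.
Local Notation sop := semilinear.

Lemma semilinear_lin a v w : sop (a *: v + w) = sg a *: sop v + sop w.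
Proof. by rewrite /sop map_mxD map_mxZ mulmxDl scalemxAl. Qed.

Lemma semilinear0 : sop 0 = 0.
Proof. by rewrite /sop map_mx0 mul0mx. Qed.

Lemma semilinearZ a v : sop (a *: v) = sg a *: sop v.
Proof. by rewrite -[a *: v]addr0 semilinear_lin semilinear0 addr0. Qed.

Lemma semilinearD v w : sop (v + w) = sop v + sop w.
Proof. by rewrite -[v in LHS]scale1r semilinear_lin rmorph1 scale1r. Qed.

Lemma semilinear_sum (I : Type) (l : seq I) (f : I -> 'rV[L]_r) :
  sop (\sum_(i <- l) f i) = \sum_(i <- l) sop (f i).
Proof. exact: (big_morph sop semilinearD semilinear0). Qed.

Lemma iter_semilinear_lin k a v w :
  iter k sop (a *: v + w) = iter k sg a *: iter k sop v + iter k sop w.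
Proof. by elim: k => //= k ->; rewrite semilinear_lin. Qed.

Variable B : set 'rV[L]_r.
Hypotheses (B0 : B 0) (BL : forall a x y, B x -> B y -> B (a *: x + y)).
Hypothesis BsV : forall v, B (sop v) -> B v.

(** A minimal relation makes w a zero, modulo [B], of an operator of order m + 1 in sop. Dividing it
    on the left by sop - lam, up to a factor f, gives an operator of order m that sends w to the
    eigenvector. Left division amounts to a right factor of order one of the adjoint operator, with
    coefficients sg'^i(a_i) and the inverse twist sg'. *)
Lemma eigenvector_mod w : ~ B w -> exists v c s, [/\ ~ B v, c != 0
  & B (sop v - pmonom c s *: v)].
Proof.
move=> Bw.
have [sg' [sgK sgK'] sgE'] := twist_bijective ch sgE.
have ch' := characterV ch; have fc' := faithfulV fc.
have [m [a [am Ba indep]]] := minimal_dependence B0 BL (u := fun k => iter k sop w) Bw.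
(* If the first coefficient were 0, one sop could be cancelled by [BsV], which contradicts
   minimality. *)
have a0 : a 0%N != 0.
  apply: contraTneq isT => a00; rewrite big_ord_recl a00 scale0r add0r in Ba.
  have /BsV h : B (sop (\sum_(k < m.+1) sg' (a k.+1) *: iter k sop w)).
    rewrite semilinear_sum; under eq_bigr do rewrite semilinearZ sgK'.
    exact: Ba.
  have := indep (fun k => sg' (a k.+1)) h m (ltnSn _).
  by rewrite am rmorph1 => /eqP; rewrite oner_eq0.
have iter_inj k x : iter k sg' x = 0 -> x = 0.
  elim: k => //= k IH h; apply: IH; rewrite -[LHS]sgK' h rmorph0 //.
have [||c [s [f [c0 f0 fP]]]] := @right_factor F _ ch' fc' sg' sgE' m.+1
  (fun i => iter i sg' (a i)) isT.
- by rewrite /=.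
- by rewrite /= am; apply/eqP => h; have /eqP := @iter_inj m.+1 1 h; rewrite oner_eq0.
set lam := pmonom c s in fP.
pose tw := twisted_power sg' lam.
(* The coefficients of the division by Horner's scheme, H k = f a_k + lam sg'(H (k+1)); the
   remainder [H 0] vanishes by the choice of f. *)
pose H k := \sum_(i < m.+2 - k) tw i * iter i sg' (f * a (k + i)%N).
have iterM k x y : iter k sg' (x * y) = iter k sg' x * iter k sg' y.
  by elim: k => //= k ->; rewrite rmorphM.
have H0 : H 0%N = 0.
  rewrite /H subn0 -[RHS]fP; apply: eq_bigr => i _; rewrite add0n iterM /=.
  by rewrite [RHS]mulrAC [RHS]mulrC; congr (_ * _); exact: mulrC.
have HS k : (k < m.+1)%N -> H k = f * a k + lam * sg' (H k.+1).
  move=> km; rewrite /H (subSn (ltnW km)) big_ord_recl /tw /twisted_power big_ord0 mul1r.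
  rewrite addn0; congr (_ + _); rewrite rmorph_sum mulr_sumr subSS.
  apply: eq_bigr => i _; rewrite /= -/(twisted_power sg' lam _) twisted_powerS.
  by rewrite rmorphM mulrA addSnnS.
have Hm : H m.+1 = f.
  rewrite /H subSn // subnn big_ord_recl big_ord0 addr0 /tw /twisted_power big_ord0 mul1r.
  by rewrite /= addn0 am mulr1.
exists (\sum_(k < m.+1) sg' (H k.+1) *: iter k sop w), c, s; split=> //.
  move=> /(indep (fun k => sg' (H k.+1)))/(_ m (ltnSn _)); rewrite Hm => sf0.
  by move/eqP: f0; apply; rewrite -[f]sgK' sf0 rmorph0.
rewrite semilinear_sum; under eq_bigr do rewrite semilinearZ sgK' -iterS.
have -> : \sum_(k < m.+1) H k.+1 *: iter k.+1 sop w = \sum_(k < m.+2) H k *: iter k sop w.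
  by rewrite [RHS]big_ord_recl H0 scale0r add0r.
rewrite big_ord_recr /= Hm scaler_sumr addrAC -sumrB.
have -> : \sum_(k < m.+1) (H k *: iter k sop w - lam *: (sg' (H k.+1) *: iter k sop w)) =
    \sum_(k < m.+1) f *: (a k *: iter k sop w).
  apply: eq_bigr => k _; rewrite !scalerA -scalerBl HS ?ltn_ord //.
  by rewrite addrK.
rewrite -scaler_sumr -scalerDr.
by have := BL f Ba B0; rewrite big_ord_recr /= am scale1r addr0.
Qed.

Definition row_val (v : 'rV[L]_r) a : Prop := forall i, val_ge (v 0 i) a.

Lemma row_val_le v a b : b <= a -> row_val v a -> row_val v b.
Proof. by move=> ba va i; apply: val_ge_le ba (va i). Qed.

Lemma row_valD v w a : row_val v a -> row_val w a -> row_val (v + w) a.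
Proof. by move=> va wa i; rewrite mxE; apply: val_geD. Qed.

Lemma finite_min (I : finType) (f : I -> rat) : exists m, forall i, m <= f i.
Proof.
have [i0|none] := pselect (exists i : I, True); last first.
  by exists 0 => i; case: none; exists i.
have [i _] := i0; have [i' _ imax] := seq_max (fun i => - f i) (mem_enum I i).
by exists (f i') => k; rewrite -lerN2 imax // mem_enum.
Qed.

Lemma exists_row_val v : exists a, row_val v a.
Proof.
have [a aP] := choice (fun i => exists_val_ge (v 0 i)).
have [m mP] := finite_min a; exists m => i; exact: val_ge_le (mP i) (aP i).
Qed.

Lemma row_val_mulmx (M : 'M[L]_r) : exists m, forall v a, row_val v a ->
  row_val (v *m M) (m + a).
Proof.
have [b bP] := choice (fun ij : 'I_r * 'I_r => exists_val_ge (M ij.1 ij.2)).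
have [m mP] := finite_min b; exists m => v a va i; rewrite mxE.
apply: val_ge_sum => k; rewrite addrC; apply: val_geM; first exact: va.
by apply: val_ge_le (mP (k, i)) _; exact: (bP (k, i)).
Qed.

End Orbits.

Section BoundedOrbits.
Variables (F : closedFieldType) (chi psi : rat -> F).
Hypotheses (ch : character chi) (cp : character psi).
Hypothesis indep : forall x y, chi x * psi y = 1 -> x = 0 /\ y = 0.
Local Notation L := (puiseux F).
Variables (sg tg : {rmorphism L -> L}).
Hypotheses (sgE : forall (f : L) x, sg f x = chi x * f x)
  (tgE : forall (f : L) x, tg f x = psi x * f x).
Variables (r : nat) (P Q Q' : 'M[L]_r).
Hypotheses (QQ' : Q *m Q' = 1%:M)
  (comm : map_mx sg Q *m P = map_mx tg P *m Q).
Local Notation sop := (semilinear sg P).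
Local Notation top := (semilinear tg Q).

Definition bounded_orbit (v : 'rV[L]_r) : Prop :=
  exists a, forall k, row_val (iter k sop v) a.

Let fc : faithful chi.
Proof. by move=> x cx; have [] := indep (x := x) (y := 0); rewrite ?(proj1 cp) ?mulr1. Qed.

Lemma semilinear_commute v : sop (top v) = top (sop v).
Proof.
rewrite /semilinear !map_mxM -!mulmxA comm; congr (_ *m _).
by apply/matrixP => i k; apply: puiseuxP => x; rewrite !mxE !(sgE, tgE) mulrCA.
Qed.

Lemma iter_semilinear_commute k v : iter k sop (top v) = top (iter k sop v).
Proof. by elim: k => //= k ->; rewrite semilinear_commute. Qed.

Lemma bounded_orbit_lin a v w : bounded_orbit v -> bounded_orbit w ->
  bounded_orbit (a *: v + w).
Proof.
move=> [b vb] [b' wb]; have [x ax] := exists_val_ge a.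
exists (Num.min (x + b) b') => k; rewrite iter_semilinear_lin; apply: row_valD.
  apply: (row_val_le (a := x + b)); first by rewrite ge_min lexx.
  move=> i; rewrite mxE; apply: val_geM; last exact: vb.
  by elim: k => //= k IH; apply: twist_val_ge sgE _ _ _.
by apply: (row_val_le (a := b')) => //; rewrite ge_min lexx orbT.
Qed.

Lemma bounded_orbit0 : bounded_orbit 0.
Proof.
exists 0 => k; have -> : iter k sop 0 = 0 by elim: k => //= k ->; rewrite semilinear0.
by move=> i; rewrite mxE; exact: val_ge0.
Qed.

Lemma bounded_orbit_sopV v : bounded_orbit (sop v) -> bounded_orbit v.
Proof.
move=> [a va]; have [b vb] := exists_row_val v; exists (Num.min a b) => -[|k].
  by apply: row_val_le vb; rewrite ge_min lexx orbT.
by rewrite iterSr; apply: row_val_le (va k); rewrite ge_min lexx.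
Qed.

Lemma bounded_orbit_top v : bounded_orbit v -> bounded_orbit (top v).
Proof.
move=> [a va]; have [m mP] := row_val_mulmx Q; exists (m + a) => k.
rewrite iter_semilinear_commute; apply: mP => i; rewrite mxE.
exact: (twist_val_ge tgE (va k i)).
Qed.

Lemma bounded_orbit_topV v : bounded_orbit (top v) -> bounded_orbit v.
Proof.
have [tg' [tgK tgK'] tgE'] := twist_bijective cp tgE.
move=> [a va]; have [m mP] := row_val_mulmx Q'; exists (m + a) => k i.
have -> : iter k sop v = map_mx tg' (top (iter k sop v) *m Q').
  rewrite /semilinear -mulmxA QQ' mulmx1.
  by apply/matrixP => x y; rewrite !mxE tgK.
rewrite mxE; apply: (twist_val_ge tgE').
by apply: mP; rewrite -iter_semilinear_commute.
Qed.

(* The vectors with a bounded orbit form a subspace stable under both operators.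
   An eigenvector modulo this subspace has slope 0 because the other operator
   maps it to eigenvectors with the other eigenvalues c psi(s)^k z^s; hence it has a
   bounded orbit itself. *)
Lemma bounded_orbits v : bounded_orbit v.
Proof.
apply: contrapT => Bv.
have [u [c [s [Bu c0 Bsu]]]] := eigenvector_mod ch fc sgE bounded_orbit0
  bounded_orbit_lin bounded_orbit_sopV Bv.
have B_itop k w : bounded_orbit w -> bounded_orbit (iter k top w).
  by move=> Bw; elim: k => //= k; exact: bounded_orbit_top.
have BB v1 v2 : bounded_orbit v1 -> bounded_orbit v2 -> bounded_orbit (v1 - v2).
  by move=> b1 b2; rewrite addrC -scaleN1r; apply: bounded_orbit_lin.
have B_sum n (f : 'I_n -> 'rV[L]_r) : (forall k, bounded_orbit (f k)) ->
    bounded_orbit (\sum_k f k).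
  move=> bf; apply: (big_ind bounded_orbit) => // [|x y bx by_].
    exact: bounded_orbit0.
  by rewrite -[x]scale1r; apply: bounded_orbit_lin.
have BZ a v1 : bounded_orbit v1 -> bounded_orbit (a *: v1).
  by move=> b1; rewrite -[a *: v1]addr0; apply: bounded_orbit_lin => //; exact: bounded_orbit0.
have [m [a [am Ba ind]]] := minimal_dependence bounded_orbit0 bounded_orbit_lin
  (u := fun k => iter k top u) Bu.
pose lam k := pmonom (c * psi s ^+ k) s.
have eig k : bounded_orbit (sop (iter k top u) - lam k *: iter k top u).
  have itop_lam x : iter k top (pmonom c s *: x) = lam k *: iter k top x.
    elim: k x => [|k IH] x; first by rewrite /lam expr0 mulr1.
    rewrite iterS IH semilinearZ -iterS; congr (_ *: _).
    by rewrite /lam (twist_monom tgE) exprS mulrCA.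
  have itop_sop x : iter k top (sop x) = sop (iter k top x).
    by elim: k {itop_lam} => //= k ->; rewrite semilinear_commute.
  have := B_itop k _ Bsu; rewrite addrC -scaleN1r iter_semilinear_lin itop_lam itop_sop.
  have -> : iter k tg (-1) = -1 by elim: k {itop_lam itop_sop} => //= k ->; rewrite rmorphN1.
  by rewrite scaleN1r addrC.
(* sop minus the last eigenvalue shortens the minimal relation between the vectors top^k u, so all
   the coefficients [b k] vanish. Comparing lowest terms in sg(a_k) lam_k = lam_(m+1) a_k gives
   chi(x) psi(s)^k = psi(s)^(m+1), with x the valuation of a nonzero a_k; independence then forces s
   = 0. *)
have s0 : s = 0.
  pose b k := sg (a k) * lam k - lam m.+1 * a k.
  have /(ind b) bE : bounded_orbit (\sum_(k < m.+1) b k *: iter k top u).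
    have b1 : bounded_orbit (sop (\sum_(k < m.+2) a k *: iter k top u)).
      by case: Ba => x xP; exists x => k; have := xP k.+1; rewrite iterSr.
    have b2 : bounded_orbit (\sum_(k < m.+2) sg (a k) *: (sop (iter k top u) - lam k *: iter k top u)).
      by apply: B_sum => k; apply: BZ; exact: eig.
    have := BB _ _ (BB _ _ b1 b2) (BZ (lam m.+1) _ Ba).
    rewrite semilinear_sum -sumrB; under [X in X - _]eq_bigr do
      rewrite semilinearZ -scalerBr opprB addrC subrK scalerA.
    rewrite scaler_sumr -sumrB; under eq_bigr do rewrite scalerA -scalerBl.
    by rewrite big_ord_recr /= am rmorph1 mul1r mulr1 subrr scale0r addr0.
  have [k km ak] : exists2 k, (k < m.+1)%N & a k != 0.
    apply: contrapT => none; apply: Bu.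
    have : bounded_orbit (iter m.+1 top u).
      move: Ba; rewrite big_ord_recr /= am scale1r big1 ?add0r // => k _.
      apply/eqP; rewrite scaler_eq0; apply/orP; left.
      by apply: contrapT => /negP ak; apply: none; exists k.
    by elim: m.+1 => //= k IH /bounded_orbit_topV.
  have [x [ax _]] := exists_val ak.
  have := congr1 (fun f : L => f (s + x)) (bE k km); rewrite /b.
  rewrite mulrC puiseux_coefD puiseux_coefN !pmonomM_coef [s + x]addrC addrK sgE.
  rewrite puiseux_coef0 => /eqP; rewrite subr_eq0 -!mulrA => /eqP/(mulfI c0).
  rewrite mulrA => /(mulIf ax).
  have -> : psi s ^+ m.+1 = psi s ^+ k * psi s ^+ (m.+1 - k) by rewrite -exprD subnKC // ltnW.
  move=> /(mulfI (expf_neq0 _ (character_neq0 s cp))) cE.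
  have [|_] := indep (x := - x) (y := s * (m.+1 - k)%:R).
  - by rewrite -characterX // -cE characterN // mulVf // character_neq0.
  move=> /eqP; rewrite mulf_eq0 pnatr_eq0 subn_eq0 leqNgt km orbF.
  by move=> /eqP.
(* For s = 0 the eigenvalue is the constant c, which does not lower valuations: the iterates of u
   are bounded by induction. *)
apply: Bu; rewrite s0 in Bsu.
have [x ux] := exists_row_val u; have [y yP] := Bsu.
exists (Num.min x y); elim=> [|k IH].
  by apply: row_val_le ux; rewrite ge_min lexx.
rewrite iterSr -[sop u](subrK (pmonom c 0 *: u)) addrC iter_semilinear_lin.
apply: row_valD; last by apply: row_val_le (yP k); rewrite ge_min lexx orbT.
move=> i; rewrite mxE -[Num.min x y]add0r; apply: val_geM; last exact: IH.
elim: k {IH} => [|k IH] /=; last exact: (twist_val_ge sgE).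
by move=> z z0; rewrite pmonom_coef lt_eqF.
Qed.
End BoundedOrbits.

(** * Embeddings of the rational functions *)

Section RationalFunctions.
Variable F : fieldType.
Local Notation K := {fraction {poly F}}.
Local Notation tofrac := (@FracField.tofrac {poly F}).

Lemma frac_numden (x : K) : x * tofrac \d_(generic_quotient.repr x) =
  tofrac \n_(generic_quotient.repr x).
Proof.
rewrite -{1}(generic_quotient.reprK x); move: (generic_quotient.repr x) => {x} [[n d] /= d0].
unlock FracField.tofrac; rewrite -[LHS]FracField.pi_mul.
apply/generic_quotient.eqmodP; rewrite /= FracField.equivfE /FracField.mulf.
by rewrite !numden_Ratio ?oner_eq0 ?mulf_neq0 ?oner_eq0 //= !mulr1 mulrC.
Qed.

Lemma denom_neq0 (x : K) : \d_(generic_quotient.repr x) != 0.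
Proof. exact: denom_ratioP. Qed.

Lemma frac_hom_ext (T : fieldType) (f g : {rmorphism K -> T}) :
  (forall p, f (tofrac p) = g (tofrac p)) -> f =1 g.
Proof.
move=> fg x; have d0 : f (tofrac \d_(generic_quotient.repr x)) != 0.
  by rewrite fmorph_eq0 tofrac_eq0 denom_neq0.
apply: (mulIf d0); rewrite -rmorphM frac_numden [in RHS]fg -rmorphM frac_numden.
exact: fg.
Qed.

Section Evaluation.
Variables (L : fieldType) (c : {rmorphism F -> L}) (w : L).
Hypothesis w_transc : forall p, p != 0 -> (map_poly c p).[w] != 0.

Let ev p := (map_poly c p).[w].

Let evM p p' : ev (p * p') = ev p * ev p'.
Proof. by rewrite /ev rmorphM hornerM. Qed.

Let evB p p' : ev (p - p') = ev p - ev p'.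
Proof. by rewrite /ev rmorphB hornerD hornerN. Qed.

Lemma ratfun_evalE x n d : d != 0 -> x * tofrac d = tofrac n ->
  ratfun_eval c w x = ev n / ev d.
Proof.
move=> d0 xd; rewrite /ratfun_eval.
have dn0 := w_transc d0; have dn1 := w_transc (denom_neq0 x).
apply/eqP; rewrite eqr_div // -!evM; apply/eqP; congr ev; apply/eqP.
rewrite -(@tofrac_eq {poly F}) !rmorphM /= -xd -frac_numden; apply/eqP.
by rewrite mulrAC.
Qed.

Lemma ratfun_morphism : exists f : {rmorphism K -> L},
  (forall x, f x = ratfun_eval c w x) /\ forall p, f (tofrac p) = (map_poly c p).[w].
Proof.
have ev1 : ev 1 = 1 by rewrite /ev rmorph1 hornerC.
have evalP p : ratfun_eval c w (tofrac p) = ev p.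
  by rewrite (ratfun_evalE (oner_neq0 _) (_ : _ = tofrac p)) ?ev1 ?divr1 // rmorph1 mulr1.
have [||f fE] := @rmorphism_pack K L (ratfun_eval c w).
- move=> x y; set dx := \d_(generic_quotient.repr x); set dy := \d_(generic_quotient.repr y).
  have dx0 : dx != 0 := denom_neq0 x; have dy0 : dy != 0 := denom_neq0 y.
  rewrite (ratfun_evalE (mulf_neq0 dx0 dy0)
    (_ : _ = tofrac (\n_(generic_quotient.repr x) * dy - \n_(generic_quotient.repr y) * dx))).
    rewrite (ratfun_evalE dx0 (frac_numden x)) (ratfun_evalE dy0 (frac_numden y)).
    by rewrite evB !evM -[X in _ = _ + X]mulNr addf_div ?w_transc // mulNr.
  rewrite rmorphM rmorphB !rmorphM /= -!frac_numden -/dx -/dy mulrBl mulrA; congr (_ - _).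
  by rewrite [tofrac dx * _]mulrC mulrA.
- split=> [|x y]; first by rewrite -(rmorph1 tofrac) evalP ev1.
  set dx := \d_(generic_quotient.repr x); set dy := \d_(generic_quotient.repr y).
  have dx0 : dx != 0 := denom_neq0 x; have dy0 : dy != 0 := denom_neq0 y.
  rewrite (ratfun_evalE (mulf_neq0 dx0 dy0)
    (_ : _ = tofrac (\n_(generic_quotient.repr x) * \n_(generic_quotient.repr y)))).
    rewrite (ratfun_evalE dx0 (frac_numden x)) (ratfun_evalE dy0 (frac_numden y)).
    by rewrite !evM mulf_div.
  by rewrite !rmorphM /= -!frac_numden -/dx -/dy mulrACA.
by exists f; split=> [x|p]; rewrite fE ?evalP.
Qed.
End Evaluation.
End RationalFunctions.

Section Embeddings.
Variable F : fieldType.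
Local Notation K := {fraction {poly F}}.
Local Notation L := (puiseux F).
Local Notation tofrac := (@FracField.tofrac {poly F}).

Lemma const_puiseux_morphism : exists c : {rmorphism F -> L}, c =1 @const_puiseux F.
Proof.
apply: rmorphism_pack.
  move=> x y; apply: puiseuxP => r; rewrite puiseux_coefD puiseux_coefN !pmonom_coef.
  by case: eqP; rewrite ?subrr ?subr0.
by split=> // x y; rewrite /const_puiseux pmonomM addr0.
Qed.

Lemma pmonomX s k : (pmonom (1 : F) s) ^+ k = pmonom 1 (k%:R * s).
Proof.
elim: k => [|k IH]; first by rewrite expr0 mul0r.
by rewrite exprS IH pmonomM mulr1 -natr1 mulrDl mul1r addrC.
Qed.

Lemma horner_pmonom (c : {rmorphism F -> L}) s p r : c =1 @const_puiseux F ->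
  (map_poly c p).[pmonom 1 s] r = \sum_(i < size p) (if r == i%:R * s then p`_i else 0).
Proof.
move=> cE; rewrite horner_coef size_map_poly puiseux_coef_sum; apply: eq_bigr => i _.
have -> : (map_poly c p)`_i = pmonom p`_i 0 by rewrite coef_map; exact: cE.
rewrite pmonomX pmonomM_coef subr0 pmonom_coef.
by case: eqP; rewrite ?mulr1 ?mulr0.
Qed.

Lemma horner_pmonom_coef (c : {rmorphism F -> L}) s p i : c =1 @const_puiseux F ->
  s != 0 -> (map_poly c p).[pmonom 1 s] (i%:R * s) = p`_i.
Proof.
move=> cE s0; rewrite horner_pmonom //.
have [ip|pi] := ltnP i (size p); last first.
  rewrite nth_default // big1 // => k _; case: eqP => // /(mulIf s0)/eqP.
  by rewrite eqr_nat => /eqP ik; move: (ltn_ord k); rewrite -ik ltnNge pi.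
rewrite (bigD1 (Ordinal ip)) //= eqxx big1 ?addr0 // => k ki.
case: eqP => // /(mulIf s0)/eqP; rewrite eqr_nat => /eqP ik.
by move: ki; rewrite -val_eqE /= -ik eqxx.
Qed.

(** s = 1 is the expansion at 0, s = -1 the expansion at infinity, and s = 1/j the embedding z ->
    z^(1/j). *)
Lemma ratfun_puiseux s : s != 0 -> exists f : {rmorphism K -> L},
  [/\ forall x, f x = ratfun_eval (@const_puiseux F) (pmonom 1 s) x,
      forall p r, f (tofrac p) r = \sum_(i < size p) (if r == i%:R * s then p`_i else 0)
    & forall p i, f (tofrac p) (i%:R * s) = p`_i].
Proof.
move=> s0; have [c cE] := const_puiseux_morphism.
have [|f [fE fp]] := @ratfun_morphism F L c (pmonom 1 s).
  move=> p p0; apply: contraNneq p0 => p0; apply/eqP/polyP => i.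
  by rewrite coef0 -(horner_pmonom_coef p i cE s0) p0.
have cfun : GRing.RMorphism.sort c = @const_puiseux F by apply/funext.
exists f; split=> [x|p r|p i].
- by rewrite fE cfun.
- by rewrite fp horner_pmonom.
by rewrite fp horner_pmonom_coef.
Qed.

Lemma const_ratfun_morphism : exists c : {rmorphism F -> K}, c =1 @const_ratfun F.
Proof.
apply: rmorphism_pack; first by move=> x y; rewrite /const_ratfun !rmorphB.
by split=> [|x y]; rewrite /const_ratfun ?rmorph1 // !rmorphM.
Qed.

Lemma sigma_ratfun_morphism q : q != 0 -> exists f : {rmorphism K -> K},
  f =1 sigma_ratfun q /\ forall p, f (tofrac p) = tofrac (p \Po (q *: 'X)).
Proof.
move=> q0; have [c cE] := const_ratfun_morphism.
have evE p : (map_poly c p).[tofrac (q%:P * 'X)] = tofrac (p \Po (q *: 'X)).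
  elim/poly_ind: p => [|p a IH]; first by rewrite rmorph0 horner0 comp_poly0 rmorph0.
  rewrite rmorphD rmorphM /= map_polyX map_polyC hornerMXaddC IH /= cE.
  by rewrite comp_poly_MXaddC -mul_polyC rmorphD [X in _ = X + _]rmorphM.
have [|f [fE fp]] := @ratfun_morphism F K c (tofrac (q%:P * 'X)).
  move=> p p0; rewrite evE tofrac_eq0; apply: contraNneq p0 => p0.
  have : (p \Po (q *: 'X)) \Po (q^-1 *: 'X) = p.
    by rewrite -comp_polyA comp_polyZ comp_polyX scalerA mulfV // scale1r comp_polyXr.
  by rewrite p0 comp_poly0 => <-.
have cfun : GRing.RMorphism.sort c = @const_ratfun F by apply/funext.
by exists f; split=> [x|p]; [rewrite fE cfun|rewrite fp evE].
Qed.
End Embeddings.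

Section DilationEmbedding.
Variables (F : fieldType) (q : F) (chi : rat -> F).
Local Notation K := {fraction {poly F}}.
Local Notation L := (puiseux F).
Local Notation tofrac := (@FracField.tofrac {poly F}).
Variables (sK : {rmorphism K -> K}) (sg : {rmorphism L -> L}) (s : rat)
  (f : {rmorphism K -> L}).
Hypotheses (ch : character chi) (chi_s : chi s = q).
Hypothesis sKE : forall p, sK (tofrac p) = tofrac (p \Po (q *: 'X)).
Hypothesis sgE : forall (x : L) r, sg x r = chi r * x r.
Hypothesis fE : forall p r,
  f (tofrac p) r = \sum_(i < size p) (if r == i%:R * s then p`_i else 0).

Lemma comp_dilation_coef (p : {poly F}) i : (p \Po (q *: 'X))`_i = q ^+ i * p`_i.
Proof.
elim/poly_ind: p i => [|p a IH] i; first by rewrite comp_poly0 coef0 mulr0.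
rewrite comp_poly_MXaddC -scalerAr coefD coefZ coefMX !coefD coefMX !coefC.
case: i => [|i] /=; first by rewrite mulr0 expr0 mul1r.
by rewrite !addr0 IH exprS mulrA.
Qed.

Lemma size_comp_dilation (p : {poly F}) : (size (p \Po (q *: 'X)) <= size p)%N.
Proof. by apply/leq_sizeP => i ip; rewrite comp_dilation_coef nth_default ?mulr0. Qed.

Lemma dilation_embedding x : sg (f x) = f (sK x).
Proof.
apply: (@frac_hom_ext F L (sg \o f) (f \o sK)) => p /=; apply: puiseuxP => r.
rewrite sgE sKE !fE mulr_sumr.
rewrite [RHS](big_ord_widen (size p) (fun i => if r == i%:R * s then (p \Po (q *: 'X))`_i else 0));
  last exact: size_comp_dilation.
rewrite [RHS]big_mkcond; apply: eq_bigr => i _.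
have E : chi (i%:R * s) * p`_i = (p \Po (q *: 'X))`_i.
  by rewrite comp_dilation_coef mulrC [i%:R * s]mulrC -characterX // chi_s mulrC.
case: ltnP => [_|ip]; (case: eqP => [->|_]; last by rewrite mulr0); first exact: E.
by rewrite E nth_default.
Qed.

(** The coefficients of the expansion of an invariant satisfy chi(r) f_r = f_r, so only the constant
    term remains. *)
Lemma dilation_fixed (c : {rmorphism F -> K}) : s != 0 -> faithful chi ->
  c =1 @const_ratfun F -> forall x, sK x = x -> exists a, x = c a.
Proof.
move=> s0 fc cE x sx; exists (f x 0); apply: (fmorph_inj f); apply: puiseuxP => r.
rewrite cE /const_ratfun fE; have [r0|r0] := eqVneq r 0; last first.
  have := congr1 (fun y : L => y r) (dilation_embedding x); rewrite sx sgE => /eqP.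
  rewrite -subr_eq0 -{2}[f x r]mul1r -mulrBl mulf_eq0 subr_eq0 => /orP[/eqP/fc/eqP|/eqP ->].
    by rewrite (negPf r0).
  rewrite big1 // => i _; case: eqP => // ri; rewrite coefC; case: eqP => // i0.
  by move: r0; rewrite ri i0 mul0r eqxx.
rewrite r0; have [->|a0] := eqVneq (f x 0) 0.
  by rewrite polyC0 size_poly0 big_ord0.
by rewrite size_polyC a0 big_ord_recl big_ord0 mul0r eqxx addr0 coefC.
Qed.
End DilationEmbedding.

(** * Regularity of rational vectors *)

Section Regularity.
Variable F : closedFieldType.
Local Notation K := {fraction {poly F}}.
Local Notation tofrac := (@FracField.tofrac {poly F}).

Definition regular (a : F) (x : K) : Prop :=
  exists n d : {poly F}, x * tofrac d = tofrac n /\ d.[a] != 0.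

Lemma regular_poly a p : regular a (tofrac p).
Proof. by exists p, 1; rewrite rmorph1 mulr1 hornerC oner_eq0. Qed.

Lemma regularD a x y : regular a x -> regular a y -> regular a (x + y).
Proof.
move=> [n [d [xd da]]] [n' [d' [yd da']]]; exists (n * d' + n' * d), (d * d').
split; last by rewrite hornerM mulf_neq0.
by rewrite rmorphD !rmorphM /= -xd -yd mulrDl mulrA [tofrac d * _]mulrC mulrA.
Qed.

Lemma regularM a x y : regular a x -> regular a y -> regular a (x * y).
Proof.
move=> [n [d [xd da]]] [n' [d' [yd da']]]; exists (n * n'), (d * d').
by split; [rewrite !rmorphM /= -xd -yd mulrACA|rewrite hornerM mulf_neq0].
Qed.

Definition regular_mx (a : F) m n (M : 'M[K]_(m, n)) : Prop := forall i j, regular a (M i j).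

Lemma regular_mulmx a m n l (M : 'M_(m, n)) (N : 'M_(n, l)) :
  regular_mx a M -> regular_mx a N -> regular_mx a (M *m N).
Proof.
move=> rM rN i j; rewrite mxE; apply: (big_ind (regular a)) => [|x y|k _].
- by rewrite -(rmorph0 tofrac); exact: regular_poly.
- exact: regularD.
by apply: regularM.
Qed.

Lemma regular_scale a c m n (M : 'M_(m, n)) :
  regular a c -> regular_mx a M -> regular_mx a (c *: M).
Proof. by move=> rc rM i j; rewrite mxE; apply: regularM. Qed.

Lemma common_denominator m n (M : 'M[K]_(m, n)) : exists2 d : {poly F}, d != 0 &
  forall i j, exists p, tofrac d * M i j = tofrac p.
Proof.
pose den i j := \d_(generic_quotient.repr (M i j)).
exists (\prod_i \prod_j den i j).
  by apply/prodf_neq0 => i _; apply/prodf_neq0 => j _; exact: denom_neq0.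
move=> i j; rewrite (bigD1 i) //= (bigD1 j) //= -mulrA.
eexists; rewrite rmorphM mulrC mulrA /= frac_numden -rmorphM; reflexivity.
Qed.

Section Dilation.
Variables (q : F) (s s' : {rmorphism K -> K}).
Hypotheses (q0 : q != 0) (sE : forall p, s (tofrac p) = tofrac (p \Po (q *: 'X)))
  (s'E : forall p, s' (tofrac p) = tofrac (p \Po (q^-1 *: 'X))).

Lemma dilationK : cancel s s'.
Proof.
apply: (@frac_hom_ext F K (s' \o s) idfun) => p /=; rewrite sE s'E -comp_polyA.
by rewrite comp_polyZ comp_polyX scalerA mulfV // scale1r comp_polyXr.
Qed.

Lemma dilationKV : cancel s' s.
Proof.
apply: (@frac_hom_ext F K (s \o s') idfun) => p /=; rewrite s'E sE -comp_polyA.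
by rewrite comp_polyZ comp_polyX scalerA mulVf // scale1r comp_polyXr.
Qed.

Lemma regular_dilation a x : regular (q * a) x -> regular a (s x).
Proof.
move=> [n [d [xd da]]]; exists (n \Po (q *: 'X)), (d \Po (q *: 'X)).
by split; [rewrite -!sE -xd rmorphM|rewrite horner_comp hornerZ hornerX].
Qed.
End Dilation.

Lemma regular_dilationV q (s s' : {rmorphism K -> K}) a x : q != 0 ->
  (forall p, s (tofrac p) = tofrac (p \Po (q *: 'X))) ->
  (forall p, s' (tofrac p) = tofrac (p \Po (q^-1 *: 'X))) ->
  regular a (s x) -> regular (q * a) x.
Proof.
move=> q0 sE s'E rx; rewrite -[x](dilationK q0 sE s'E).
by apply: (regular_dilation s'E); rewrite mulKf.
Qed.

(** A denominator of minimal degree has no root except 0: at any other root the numerator would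
    vanish too. *)
Lemma laurent_polynomial x : (forall a, a != 0 -> regular a x) ->
  exists m p, x * tofrac 'X^m = tofrac p.
Proof.
move=> reg.
pose P k := `[< exists n d : {poly F}, [/\ x * tofrac d = tofrac n, d != 0 & size d = k] >].
have exP : exists k, P k.
  by eexists; apply/asboolP; do 2 eexists; split; [exact: frac_numden|exact: denom_neq0|].
case: (ex_minnP exP) => k /asboolP[n [d [xd d0 sd]]] mink.
have droot a : root d a -> a = 0.
  move=> rd; apply/eqP; apply: contraT => a0; have [n' [d' [xd' da']]] := reg a a0.
  have nd : n * d' = n' * d.
    apply/eqP; rewrite -(@tofrac_eq {poly F}) !rmorphM /= -xd -xd'; apply/eqP.
    by rewrite mulrAC.
  have rn : root n a.
    have := congr1 (fun p => p.[a]) nd; rewrite !hornerM.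
    move: rd; rewrite !rootE => /eqP ->; rewrite mulr0 => /eqP.
    by rewrite mulf_eq0 (negPf da') orbF.
  have [n1 nE] := factor_theorem _ _ rn; have [d1 dE] := factor_theorem _ _ rd.
  have d10 : d1 != 0 by apply: contraNneq d0 => h; rewrite dE h mul0r.
  have /mink : P (size d1).
    apply/asboolP; exists n1, d1; split=> //.
    have X0 : tofrac ('X - a%:P) != 0 by rewrite tofrac_eq0 polyXsubC_eq0.
    by apply: (mulIf X0); rewrite -mulrA -!rmorphM /= -dE -nE.
  by rewrite -sd dE size_Mmonic ?monicXsubC // size_XsubC addn2 ltnn.
have [rs rsE] := closed_field_poly_normal d.
have rs0 : forall a, a \in rs -> a = 0.
  by move=> a ars; apply: droot; rewrite rsE rootZ ?lead_coef_eq0 // root_prod_XsubC.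
have dE : d = lead_coef d *: 'X^(size rs).
  rewrite {1}rsE; congr (_ *: _); elim: rs rs0 {rsE} => [|a rs IH] rs0; first by rewrite big_nil.
  rewrite big_cons IH => [|b bl]; last by apply: rs0; rewrite inE bl orbT.
  by rewrite (rs0 a) ?mem_head // subr0 -exprS.
exists (size rs), ((lead_coef d)^-1 *: n).
rewrite -mul_polyC rmorphM /= -xd {2}dE -mul_polyC rmorphM /= mulrCA [tofrac _ * (tofrac _ * _)]mulrA.
by rewrite -rmorphM -rmorphM /= -polyCM mulVf ?lead_coef_eq0 // polyC1 mul1r.
Qed.

(** [f0] and [f1] are the expansions at 0 and at infinity. Poles of order at most N there and none
    elsewhere confine x to a space of dimension 2N + 1 over F. *)
Lemma laurent_bounded (f0 f1 : {rmorphism K -> puiseux F}) N x :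
  (forall p i, f0 (tofrac p) (i%:R * 1) = p`_i) ->
  (forall p i, f1 (tofrac p) (i%:R * -1) = p`_i) ->
  (forall m, f0 (tofrac 'X^m) = pmonom 1 m%:R) ->
  (forall m, f1 (tofrac 'X^m) = pmonom 1 (- m%:R)) ->
  (forall a, a != 0 -> regular a x) ->
  val_ge (f0 x) (- N%:R) -> val_ge (f1 x) (- N%:R) ->
  exists2 p : {poly F}, (size p <= (N + N).+1)%N & x * tofrac 'X^N = tofrac p.
Proof.
move=> f0E f1E f0X f1X reg v0 v1; have [m [n xn]] := laurent_polynomial reg.
have c0 i : f0 x (i%:R - m%:R) = n`_i.
  rewrite -(f0E n i) -xn (rmorphM f0) f0X mulrC.
  by rewrite pmonomM_coef mul1r mulr1.
have c1 i : f1 x (m%:R - i%:R) = n`_i.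
  rewrite -(f1E n i) -xn (rmorphM f1) f1X mulrC.
  by rewrite pmonomM_coef mul1r opprK mulrN mulr1 addrC.
have n_low i : (i + N < m)%N -> n`_i = 0.
  by move=> im; rewrite -c0 v0 // ltrBlDr addrC -ltrBlDr opprK -natrD ltr_nat.
have n_high i : (m + N < i)%N -> n`_i = 0.
  by move=> im; rewrite -c1 v1 // ltrBlDr addrC -ltrBlDr opprK -natrD ltr_nat.
pose n' := drop_poly m (n * 'X^N).
have n'E : n' * 'X^m = n * 'X^N.
  rewrite -[RHS](poly_take_drop m) (_ : take_poly m _ = 0) ?add0r //.
  apply/polyP => i; rewrite coef_take_poly coef0 coefMXn; case: ltnP => // im.
  by case: ltnP => // Ni; apply: n_low; rewrite subnK.
exists n'.
  apply/leq_sizeP => i iN; rewrite coef_drop_poly coefMXn; case: ltnP => // h.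
  by apply: n_high; lia.
have Xm0 : tofrac 'X^m != 0 by rewrite tofrac_eq0 -size_poly_eq0 size_polyXn.
by apply: (mulIf Xm0); rewrite mulrAC xn -!rmorphM /= n'E.
Qed.

(* A bijective semilinear operator, seen through its effect on regularity: outside
   of the singularities, t v is regular at a if and only if v is regular at q a. *)
Definition transports (r : nat) (q : F) (sing : set F) (t : 'rV[K]_r -> 'rV[K]_r) : Prop :=
  forall a v, ~ sing a -> regular_mx (q * a) v <-> regular_mx a (t v).

(** Regularity of v read at the end of the q-orbit of a: once the orbit has passed its last
    singularity, the condition no longer depends on k. *)
Definition eventually_regular r q (t : 'rV[K]_r -> 'rV[K]_r) a v : Prop :=
  exists k0, forall k, (k0 <= k)%N -> regular_mx (q ^- k * a) (iter k t v).

Lemma eventually_regularE r q sing (t : 'rV[K]_r -> 'rV[K]_r) a v k1 : q != 0 ->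
  transports q sing t -> (forall k, (k1 < k)%N -> ~ sing (q ^- k * a)) ->
  eventually_regular q t a v <-> regular_mx (q ^- k1 * a) (iter k1 t v).
Proof.
move=> q0 tr ns.
have step k : (k1 <= k)%N -> regular_mx (q ^- k * a) (iter k t v) <->
    regular_mx (q ^- k.+1 * a) (iter k.+1 t v).
  move=> kk; have := tr (q ^- k.+1 * a) (iter k t v) (ns k.+1 kk).
  by rewrite mulrA exprS invfM mulVKf.
have all k : (k1 <= k)%N -> regular_mx (q ^- k * a) (iter k t v) <->
    regular_mx (q ^- k1 * a) (iter k1 t v).
  elim: k => [|k IH]; first by rewrite leqn0 => /eqP ->.
  rewrite leq_eqVlt => /predU1P[<-//|kk].
  by apply: iff_trans (IH kk); apply: iff_sym; apply: step.
split=> [[k0 k0P]|reg]; last by exists k1 => k kk; apply/(all k kk).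
by apply/(all (maxn k0 k1)); [rewrite leq_maxr|apply: k0P; rewrite leq_maxl].
Qed.

Lemma transports_inv r q sing (t t' : 'rV[K]_r -> 'rV[K]_r) : q != 0 ->
  transports q sing t -> cancel t' t ->
  transports q^-1 (fun a => sing (q^-1 * a)) t'.
Proof.
move=> q0 tr tK a v ns; have := tr (q^-1 * a) (t' v) ns.
by rewrite tK mulVKf // => h; apply: iff_sym.
Qed.

Lemma exists_nonsingular (q : F) (l : seq F) : (forall m n : nat, q ^+ m = q ^+ n -> m = n) ->
  exists B, forall b, b \in l -> b != 0 -> forall k, (B <= k)%N -> q ^+ k * b \notin l.
Proof.
move=> qinj.
suff H (l1 : seq F) : exists B, forall b, b \in l1 -> b != 0 -> forall k, (B <= k)%N -> q ^+ k * b \notin l.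
  exact: H.
elim: l1 => [|x l1 [B BP]]; first by exists 0%N.
have [x0|x0] := eqVneq x 0.
  by exists B => b; rewrite inE => /predU1P[->|/BP//]; rewrite x0 eqxx.
have [|B' B'P] := @injective_avoids _ (fun k => q ^+ k * x) l.
  by move=> m n /(mulIf x0); apply: qinj.
exists (maxn B B') => b bl b0 k; rewrite geq_max => /andP[Bk B'k].
by move: bl; rewrite inE => /predU1P[->|bl]; [exact: B'P|exact: BP].
Qed.
End Regularity.

(** * Consistent systems *)

Section Consistent.
Variables (F : closedFieldType) (q p : F) (chi psi : rat -> F).
Local Notation K := {fraction {poly F}}.
Local Notation L := (puiseux F).
Local Notation tofrac := (@FracField.tofrac {poly F}).
Hypotheses (ch : character chi) (cp : character psi) (chi1 : chi 1 = q) (psi1 : psi 1 = p).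
Hypothesis indep : forall x y, chi x * psi y = 1 -> x = 0 /\ y = 0.
Variables (sK sK' tK tK' : {rmorphism K -> K}).
Hypotheses (sKE : forall f, sK (tofrac f) = tofrac (f \Po (q *: 'X)))
  (sK'E : forall f, sK' (tofrac f) = tofrac (f \Po (q^-1 *: 'X)))
  (tKE : forall f, tK (tofrac f) = tofrac (f \Po (p *: 'X)))
  (tK'E : forall f, tK' (tofrac f) = tofrac (f \Po (p^-1 *: 'X))).
Variables (r : nat) (P P' Q Q' : 'M[K]_r).
Hypotheses (PP' : P *m P' = 1%:M) (QQ' : Q *m Q' = 1%:M)
  (comm : map_mx sK Q *m P = map_mx tK P *m Q).

Let q0 : q != 0. Proof. by rewrite -chi1 character_neq0. Qed.
Let p0 : p != 0. Proof. by rewrite -psi1 character_neq0. Qed.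

Let s (v : 'rV[K]_r) := map_mx sK v *m P.
Let s' (v : 'rV[K]_r) := map_mx sK' (v *m P').
Let t (v : 'rV[K]_r) := map_mx tK v *m Q.

Let sK_K := dilationK q0 sKE sK'E.
Let sK_KV := dilationKV q0 sKE sK'E.

Let s'K : cancel s' s.
Proof.
move=> v; rewrite /s /s'.
have -> : map_mx sK (map_mx sK' (v *m P')) = v *m P'.
  by apply/matrixP => i j; rewrite mxE [map_mx sK' _ i j]mxE sK_KV.
by rewrite -mulmxA (mulmx1C PP') mulmx1.
Qed.

Let sK1 : cancel s s'.
Proof.
move=> v; rewrite /s /s' -mulmxA PP' mulmx1.
by apply/matrixP => i j; rewrite !mxE sK_K.
Qed.

Let st v : s (t v) = t (s v).
Proof.
rewrite /s /t !map_mxM -!mulmxA comm; congr (_ *m _); apply/matrixP => i j; rewrite !mxE.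
apply: (@frac_hom_ext F K (sK \o tK) (tK \o sK)) => f /=.
by rewrite tKE !sKE tKE -!comp_polyA !comp_polyZ !comp_polyX !scalerA mulrC.
Qed.

Let s't v : s' (t v) = t (s' v).
Proof. by apply: (can_inj sK1); rewrite s'K st s'K. Qed.

Let singular_denominator : exists2 D : {poly F}, D != 0 & forall a, ~~ root D a ->
  [/\ regular_mx a P, regular_mx a P', regular_mx a Q & regular_mx a Q'].
Proof.
have [d1 d10 d1P] := common_denominator P; have [d2 d20 d2P] := common_denominator P'.
have [d3 d30 d3P] := common_denominator Q; have [d4 d40 d4P] := common_denominator Q'.
exists (d1 * d2 * (d3 * d4)); first by rewrite !mulf_neq0.
move=> a; rewrite !rootM !negb_or => /andP[/andP[a1 a2] /andP[a3 a4]].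
have reg d (M : 'M[K]_r) : ~~ root d a ->
    (forall i j, exists f, tofrac d * M i j = tofrac f) -> regular_mx a M.
  by move=> da dM i j; have [f fE] := dM i j; exists f, d; rewrite mulrC fE.
by split; [apply: (reg d1)|apply: (reg d2)|apply: (reg d3)|apply: (reg d4)].
Qed.

Lemma semilinear_transports (u : F) (uK uK' : {rmorphism K -> K}) (M M' : 'M[K]_r)
    (sing : set F) : u != 0 -> (forall f, uK (tofrac f) = tofrac (f \Po (u *: 'X))) ->
  (forall f, uK' (tofrac f) = tofrac (f \Po (u^-1 *: 'X))) -> M *m M' = 1%:M ->
  (forall a, ~ sing a -> regular_mx a M /\ regular_mx a M') ->
  transports u sing (fun v => map_mx uK v *m M).
Proof.
move=> u0 uE u'E MM' reg a v ns; have [rM rM'] := reg a ns; split=> rv.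
  apply: regular_mulmx => // i j; rewrite mxE; exact: (regular_dilation uE).
have : regular_mx a (map_mx uK v).
  by rewrite -[map_mx uK v]mulmx1 -MM' mulmxA; apply: regular_mulmx.
move=> h i j; apply: (regular_dilationV u0 uE u'E); have := h i j; by rewrite mxE.
Qed.

Let qinj (m n : nat) : q ^+ m = q ^+ n -> m = n.
Proof.
rewrite -chi1 !characterX // !mul1r => e.
have fc : faithful chi by move=> x cx; have [] := indep (x := x) (y := 0); rewrite ?(proj1 cp) ?mulr1.
by have /eqP := faithful_inj ch fc e; rewrite eqr_nat => /eqP.
Qed.

Lemma eventually_regular_commute (u : F) (S T : 'rV[K]_r -> 'rV[K]_r) (w : F) sing a v :
  transports w sing T -> (forall v, S (T v) = T (S v)) -> w != 0 ->
  (exists B, forall k, (B <= k)%N -> ~ sing (u ^- k * (w^-1 * a))) ->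
  eventually_regular u S a v <-> eventually_regular u S (w^-1 * a) (T v).
Proof.
move=> tr ST w0 [B BP].
have iST k : iter k S (T v) = T (iter k S v) by elim: k => //= k ->; rewrite ST.
have eqv k : (B <= k)%N -> regular_mx (u ^- k * a) (iter k S v) <->
    regular_mx (u ^- k * (w^-1 * a)) (iter k S (T v)).
  by move=> /BP ns; have := tr _ (iter k S v) ns; rewrite iST mulrCA mulVKf.
split=> -[k0 k0P]; exists (maxn B k0) => k; rewrite geq_max => /andP[Bk k0k].
  by apply/(eqv k Bk); apply: k0P.
by apply/(eqv k Bk); apply: k0P.
Qed.

(** If the conditions at the two ends of the q-orbit of a differ for some vector, then t transports
    this to the orbits of all p^-l a. Each of these orbits contains one of the finitely many
    singularities, but by independence they are pairwise distinct. *)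
Lemma two_sided_regular : exists (sing : seq F),
  [/\ transports q [set a | a \in sing] s, transports p [set a | a \in sing] t
    & forall a v, a != 0 ->
        eventually_regular q s a v <-> eventually_regular q^-1 s' a v].
Proof.
have [D D0 DP] := singular_denominator.
have [sing singE] := closed_field_poly_normal D.
have ns a : ~ [set a | a \in sing] a -> ~~ root D a.
  by rewrite /= => /negP; rewrite singE rootZ ?lead_coef_eq0 // root_prod_XsubC.
have trs : transports q [set a | a \in sing] s.
  by apply: (semilinear_transports q0 sKE sK'E PP') => a /ns/DP[].
have trt : transports p [set a | a \in sing] t.
  by apply: (semilinear_transports p0 tKE tK'E QQ') => a /ns/DP[].
exists sing; split=> // a v a0; apply: contrapT => Dv.
have qV0 : q^-1 != 0 by rewrite invr_eq0.
have trs' := transports_inv q0 trs s'K.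
pose bad a := exists v, ~ (eventually_regular q s a v <-> eventually_regular q^-1 s' a v).
have avoid1 (b : F) : b != 0 -> exists B, forall k, (B <= k)%N -> ~ [set a | a \in sing] (q ^- k * b).
  move=> b0; have [|B BP] := @injective_avoids _ (fun k => q ^- k * b) sing.
    by move=> m n /(mulIf b0)/invr_inj; apply: qinj.
  by exists B => k /BP /negP.
have avoid2 (b : F) : b != 0 -> exists B, forall k, (B <= k)%N -> ~ [set a | a \in sing] (q^-1 ^- k * b).
  move=> b0; have [|B BP] := @injective_avoids _ (fun k => q^-1 ^- k * b) sing.
    by move=> m n /(mulIf b0)/invr_inj; rewrite !exprVn => /invr_inj; apply: qinj.
  by exists B => k /BP /negP.
have bad_p b : b != 0 -> bad b -> bad (p^-1 * b).
  move=> b0 [u uP]; exists (t u) => h; apply: uP.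
  have pb0 : p^-1 * b != 0 by rewrite mulf_neq0 ?invr_eq0.
  have e1 := eventually_regular_commute u trt st p0 (avoid1 _ pb0).
  have e2 := eventually_regular_commute u trt s't p0 (avoid2 _ pb0).
  by split=> [/e1/h/e2|/e2/h/e1].
(* Off the orbits of the singularities both conditions mean regularity at b. *)
have bad_sing b : bad b -> exists x, chi x * b \in sing.
  move=> [u uP]; apply: contrapT => none; apply: uP.
  have n1 k : ~ [set a | a \in sing] (q ^- k * b).
    move=> h; apply: none; exists (- k%:R).
    by rewrite characterN // -[k%:R]mul1r -characterX // chi1.
  have n2 k : ~ [set a | a \in sing] (q ^+ k * b).
    move=> h; apply: none; exists k%:R.
    by rewrite -[k%:R]mul1r -characterX // chi1.
  have e1 := @eventually_regularE F r q _ s b u 0 q0 trs (fun k _ => n1 k).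
  have e2 : eventually_regular q^-1 s' b u <-> regular_mx (q^-1 ^- 0 * b) (iter 0 s' u).
    apply: (eventually_regularE _ qV0 trs') => k k0 /=.
    rewrite exprVn invrK -(prednK k0) exprS mulrA mulrA mulVf // mul1r.
    exact: n2.
  by apply: iff_trans e1 _; apply: iff_sym; apply: iff_trans e2 _; rewrite !expr0 !invr1.
have bad_l l : bad (p ^- l * a).
  elim: l => [|l IH]; first by rewrite expr0 invr1 mul1r; exists v.
  rewrite exprS invfM -mulrA; apply: bad_p => //.
  by rewrite mulf_neq0 ?invr_eq0 ?expf_neq0.
have [x xP] := choice (fun l => bad_sing _ (bad_l l)).
have [|B BP] := @injective_avoids _ (fun l => chi (x l) * (p ^- l * a)) sing.
  move=> m n; rewrite !mulrA => /(mulIf a0) e.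
  rewrite -psi1 !characterX // !mul1r -!characterN // in e.
  have [|_] := indep (x := x m - x n) (y := - m%:R + n%:R).
    rewrite (proj2 ch) (proj2 cp) mulrACA e mulrACA -(proj2 ch) -(proj2 cp).
    by rewrite subrr addNr (proj1 ch) (proj1 cp) mulr1.
  by move=> /eqP; rewrite addrC subr_eq0 eqr_nat => /eqP.
by have := BP B (leqnn _); rewrite xP.
Qed.

Let iter_s'_mx k : exists M : 'M[K]_r, forall v, iter k s' v = map_mx (iter k sK') v *m M.
Proof.
elim: k => [|k [M MP]].
  by exists 1%:M => v; rewrite mulmx1 /=; apply/matrixP => i j; rewrite mxE.
exists (map_mx sK' M *m map_mx sK' P') => v; rewrite iterS MP /s' !map_mxM -!mulmxA.
by congr (_ *m _); apply/matrixP => i j; rewrite !mxE.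
Qed.

Let iter_s_mx k : exists M : 'M[K]_r, forall v, iter k s v = map_mx (iter k sK) v *m M.
Proof.
elim: k => [|k [M MP]].
  by exists 1%:M => v; rewrite mulmx1 /=; apply/matrixP => i j; rewrite mxE.
exists (map_mx sK M *m P) => v; rewrite iterS MP /s !map_mxM -!mulmxA.
by congr (_ *m _); apply/matrixP => i j; rewrite !mxE.
Qed.

(* The vectors regular everywhere near the ends of the q-orbits; they have bounded
   poles outside of 0 and infinity. *)
Let global v := forall a, a != 0 -> eventually_regular q s a v.

(** For each a, either q^-k a is nonsingular for all k > B, or q^k a is nonsingular for all k >= 0.
    Being global at a then means that s^B v is regular at q^-B a, respectively that v is regular at
    a. So the denominators of the matrix of s^-B bound the poles of global vectors, and a polynomial
    multiple of a basis vector is global. *)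
Lemma global_sections : (exists2 d : {poly F}, d != 0 &
    forall v, global v -> forall a, a != 0 -> regular_mx a (tofrac d *: v)) /\
  ((0 < r)%N -> exists2 v, v != 0 & global v).
Proof.
have [sing [trs trt np]] := two_sided_regular.
have qV0 : q^-1 != 0 by rewrite invr_eq0.
have trs' := transports_inv q0 trs s'K.
have [B BP] := exists_nonsingular sing qinj.
have dicho a : a != 0 -> (forall k, (B < k)%N -> ~ [set a | a \in sing] (q ^- k * a)) \/
    (forall k, ~ [set a | a \in sing] (q ^+ k * a)).
  move=> a0; have [h|/existsNP[k /not_implyP[kB /contrapT kS]]] :=
    pselect (forall k, (B < k)%N -> ~ [set a | a \in sing] (q ^- k * a)); first by left.
  right=> k' /= k'S; have b0 : q ^- k * a != 0 by rewrite mulf_neq0 ?invr_eq0 ?expf_neq0.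
  have := BP _ kS b0 (k' + k)%N (leq_trans (ltnW kB) (leq_addl _ _)).
  by rewrite exprD -mulrA mulVKf ?expf_neq0 // k'S.
have right_regular a v : a != 0 -> (forall k, ~ [set a | a \in sing] (q ^+ k * a)) ->
    eventually_regular q s a v <-> regular_mx a v.
  move=> a0 n2; apply: iff_trans (np a v a0) _.
  have e2 : eventually_regular q^-1 s' a v <-> regular_mx (q^-1 ^- 0 * a) (iter 0 s' v).
    apply: (eventually_regularE _ qV0 trs') => k k0 /=.
    rewrite exprVn invrK -(prednK k0) exprS mulrA mulrA mulVf // mul1r.
    exact: n2.
  by apply: iff_trans e2 _; rewrite expr0 invr1 mul1r.
have iter_tofrac (fK : {rmorphism K -> K}) (u : F) k f :
    (forall f, fK (tofrac f) = tofrac (f \Po (u *: 'X))) ->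
    exists f', iter k fK (tofrac f) = tofrac f'.
  by move=> fE; elim: k => [|k [f' f'E]]; [exists f|rewrite iterS f'E fE; eexists].
have isK : forall k x, iter k sK (iter k sK' x) = x.
  by elim=> // k IH x; rewrite iterSr /= sK_KV IH.
split.
  have [M MP] := iter_s'_mx B; have [d d0 dP] := common_denominator M.
  exists d => // v gv a a0; have [n1|n2] := dicho a a0; last first.
    apply: regular_scale; first exact: regular_poly.
    by apply/(right_regular a v a0 n2); apply: gv.
  have /(eventually_regularE v q0 trs n1) regB := gv a a0.
  have -> : v = map_mx (iter B sK') (iter B s v) *m M.
    rewrite -MP; elim: (B) (v) => // k IH w.
    by rewrite iterSr [iter k.+1 s w]iterS sK1 -IH.
  rewrite scalemxAr; apply: regular_mulmx.
    move=> i j; rewrite mxE; move: (iter B s v) regB => w regB.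
    have {regB} := regB i j; move: (w i j) => x; elim: (B) (a) => [|k IH] b.
      by rewrite expr0 invr1 mul1r.
    move=> rx; rewrite iterS; apply: (regular_dilation sK'E); apply: IH.
    by rewrite mulrA -invfM -exprSr.
  by move=> i j; rewrite mxE; have [f ->] := dP i j; exact: regular_poly.
move=> r_gt0; have [M MP] := iter_s_mx B; have [d d0 dP] := common_denominator M.
(* The B-th power of sK maps [e] to [d], the common denominator of the matrix of s^B. *)
have [e eE] := iter_tofrac sK' q^-1 B d sK'E.
have e0 : tofrac e != 0.
  rewrite -eE; elim: (B) => [|k IH] /=; first by rewrite tofrac_eq0.
  by rewrite fmorph_eq0.
exists (tofrac e *: delta_mx 0 (Ordinal r_gt0)).
  apply: contraNneq e0 => /rowP/(_ (Ordinal r_gt0)).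
  by rewrite !mxE !eqxx mulr1 => ->.
move=> a a0; have [n1|n2] := dicho a a0.
  apply/(eventually_regularE _ q0 trs n1); rewrite MP.
  have -> : map_mx (iter B sK) (tofrac e *: delta_mx 0 (Ordinal r_gt0) : 'rV[K]_r) =
      tofrac d *: delta_mx 0 (Ordinal r_gt0).
    apply/rowP => i; rewrite !mxE -eE; case: (i == _); rewrite /= ?mulr1 ?isK // !mulr0.
    by elim: (B) => //= k ->; rewrite rmorph0.
  rewrite -scalemxAl => i j; rewrite ord1 -rowE !mxE.
  by have [f ->] := dP (Ordinal r_gt0) j; exact: regular_poly.
apply/(right_regular _ _ a0 n2) => i j; rewrite !mxE.
case: (_ && _); rewrite ?mulr1 ?mulr0; first exact: regular_poly.
by rewrite -(rmorph0 tofrac); exact: regular_poly.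
Qed.

(** All iterates s^k v are global, so d s^k v has poles at 0 and infinity only, and their order is
    bounded by [bounded_orbits]. Hence the iterates lie in a finite-dimensional space over the
    constants. *)
Lemma polynomial_relation (v : 'rV[K]_r) : global v ->
  exists2 f : {poly F}, f != 0 & \sum_(k < size f) tofrac (f`_k)%:P *: iter k s v = 0.
Proof.
move=> gv; have [[d d0 dP] _] := global_sections.
have gs w : global w -> global (s w).
  move=> gw a a0; have qa0 : q * a != 0 by rewrite mulf_neq0.
  have [k0 k0P] := gw _ qa0; exists k0 => k kk.
  by have := k0P k.+1 (leqW kk); rewrite exprSr invfM -mulrA mulKf // iterSr.
have gk k : global (iter k s v) by elim: k => //= k; exact: gs.
have n1 : (-1 : rat) != 0 by [].
have [f0 [_ f0E f0c]] := ratfun_puiseux F (oner_neq0 rat).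
have [f1 [_ f1E f1c]] := ratfun_puiseux F n1.
have [sg sgE] := twist_morphism ch; have [tg tgE] := twist_morphism cp.
have [sg' sgE'] := twist_morphism (characterV ch).
have [tg' tgE'] := twist_morphism (characterV cp).
(* In the expansion at infinity the dilations act through the inverse characters, so the characters
   are parameters here. *)
have bound (f : {rmorphism K -> L}) (c1 c2 : rat -> F) (s1 t1 : {rmorphism L -> L}) :
    character c1 -> character c2 -> (forall x y, c1 x * c2 y = 1 -> x = 0 /\ y = 0) ->
    (forall (g : L) x, s1 g x = c1 x * g x) -> (forall (g : L) x, t1 g x = c2 x * g x) ->
    (forall x, s1 (f x) = f (sK x)) -> (forall x, t1 (f x) = f (tK x)) ->
    exists a, forall k, row_val (map_mx f (iter k s v)) a.
  move=> ch1 ch2 ind s1E t1E s1f t1f.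
  have QQf : map_mx f Q *m map_mx f Q' = 1%:M by rewrite -map_mxM QQ' map_mx1.
  have map_s (M : 'M[K]_r) : map_mx s1 (map_mx f M) = map_mx f (map_mx sK M).
    by apply/matrixP => i j; rewrite !mxE s1f.
  have map_t (M : 'M[K]_r) : map_mx t1 (map_mx f M) = map_mx f (map_mx tK M).
    by apply/matrixP => i j; rewrite !mxE t1f.
  have commf : map_mx s1 (map_mx f Q) *m map_mx f P = map_mx t1 (map_mx f P) *m map_mx f Q.
    by rewrite map_s map_t -!map_mxM comm.
  have [a aP] := bounded_orbits ch1 ch2 ind s1E t1E QQf commf (map_mx f v).
  exists a => k; have -> : map_mx f (iter k s v) = iter k (semilinear s1 (map_mx f P)) (map_mx f v).
    elim: k => //= k <-; rewrite /semilinear /s map_mxM; congr (_ *m _).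
    by apply/matrixP => i j; rewrite !mxE s1f.
  exact: aP.
have [a0 a0P] : exists a, forall k, row_val (map_mx f0 (iter k s v)) a.
  apply: (bound f0 chi psi sg tg) => //.
    exact: (dilation_embedding ch chi1 sKE sgE f0E).
  exact: (dilation_embedding cp psi1 tKE tgE f0E).
have [a1 a1P] : exists a, forall k, row_val (map_mx f1 (iter k s v)) a.
  apply: (bound f1 _ _ sg' tg' (characterV ch) (characterV cp)) => //.
  - move=> x y h; apply: indep; rewrite -[LHS]invrK invfM h invr1 //.
  - apply: (dilation_embedding (characterV ch) _ sKE sgE' f1E).
    by rewrite characterN // invrK.
  apply: (dilation_embedding (characterV cp) _ tKE tgE' f1E).
  by rewrite characterN // invrK.
have [b0 b0P] := exists_val_ge (f0 (tofrac d)); have [b1 b1P] := exists_val_ge (f1 (tofrac d)).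
have [N0 N0P] := exists_bound (- (b0 + a0)); have [N1 N1P] := exists_bound (- (b1 + a1)).
pose N := maxn N0 N1.
have fX (f : {rmorphism K -> L}) (u : rat) m : u != 0 -> (forall (g : {poly F}) x, f (tofrac g) x =
    \sum_(i < size g) (if x == i%:R * u then g`_i else 0)) -> f (tofrac 'X^m) = pmonom 1 (m%:R * u).
  move=> u0 fE; apply: puiseuxP => x; rewrite fE pmonom_coef size_polyXn big_ord_recr /=.
  rewrite big1 ?add0r => [|i _]; first by rewrite coefXn eqxx.
  by rewrite coefXn (ltn_eqF (ltn_ord i)); case: ifP.
have poly k i : exists2 g : {poly F}, (size g <= (N + N).+1)%N &
    tofrac d * iter k s v 0 i * tofrac 'X^N = tofrac g.
  apply: (laurent_bounded (f0 := f0) (f1 := f1)) => //.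
  - by move=> m; rewrite (fX f0 1) ?mulr1.
  - by move=> m; rewrite (fX f1 (-1)) // mulrN mulr1.
  - by move=> a an0; have := dP _ (gk k) a an0 0 i; rewrite mxE.
  - rewrite rmorphM; apply: (@val_ge_le _ _ (b0 + a0)).
      rewrite lerNl; apply: le_trans (ltW N0P) _; by rewrite ler_nat leq_maxl.
    by apply: val_geM => //; have := a0P k i; rewrite mxE.
  rewrite rmorphM; apply: (@val_ge_le _ _ (b1 + a1)).
    rewrite lerNl; apply: le_trans (ltW N1P) _; by rewrite ler_nat leq_maxr.
  by apply: val_geM => //; have := a1P k i; rewrite mxE.
have [g gP] := choice (fun ki : nat * 'I_r => (let: ex_intro2 g a b := poly ki.1 ki.2 in
  ex_intro (fun g : {poly F} => (size g <= (N + N).+1)%N /\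
    tofrac d * iter ki.1 s v 0 ki.2 * tofrac 'X^N = tofrac g) g (conj a b))).
(* Each of the r entries has 2N + 1 coefficients, so n + 1 iterates are linearly dependent over
   F. *)
pose n := (r * (N + N).+1)%N.
pose M : 'M[F]_(n.+1, n) := \matrix_(k < n.+1) mxvec (\matrix_(i < r, l < (N + N).+1) (g (val k, i))`_l).
have : kermx M != 0.
  by rewrite -mxrank_eq0 mxrank_ker subn_eq0 -ltnNge; apply: leq_ltn_trans (rank_leq_col _) _.
case/rowV0Pn => x /sub_kermxP xM x0.
pose f := \poly_(k < n.+1) x 0 (inord k).
exists f.
  apply: contraNneq x0 => f00; apply/eqP/rowP => k; have := congr1 (fun h : {poly F} => h`_k) f00.
  by rewrite coef_poly ltn_ord inord_val coef0 mxE.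
have -> : \sum_(k < size f) tofrac (f`_k)%:P *: iter k s v =
    \sum_(k < n.+1) tofrac (x 0 k)%:P *: iter k s v.
  rewrite (big_ord_widen n.+1 (fun k => tofrac (f`_k)%:P *: iter k s v)) ?size_poly //.
  rewrite big_mkcond; apply: eq_bigr => k _; case: ltnP => [_|fk].
    by rewrite coef_poly ltn_ord inord_val.
  have := nth_default 0 fk; rewrite coef_poly ltn_ord inord_val => ->.
  by rewrite polyC0 rmorph0 scale0r.
apply/rowP => i; rewrite summxE mxE.
have dX0 : tofrac d * tofrac 'X^N != 0.
  by rewrite mulf_neq0 ?tofrac_eq0 // -size_poly_eq0 size_polyXn.
apply: (mulfI dX0); rewrite mulr0 mulr_sumr.
have term (k : 'I_n.+1) : tofrac d * tofrac 'X^N * (tofrac (x 0 k)%:P *: iter k s v) 0 i =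
    tofrac ((x 0 k)%:P * g (val k, i)).
  rewrite mxE rmorphM /= -(proj2 (gP (val k, i))) /=.
  by rewrite mulrCA; congr (_ * _); rewrite mulrAC.
under eq_bigr do rewrite term.
rewrite -rmorph_sum /= -(rmorph0 tofrac); congr tofrac; apply/polyP => l.
rewrite coef_sum coef0; under eq_bigr do rewrite coefCM.
have [lN|Nl] := ltnP l (N + N).+1; last first.
  by apply: big1 => k _; rewrite nth_default ?mulr0 // (leq_trans (proj1 (gP (val k, i)))).
have := congr1 (fun y : 'rV_n => y 0 (mxvec_index i (Ordinal lN))) xM.
move=> h; rewrite [LHS]mxE [RHS]mxE in h; apply: etrans h; apply: eq_bigr => k _.
by rewrite mxE mxvecE mxE.
Qed.

(** Constants commute with s, so F[X] acts on v with X acting as s. If f is an annihilator of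
    minimal degree and mu a root of f, then f / (X - mu) sends v to a nonzero eigenvector. *)
Lemma consistent_eigenvector : (0 < r)%N ->
  exists (v : 'rV[K]_r) (mu : K), v != 0 /\ map_mx sK v *m P = mu *: v.
Proof.
move=> r_gt0; have [_ /(_ r_gt0)[v v0 gv]] := global_sections.
pose act (f : {poly F}) := \sum_(k < size f) tofrac (f`_k)%:P *: iter k s v.
have actE (f : {poly F}) n : (size f <= n)%N ->
    act f = \sum_(k < n) tofrac (f`_k)%:P *: iter k s v.
  move=> fn; rewrite /act (big_ord_widen n (fun k => tofrac (f`_k)%:P *: iter k s v)) //.
  rewrite big_mkcond; apply: eq_bigr => k _; case: ltnP => // fk.
  by rewrite nth_default // polyC0 rmorph0 scale0r.
pose R k := `[< exists2 f : {poly F}, f != 0 & act f = 0 /\ size f = k >].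
have exR : exists k, R k.
  by have [f f0 fv] := polynomial_relation gv; exists (size f); apply/asboolP; exists f.
case: (ex_minnP exR) => k /asboolP[f f0 [fv sf]] mink.
have [|mu rmu] := @closed_rootP F f _.
  apply/eqP => s1; move: fv; rewrite (actE f 1) ?s1 // big_ord_recl big_ord0 addr0 /=.
  move/eqP; rewrite scaler_eq0 (negPf v0) orbF tofrac_eq0 polyC_eq0.
  by apply/negP; move: f0; rewrite -lead_coef_eq0 lead_coefE s1.
have [g gE] := factor_theorem _ _ rmu.
have g0 : g != 0 by apply: contraNneq f0 => h; rewrite gE h mul0r.
have sg : size f = (size g).+1.
  by rewrite gE size_Mmonic ?monicXsubC // size_XsubC addn2.
exists (act g), (tofrac mu%:P); split.
  apply/eqP => ag; have /mink : R (size g) by apply/asboolP; exists g.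
  by rewrite -sf sg ltnn.
have sact : s (act g) = \sum_(k < size g) tofrac (g`_k)%:P *: iter k.+1 s v.
  rewrite /act /s map_mx_sum mulmx_suml; apply: eq_bigr => i _.
  by rewrite map_mxZ -scalemxAl sKE comp_polyC.
rewrite -/(s (act g)) sact; apply/eqP; rewrite -subr_eq0; apply/eqP; rewrite -[RHS]fv.
rewrite (actE f (size g).+1) ?sg // (actE g (size g).+1) // scaler_sumr.
have -> : \sum_(k < size g) tofrac (g`_k)%:P *: iter k.+1 s v =
    \sum_(k < (size g).+1) tofrac (('X * g)`_k)%:P *: iter k s v.
  rewrite big_ord_recl coefXM polyC0 rmorph0 scale0r add0r.
  by apply: eq_bigr => i _; rewrite coefXM.
rewrite -sumrB; apply: eq_bigr => i _.
rewrite scalerA -scalerBl -rmorphM -rmorphB /= -polyCM -polyCB; congr (tofrac _%:P *: _).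
by rewrite gE mulrBr coefB coefMC [g * 'X]mulrC [mu * _]mulrC.
Qed.
End Consistent.

(** * Sequences induced by derivations *)

Lemma iter_cancel (T : Type) (f f' : T -> T) k : cancel f f' -> cancel (iter k f) (iter k f').
Proof. by move=> fK; elim: k => // k IH x; rewrite iterSr iterS fK IH. Qed.

Lemma iter_commute (T : Type) (f h : T -> T) k x : (forall x, f (h x) = h (f x)) ->
  f (iter k h x) = iter k h (f x).
Proof. by move=> fh; elim: k => //= k <-; rewrite fh. Qed.

Section InducedSequences.
Variables (K L : fieldType) (iota : {rmorphism K -> L}).
Variables (sK sK' tK tK' : {rmorphism K -> K}) (sg sg' tg tg' : {rmorphism L -> L}).
Hypotheses (sKK : cancel sK sK') (sKK' : cancel sK' sK) (tKK : cancel tK tK').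
Hypotheses (sgK : cancel sg sg') (sgK' : cancel sg' sg) (tgK : cancel tg tg')
  (tgK' : cancel tg' tg).
Hypotheses (sgi : forall k, sg (iota k) = iota (sK k))
  (tgi : forall k, tg (iota k) = iota (tK k)) (tg'i : forall k, tg' (iota k) = iota (tK' k)).
Hypotheses (stg : forall x, sg (tg x) = tg (sg x))
  (stK' : forall x, sK (tK' x) = tK' (sK x)).
Variables (n : nat) (A A' : 'M[K]_n) (g : L).
Hypothesis AA' : A *m A' = 1%:M.

Definition orbit_col : 'cV[L]_n := \col_i iter i sg g.
Let Y k : 'cV[L]_n := map_mx (iter k tg) orbit_col.
Let Ak k : 'M[K]_n := map_mx (iter k tK) A.
Let A'k k : 'M[K]_n := map_mx (iter k tK) A'.

Hypothesis sY0 : map_mx sg orbit_col = map_mx iota A *m orbit_col.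

Definition field_derivation (delta : L -> L) : Prop :=
  derivation delta /\ forall k, delta (iota k) = 0.
Local Notation der := field_derivation.

Variable m : nat.
(** [forward] and [backward] are the recursions of order m that an algebraic relation between the
    tau^k g imposes on every derivation. *)
Hypothesis forward : forall delta, der delta ->
  (forall i, (i < m)%N -> delta (iter i tg g) = 0) -> delta (iter m tg g) = 0.
Hypothesis backward : forall delta, der delta ->
  (forall i, (i < m)%N -> delta (iter i.+1 tg g) = 0) -> delta g = 0.
Hypothesis entries_free : forall r : 'rV[K]_n, map_mx iota r *m orbit_col = 0 -> r = 0.
Hypothesis no_line : forall (M : 'M[K]_n) mu, \tr M = 0 ->
  map_mx sK M *m A = mu *: (A *m M) -> M = 0.
Hypothesis lie_nonzero : forall M, exists (a : nat -> 'M[K]_n) (delta : L -> L),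
  [/\ derivation delta, forall k, delta (iota k) = 0,
      forall i, (i <= M)%N -> map_mx delta (Y i) = map_mx iota (a i) *m Y i,
      forall i, \tr (a i) = 0 & a 0%N != 0].
Hypothesis eigenvector : forall r (P P' Q Q' : 'M[K]_r), P *m P' = 1%:M ->
  Q *m Q' = 1%:M -> map_mx sK Q *m P = map_mx tK' P *m Q -> (0 < r)%N ->
  exists (v : 'rV[K]_r) (mu : K), v != 0 /\ map_mx sK v *m P = mu *: v.

Lemma field_derivation_conj delta (h h' : {rmorphism L -> L}) (f : K -> K) :
  cancel h h' -> (forall k, h (iota k) = iota (f k)) -> der delta ->
  der (fun x => h' (delta (h x))).
Proof.
move=> hK hi [[dD dM] dK]; split; last by move=> k; rewrite hi dK rmorph0.
by split=> x y; rewrite ?rmorphD ?dD ?rmorphD // rmorphM dM rmorphD !rmorphM !hK.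
Qed.

Lemma field_derivation_conj_iter k delta (h h' : {rmorphism L -> L}) (f : K -> K) :
  cancel h h' -> (forall k, h (iota k) = iota (f k)) -> der delta ->
  der (fun x => iter k h' (delta (iter k h x))).
Proof.
move=> hK hi; elim: k delta => // k IH delta dd.
have := IH _ (field_derivation_conj hK hi dd).
by congr der; apply/funext => x; rewrite -iterSr.
Qed.

Lemma field_derivation_lin k d1 d2 : der d1 -> der d2 ->
  der (fun x => iota k * d1 x + d2 x).
Proof.
move=> [[D1 M1] K1] [[D2 M2] K2]; split; last by move=> x; rewrite K1 K2 mulr0 addr0.
by split=> x y; rewrite ?D1 ?D2 ?M1 ?M2; ring.
Qed.

Let itgstg k x i : iter k tg (iter i sg x) = iter i sg (iter k tg x).
Proof.
by elim: k => //= k ->; apply: iter_commute => y; rewrite stg.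
Qed.

(** Conjugating by tau^(k-m) moves the window of the recursion to any place; the conjugate is again
    a derivation trivial on K. *)
Lemma forward_all delta : der delta -> (forall i, (i < m)%N -> delta (iter i tg g) = 0) ->
  forall k, delta (iter k tg g) = 0.
Proof.
move=> dd dm; elim/ltn_ind => k IH; have [km|mk] := ltnP k m; first exact: dm.
have := forward (field_derivation_conj_iter (k - m) tgK tgi dd).
rewrite -iterD subnK // => H.
have {}H : iter (k - m) tg' (delta (iter k tg g)) = 0.
  apply: H => i im; rewrite -iterD IH; last by lia.
  by elim: (k - m)%N => //= k' ->; rewrite rmorph0.
rewrite -(iter_cancel (k - m) tgK' (delta _)) H.
by elim: (k - m)%N => //= k' ->; rewrite rmorph0.
Qed.

Let iter_eq0 i (h : {rmorphism L -> L}) x : iter i h x = 0 -> x = 0.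
Proof.
elim: i => //= i IH h0; apply: IH; apply: (fmorph_inj h).
by rewrite h0 rmorph0.
Qed.

Let entryE k (i : 'I_n) : Y k i 0 = iter k tg (iter i sg g).
Proof. by rewrite !mxE. Qed.

Lemma kill_all delta : der delta -> (forall k, (k < m)%N -> map_mx delta (Y k) = 0) ->
  forall k, map_mx delta (Y k) = 0.
Proof.
move=> dd dm k; apply/matrixP => i l; rewrite ord1 mxE entryE mxE itgstg.
apply: (iter_eq0 (i := i) (h := sg')).
apply: (forward_all (field_derivation_conj_iter i sgK sgi dd)) => a am.
have := congr1 (fun M : 'cV_n => M i 0) (dm a am); rewrite mxE entryE mxE itgstg => ->.
by elim: (val i) => //= k' ->; rewrite rmorph0.
Qed.

Lemma kill_first delta : der delta -> (forall k, (k < m)%N -> map_mx delta (Y k.+1) = 0) ->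
  map_mx delta (Y 0%N) = 0.
Proof.
move=> dd dm; apply/matrixP => i l; rewrite ord1 mxE entryE mxE /=.
apply: (iter_eq0 (i := i) (h := sg')).
apply: (backward (field_derivation_conj_iter i sgK sgi dd)) => a am.
have := congr1 (fun M : 'cV_n => M i 0) (dm a am); rewrite mxE entryE mxE itgstg => ->.
by elim: (val i) => //= k' ->; rewrite rmorph0.
Qed.

Let iter_tgi k x : iter k tg (iota x) = iota (iter k tK x).
Proof. by elim: k => //= k ->. Qed.

Let iter_tg'i k x : iter k tg' (iota x) = iota (iter k tK' x).
Proof. by elim: k => //= k ->. Qed.

Lemma iter_rmorphism (R : nzRingType) k (h : {rmorphism R -> R}) :
  exists f : {rmorphism R -> R}, f =1 iter k h.
Proof.
elim: k => [|k [f fE]]; first by exists idfun.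
by exists (h \o f) => x /=; rewrite fE.
Qed.

Lemma orbit_mx_free k (B : 'M[K]_n) : map_mx iota B *m Y k = 0 -> B = 0.
Proof.
move=> BY; apply/row_matrixP => i; rewrite row0.
have [f' f'E] := iter_rmorphism k tg'.
have h : map_mx iota (map_mx (iter k tK') (row i B)) *m orbit_col = 0.
  have := congr1 (fun M => row i (map_mx f' M)) BY.
  rewrite map_mxM row_mul map_mx0 row0 -[RHS](map_mx0 f') => e.
  rewrite -[RHS](map_mx0 f') -e; congr (_ *m _).
    by apply/matrixP => a b; rewrite !mxE f'E iter_tg'i.
  by apply/matrixP => a b; rewrite !mxE f'E (iter_cancel k tgK).
have := entries_free h; move=> r0; apply/matrixP => a b.
have := congr1 (fun M : 'rV_n => M a b) r0; rewrite !mxE => e0.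
have [f fE] := iter_rmorphism k tK'.
by apply: (fmorph_inj f); rewrite fE e0 rmorph0.
Qed.

Implicit Types (a b : nat -> 'M[K]_n).

(** The derivation may depend on M, as a tower contains fundamental matrices of finitely many
    systems only. *)
Definition lie_sequence a : Prop := (forall i, \tr (a i) = 0) /\
  forall M, exists delta, der delta /\
    forall k, (k <= M)%N -> map_mx delta (Y k) = map_mx iota (a k) *m Y k.

Lemma lie_sequence_lin x a b : lie_sequence a -> lie_sequence b ->
  lie_sequence (fun k => x *: a k + b k).
Proof.
move=> [ta la] [tb lb]; split=> [i|M]; first by rewrite raddfD /= mxtraceZ ta tb mulr0 addr0.
have [d1 [dd1 d1Y]] := la M; have [d2 [dd2 d2Y]] := lb M.
exists (fun z => iota x * d1 z + d2 z); split; first exact: field_derivation_lin.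
move=> k kM; rewrite map_mxD map_mxZ mulmxDl -scalemxAl -d1Y // -d2Y //.
by apply/matrixP => i l; rewrite !mxE.
Qed.

Lemma lie_sequence0 : lie_sequence (fun=> 0).
Proof.
split=> [i|M]; first by rewrite raddf0.
exists (fun=> 0); split; first by split=> //; split=> x y; rewrite ?addr0 // mulr0 mul0r addr0.
by move=> k _; rewrite map_mx0 mul0mx; apply/matrixP => i l; rewrite !mxE.
Qed.

Lemma orbit_equation k : map_mx sg (Y k) = map_mx iota (Ak k) *m Y k.
Proof.
have [f fE] := iter_rmorphism k tg.
have -> : map_mx sg (Y k) = map_mx f (map_mx sg orbit_col).
  by apply/matrixP => i l; rewrite !mxE fE; apply: iter_commute.
rewrite sY0 map_mxM; congr (_ *m _); last by apply/matrixP => i l; rewrite !mxE fE.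
by apply/matrixP => i l; rewrite !mxE fE iter_tgi.
Qed.

Lemma orbit_inverse k : Ak k *m A'k k = 1%:M.
Proof.
have [f fE] := iter_rmorphism k tK.
have mapE (M : 'M[K]_n) : map_mx (iter k tK) M = map_mx f M.
  by apply/matrixP => i l; rewrite !mxE fE.
by rewrite /Ak /A'k !mapE -map_mxM AA' map_mx1.
Qed.

Definition conj_sequence a k : 'M[K]_n := A'k k *m map_mx sK (a k) *m Ak k.
Definition shift_sequence a k : 'M[K]_n := map_mx tK' (a k.+1).

(** This is the sequence of the conjugate derivation sg delta sg^-1, computed from sg^-1 Y_k =
    sigma^-1(A_k^-1) Y_k. *)
Lemma conj_sequence_lie a : lie_sequence a -> lie_sequence (conj_sequence a).
Proof.
move=> [ta la]; split=> [i|M].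
  rewrite /conj_sequence mxtrace_mulC mulmxA orbit_inverse mul1mx trace_map_mx ta.
  exact: rmorph0.
have [d [dd dY]] := la M.
have sg'i k : sg' (iota k) = iota (sK' k) by apply: (can_inj sgK); rewrite sgK' sgi sKK'.
exists (fun x => sg (d (sg' x))); split; first exact: (field_derivation_conj sgK' sg'i dd).
move=> k kM.
have s'Y : map_mx sg' (Y k) = map_mx iota (map_mx sK' (A'k k)) *m Y k.
  have e : map_mx sg' (map_mx sg (Y k)) = Y k by apply/matrixP => i l; rewrite !mxE sgK.
  have e' : map_mx iota (map_mx sK' (Ak k)) *m map_mx sg' (Y k) = Y k.
    rewrite -[RHS]e orbit_equation map_mxM; congr (_ *m _).
    by apply/matrixP => i l; rewrite !mxE sg'i.
  rewrite -[in RHS]e' mulmxA -!map_mxM (mulmx1C (orbit_inverse k)).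
  by rewrite !map_mx1 mul1mx.
have -> : map_mx (fun x => sg (d (sg' x))) (Y k) = map_mx sg (map_mx d (map_mx sg' (Y k))).
  by apply/matrixP => i l; rewrite !mxE.
rewrite s'Y derivation_mulmx; last by case: dd.
have -> : map_mx d (map_mx iota (map_mx sK' (A'k k))) = 0.
  by apply/matrixP => i l; rewrite !mxE; case: dd => _ ->.
rewrite mul0mx add0r dY // /conj_sequence !map_mxM orbit_equation !mulmxA.
congr (_ *m _ *m _ *m _); apply/matrixP => i l; rewrite !mxE sgi ?sKK' //.
Qed.

Lemma shift_sequence_lie a : lie_sequence a -> lie_sequence (shift_sequence a).
Proof.
move=> [ta la]; split=> [i|M]; first by rewrite /shift_sequence trace_map_mx ta; exact: rmorph0.
have [d [dd dY]] := la M.+1.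
exists (fun x => tg' (d (tg x))); split; first exact: (field_derivation_conj tgK tgi dd).
move=> k kM.
have -> : map_mx (fun x => tg' (d (tg x))) (Y k) = map_mx tg' (map_mx d (Y k.+1)).
  by apply/matrixP => i l; rewrite !mxE.
rewrite dY // map_mxM /shift_sequence; congr (_ *m _).
  by apply/matrixP => i l; rewrite !mxE tg'i.
by apply/matrixP => i l; rewrite !mxE /= tgK.
Qed.

Lemma conj_shift_sequence a k :
  conj_sequence (shift_sequence a) k = shift_sequence (conj_sequence a) k.
Proof.
rewrite /conj_sequence /shift_sequence !map_mxM; congr (_ *m _ *m _).
- by apply/matrixP => i l; rewrite !mxE /= tKK.
- by apply/matrixP => i l; rewrite !mxE stK'.
by apply/matrixP => i l; rewrite !mxE /= tKK.
Qed.

Lemma lie_sequence_inj a : lie_sequence a -> (forall k, (k < m)%N -> a k = 0) ->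
  forall k, a k = 0.
Proof.
move=> [_ la] am k; have [d [dd dY]] := la (maxn k m).
apply: (@orbit_mx_free k); rewrite -dY ?leq_maxl //; apply: (kill_all dd) => l lm.
by rewrite dY ?am ?map_mx0 ?mul0mx // leq_max (ltnW lm) orbT.
Qed.

(** The shift loses only the term of index 0, which the backward recursion recovers. *)
Lemma shift_sequence_inj a : lie_sequence a -> (forall k, shift_sequence a k = 0) ->
  forall k, a k = 0.
Proof.
move=> la sa; have aS k : a k.+1 = 0.
  apply/matrixP => i l; have := congr1 (fun M : 'M_n => M i l) (sa k); rewrite !mxE => h.
  by apply: (fmorph_inj tK'); rewrite h rmorph0.
have [_ /(_ m)[d [dd dY]]] := la.
case=> [|k]; last exact: aS.
apply: (@orbit_mx_free 0); rewrite -dY //; apply: (kill_first dd) => l lm.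
by rewrite dY // aS map_mx0 mul0mx.
Qed.

Lemma conj_sequence_inj a k : conj_sequence a k = 0 -> a k = 0.
Proof.
move=> /(congr1 (fun M => Ak k *m M *m A'k k)).
rewrite /conj_sequence !mulmxA orbit_inverse mul1mx -mulmxA orbit_inverse mulmx1 mulmx0 mul0mx => h.
apply/matrixP => i l; have := congr1 (fun M : 'M_n => M i l) h; rewrite !mxE => e.
by apply: (fmorph_inj sK); rewrite e rmorph0.
Qed.

(** m terms determine a sequence; one more is recorded so that the term of index 0 is visible even
    for m = 0. *)
Let D := (m.+1 * (n * n))%N.

Definition encode a : 'rV[K]_D := mxvec (\matrix_(k < m.+1, l < n * n) mxvec (a k) 0 l).

Lemma encode_inj a b : encode a = encode b -> forall k, (k < m.+1)%N -> a k = b k.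
Proof.
move=> /(can_inj mxvecK) /matrixP e k km; apply: (can_inj mxvecK); apply/rowP => l.
by have := e (Ordinal km) l; rewrite !mxE.
Qed.

Lemma encode_lin x a b : encode (fun k => x *: a k + b k) = x *: encode a + encode b.
Proof.
rewrite /encode -linearP; congr mxvec; apply/matrixP => k l; rewrite !mxE linearP /=.
by rewrite !mxE.
Qed.

Lemma encode0 : encode (fun=> 0) = 0.
Proof.
rewrite -[RHS](addNr (encode (fun=> 0))) -scaleN1r -encode_lin.
by congr encode; apply/funext => k; rewrite scaler0 addr0.
Qed.

(* The truncated spaces form a decreasing sequence of nonzero subspaces of a
   finite-dimensional space; truncated solutions with the same first terms agree. *)
Lemma lie_sequence_nonzero : exists a, lie_sequence a /\ exists k, a k != 0.
Proof.
pose trunc M a := (forall i, \tr (a i) = 0) /\ exists delta, der delta /\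
    forall k, (k <= M)%N -> map_mx delta (Y k) = map_mx iota (a k) *m Y k.
pose W M := [set v : 'rV[K]_D | exists2 a, trunc M a & v = encode a].
have trunc_lin M x a b : trunc M a -> trunc M b -> trunc M (fun k => x *: a k + b k).
  move=> [ta [d1 [dd1 d1Y]]] [tb [d2 [dd2 d2Y]]]; split=> [i|].
    by rewrite raddfD /= mxtraceZ ta tb mulr0 addr0.
  exists (fun z => iota x * d1 z + d2 z); split; first exact: field_derivation_lin.
  move=> k kM; rewrite map_mxD map_mxZ mulmxDl -scalemxAl -d1Y // -d2Y //.
  by apply/matrixP => i l; rewrite !mxE.
have W0 M : W M 0.
  exists (fun=> 0); last by rewrite encode0.
  by have [t0 l0] := lie_sequence0; split=> //; exact: l0.
have WL M x u v : W M u -> W M v -> W M (x *: u + v).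
  move=> [a la ->] [b lb ->]; exists (fun k => x *: a k + b k); first exact: trunc_lin.
  by rewrite encode_lin.
have Wmx M := subspace_matrix (W0 M) (WL M).
pose R r := `[< exists M (B : 'M[K]_(r, D)), row_free B /\ forall v, W M v <-> (v <= B)%MS >].
have exR : exists r, R r.
  by have [r [B BP]] := Wmx 0%N; exists r; apply/asboolP; exists 0%N, B.
case: (ex_minnP exR) => r /asboolP[M1 [B [fB BP]]] minr.
have Wsub M M' : (M <= M')%N -> W M' `<=` W M.
  move=> MM' v [a [ta [d [dd dY]]] ->]; exists a => //; split=> //; exists d; split=> // k kM.
  by apply: dY; apply: leq_trans MM'.
have stable M v : (M1 <= M)%N -> W M1 v -> W M v.
  move=> MM1; have [r' [B' [fB' B'P]]] := Wmx M.
  have rr' : (r <= r')%N by apply: minr; apply/asboolP; exists M, B'.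
  have BB' : (B' <= B)%MS.
    by apply/row_subP => i; apply/BP/(Wsub _ _ MM1)/B'P; exact: row_sub.
  have [_] := mxrank_leqif_sup BB'.
  have rB : \rank B = r by apply/eqP.
  have rB' : \rank B' = r' by apply/eqP.
  rewrite rB rB'; have r'r : (r' <= r)%N by have := mxrankS BB'; rewrite rB rB'.
  rewrite eqn_leq rr' r'r => /esym BB; move=> /BP vB; apply/B'P.
  exact: submx_trans vB BB.
have [a0 [d0 [dd0 dK0 dY0 ta0 a00]]] := lie_nonzero M1.
have Wa0 : W M1 (encode a0) by exists a0 => //; split=> //; exists d0; split.
(* A truncation up to M + m contains the first m terms, which determine the others; so the choices
   for different M agree where they overlap and form one sequence. *)
have all M : exists a, trunc (maxn (M + m) M1) a /\ encode a = encode a0.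
  by have [a la ->] := stable _ _ (leq_maxr (M + m) M1) Wa0; exists a.
have [aa aP] := choice all.
have agree M M' k : (k <= M)%N -> (k <= M')%N -> aa M k = aa M' k.
  move=> kM kM'; have [[_ [d [dd dY]]] e] := aP M; have [[_ [d' [dd' dY']]] e'] := aP M'.
  apply/eqP; rewrite -subr_eq0; apply/eqP.
  have e1 l : (l < m.+1)%N -> aa M l = aa M' l by apply: encode_inj; rewrite e e'.
  have ddd := field_derivation_lin (-1) dd' dd.
  have dYl l : (l <= maxn (M + m) M1)%N -> (l <= maxn (M' + m) M1)%N ->
      map_mx (fun x => iota (-1) * d' x + d x) (Y l) = map_mx iota (aa M l - aa M' l) *m Y l.
    move=> l1 l2; rewrite map_mxB mulmxBl -dY // -dY' //.
    by apply/matrixP => i z; rewrite !mxE rmorphN1 mulN1r addrC.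
  have le l : (l <= M)%N -> (l <= maxn (M + m) M1)%N.
    by move=> lM; rewrite leq_max (leq_trans lM) // leq_addr.
  have lm l : (l < m)%N -> forall M0, (l <= maxn (M0 + m) M1)%N.
    by move=> lm M0; rewrite leq_max (leq_trans (ltnW lm)) // leq_addl.
  apply: (@orbit_mx_free k); rewrite -dYl.
  - apply: (kill_all ddd) => l l_m; rewrite dYl; try exact: lm.
    by rewrite e1 ?subrr ?map_mx0 ?mul0mx // ltnS ltnW.
  - exact: le.
  by rewrite leq_max (leq_trans kM') // leq_addr.
exists (fun k => aa k k); split.
  split=> [i|M]; first by have [[]] := aP i.
  have [[_ [d [dd dY]]] _] := aP M; exists d; split=> // k kM.
  rewrite dY; last by rewrite leq_max (leq_trans kM) // leq_addr.
  by rewrite (agree M k k kM (leqnn _)).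
exists 0%N; have [_ e] := aP 0%N.
by rewrite (encode_inj e).
Qed.

(* On the finite-dimensional space of the sequences, conjugation and shift are given
   by a consistent pair of matrices P and Q; an eigenvector is a sequence whose terms
   span lines excluded by no_line. *)
Lemma recursive_orbit_absurd : False.
Proof.
pose W := [set v : 'rV[K]_D | exists2 a, lie_sequence a & v = encode a].
have W0 : W 0 by exists (fun=> 0); [exact: lie_sequence0|rewrite encode0].
have WL x u v : W u -> W v -> W (x *: u + v).
  move=> [a la ->] [b lb ->]; exists (fun k => x *: a k + b k); first exact: lie_sequence_lin.
  by rewrite encode_lin.
have [r [B [fB BP]]] := subspace_matrix W0 WL.
have exb (i : 'I_r) : exists a, lie_sequence a /\ encode a = row i B.
  by have [|a la ->] := proj2 (BP (row i B)); [exact: row_sub|exists a].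
have [b bP] := choice exb.
pose comb (x : 'rV[K]_r) k : 'M[K]_n := \sum_i x 0 i *: b i k.
have comb_seq (l : seq 'I_r) (x : 'I_r -> K) : lie_sequence (fun k => \sum_(i <- l) x i *: b i k) /\
    encode (fun k => \sum_(i <- l) x i *: b i k) = \sum_(i <- l) x i *: encode (b i).
  elim: l => [|i l [l1 l2]].
    have -> : (fun k => \sum_(i <- [::]) x i *: b i k) = (fun=> 0).
      by apply/funext => k; rewrite big_nil.
    by rewrite big_nil encode0; split=> //; exact: lie_sequence0.
  have -> : (fun k => \sum_(i <- i :: l) x i *: b i k) =
      (fun k => x i *: b i k + \sum_(i <- l) x i *: b i k).
    by apply/funext => k; rewrite big_cons.
  rewrite big_cons encode_lin l2; split=> //; apply: lie_sequence_lin => //.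
  by have [] := bP i.
have comb_lie x : lie_sequence (comb x) by have [] := comb_seq (index_enum _) (fun i => x 0 i).
have comb_enc x : encode (comb x) = x *m B.
  have [_ ->] := comb_seq (index_enum _) (fun i => x 0 i).
  by rewrite mulmx_sum_row; apply: eq_bigr => i _; have [_ ->] := bP i.
have enc0 a : lie_sequence a -> encode a = 0 -> forall k, a k = 0.
  move=> la ea; apply: lie_sequence_inj => // k km.
  by rewrite (@encode_inj a (fun=> 0)) ?encode0 // ltnW.
have lie_eq a a' : lie_sequence a -> lie_sequence a' -> encode a = encode a' ->
    forall k, a k = a' k.
  move=> la la' ee k; apply/eqP; rewrite -subr_eq0 addrC -scaleN1r; apply/eqP.
  apply: (enc0 (fun k => (-1) *: a' k + a k)); first exact: lie_sequence_lin.
  by rewrite encode_lin ee scaleN1r addNr.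
have comb_surj a : lie_sequence a -> exists x, forall k, a k = comb x k.
  move=> la; have /BP/submxP[x ex] : W (encode a) by exists a.
  by exists x; apply: lie_eq => //; rewrite comb_enc.
have comb_inj x : (forall k, comb x k = 0) -> x = 0.
  move=> x0; have : encode (comb x) = 0.
    by rewrite (_ : comb x = fun=> 0) ?encode0 //; apply/funext.
  rewrite comb_enc => xB; apply: (row_free_inj fB); by rewrite xB mul0mx.
have [a1 [la1 [k1 ak1]]] := lie_sequence_nonzero.
have r_gt0 : (0 < r)%N.
  rewrite lt0n; apply: contraNneq ak1 => r0; have [x xE] := comb_surj _ la1.
  rewrite xE /comb big1 // => i _; by have := ltn_ord i; rewrite {2}r0.
have [PP PE] := choice (fun i => comb_surj _ (conj_sequence_lie (proj1 (bP i)))).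
have [QQ QE] := choice (fun i => comb_surj _ (shift_sequence_lie (proj1 (bP i)))).
pose P : 'M[K]_r := \matrix_i PP i; pose Q : 'M[K]_r := \matrix_i QQ i.
have combD x (f : K -> K) (E : (nat -> 'M[K]_n) -> nat -> 'M[K]_n) (M : 'M[K]_r) k :
    (E (comb x) k = \sum_i f (x 0 i) *: E (b i) k) ->
    (forall i, E (b i) k = comb (row i M) k) -> E (comb x) k = comb (map_mx f x *m M) k.
  move=> -> Eb; rewrite /comb; under eq_bigr do rewrite Eb /comb scaler_sumr.
  rewrite exchange_big; apply: eq_bigr => l _ /=; rewrite mxE scaler_suml.
  by apply: eq_bigr => i _; rewrite !mxE scalerA.
have conjE x k : conj_sequence (comb x) k = comb (map_mx sK x *m P) k.
  apply: combD => [|i]; last by rewrite PE /P rowK.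
  rewrite /conj_sequence /comb map_mx_sum mulmx_sumr mulmx_suml; apply: eq_bigr => i _.
  by rewrite map_mxZ -scalemxAr -scalemxAl.
have shiftE x k : shift_sequence (comb x) k = comb (map_mx tK' x *m Q) k.
  apply: combD => [|i]; last by rewrite QE /Q rowK.
  rewrite /shift_sequence /comb map_mx_sum; apply: eq_bigr => i _.
  by rewrite map_mxZ.
have unit_of (M : 'M[K]_r) : (forall x : 'rV_r, x *m M = 0 -> x = 0) -> M *m invmx M = 1%:M.
  move=> inj; apply: mulmxV; rewrite -row_free_unit -kermx_eq0; apply/eqP/row_matrixP => i.
  by rewrite row0; apply: inj; apply/sub_kermxP; exact: row_sub.
have PV : P *m invmx P = 1%:M.
  apply: unit_of => x xP; have xE : x = map_mx sK (map_mx sK' x).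
    by apply/matrixP => i l; rewrite !mxE sKK'.
  suff x0 : map_mx sK' x = 0 by rewrite xE x0 map_mx0.
  apply: comb_inj => k; apply: conj_sequence_inj; rewrite conjE -xE xP /comb.
  by rewrite big1 // => i _; rewrite mxE scale0r.
have QV : Q *m invmx Q = 1%:M.
  apply: unit_of => x xQ; have xE : x = map_mx tK' (map_mx tK x).
    by apply/matrixP => i l; rewrite !mxE tKK.
  suff x0 : map_mx tK x = 0 by rewrite xE x0 map_mx0.
  apply: comb_inj; apply: (shift_sequence_inj (comb_lie _)) => k; rewrite shiftE -xE xQ /comb.
  by rewrite big1 // => i _; rewrite mxE scale0r.
have combB x y k : comb (x - y) k = comb x k - comb y k.
  by rewrite /comb -sumrB; apply: eq_bigr => i _; rewrite !mxE scalerBl.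
have comm : map_mx sK Q *m P = map_mx tK' P *m Q.
  apply/row_matrixP => i; rewrite !row_mul; apply/eqP; rewrite -subr_eq0; apply/eqP.
  apply: comb_inj => k; rewrite combB; apply/eqP; rewrite subr_eq0; apply/eqP.
  have dE (f : {rmorphism K -> K}) : map_mx f (delta_mx 0 i : 'rV[K]_r) = delta_mx 0 i.
    by apply/matrixP => u w; rewrite !mxE; case: (_ && _); rewrite ?rmorph1 ?rmorph0.
  have dc : conj_sequence (comb (delta_mx 0 i : 'rV[K]_r)) = comb (row i P).
    by apply/funext => l; rewrite conjE dE rowE.
  have ds : shift_sequence (comb (delta_mx 0 i : 'rV[K]_r)) = comb (row i Q).
    by apply/funext => l; rewrite shiftE dE rowE.
  by rewrite -!map_row -conjE -shiftE -ds -dc conj_shift_sequence.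
have [v [mu [v0 vE]]] := eigenvector PV QV comm r_gt0.
have [k vk] : exists k, comb v k != 0.
  apply: contrapT => nk; move/eqP: v0; apply; apply: comb_inj => k.
  by apply/eqP; apply: contrapT => /negP vk; apply: nk; exists k.
have := conjE v k; rewrite vE.
have -> : comb (mu *: v) k = mu *: comb v k.
  by rewrite /comb scaler_sumr; apply: eq_bigr => i _; rewrite mxE scalerA.
move=> /(congr1 (fun M => Ak k *m M)); rewrite /conj_sequence !mulmxA orbit_inverse mul1mx => e.
(* The k-th term a satisfies sigma(a) A_k = mu A_k a; applying tau^-k replaces A_k by A. *)
have [f fE] := iter_rmorphism k tK'.
have fA : map_mx f (Ak k) = A.
  by apply/matrixP => i l; rewrite !mxE fE (iter_cancel k tKK).
have := congr1 (map_mx f) e; rewrite -scalemxAr map_mxZ !map_mxM fA.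
have -> : map_mx f (map_mx sK (comb v k)) = map_mx sK (map_mx f (comb v k)).
  by apply/matrixP => i l; rewrite !mxE !fE (@iter_commute _ sK tK').
move=> /no_line fv0; move/eqP: vk; apply; apply/matrixP => i l; apply: (fmorph_inj f).
have [tv _] := comb_lie v.
have := fv0; rewrite trace_map_mx tv => /(_ (rmorph0 f)) /matrixP/(_ i l).
by rewrite !mxE rmorph0.
Qed.
End InducedSequences.

(** * Algebraic relations *)

Section AlgebraicRelation.
Variables (L : fieldType) (C : set L).
Hypotheses (char0 : forall n, n.+1%:R != 0 :> L) (CMn : forall x k, C x -> C (x *+ k)).

(** Among nonzero relations of minimal degree, a nonzero partial derivative has smaller degree and
    so cannot vanish at the point; characteristic 0 ensures that some partial derivative is
    nonzero. *)
Lemma minimal_relation m (P : mpoly m L) (v : 'I_m -> L) : P != 0 ->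
  (forall e, C (mcoeff e P)) -> meval v P = 0 ->
  exists Q : mpoly m L, [/\ forall e, C (mcoeff e Q), meval v Q = 0,
    exists i, mderiv i Q != 0 & forall i, mderiv i Q != 0 -> meval v (mderiv i Q) != 0].
Proof.
move=> P0 PC vP.
pose T k := `[< exists Q : mpoly m L, [/\ Q != 0, forall e, C (mcoeff e Q), meval v Q = 0
  & msize Q = k] >].
have exT : exists k, T k by exists (msize P); apply/asboolP; exists P.
case: (ex_minnP exT) => k /asboolP[Q [Q0 QC vQ sQ]] mink.
exists Q; split=> // [|i Qi].
- apply: contrapT => noi; have [c QE] : exists c, Q = mpolyC m c.
    exists (mcoeff mnm0 Q); apply/mpolyP => e; rewrite mcoeffC.
    have [->|e0] := eqVneq mnm0 e; first by rewrite mulr1.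
    have [i ei] : exists i, e i != 0%N.
      apply: contrapT => ne; move/eqP: e0; apply; apply/mnmP => i; rewrite mnm0E.
      by apply/esym/eqP; apply: contrapT => ei; apply: ne; exists i; apply/negP.
    have Qi : mderiv i Q = 0 by apply: contrapT => /eqP Qi; apply: noi; exists i.
    have := mcoeff_deriv i (mnm_sub e (mnm1 i)) Q; rewrite Qi mcoeff0 submK ?lep1mP //.
    by move/esym/eqP; rewrite -[X in X == 0]mulr_natr mulf_eq0 (negPf (char0 _)) orbF mulr0 => /eqP.
  by move: Q0; rewrite QE -(mevalC v c) -QE vQ mpolyC0 eqxx.
apply/eqP => vQi; pose e := mlead (mderiv i Q).
have : (k <= msize (mderiv i Q))%N.
  apply: mink; apply/asboolP; exists (mderiv i Q); split=> // a.
  by rewrite mcoeff_deriv; exact: CMn.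
rewrite leqNgt -sQ -(mlead_deg Qi) -/e => /negP; apply.
have -> : (mdeg e).+1 = mdeg (mnm_add e (mnm1 i)) by rewrite mdegD mdeg1 addn1.
apply: msize_mdeg_lt; rewrite mcoeff_msupp.
apply: contraTneq (mlead_supp Qi) => h.
by rewrite mcoeff_msupp mcoeff_deriv -/e h mul0rn eqxx.
Qed.

Lemma derivation_meval m (d : L -> L) (P : mpoly m L) (v : 'I_m -> L) : derivation d ->
  (forall e, d (mcoeff e P) = 0) ->
  d (meval v P) = \sum_i meval v (mderiv i P) * d (v i).
Proof.
move=> dd dP; have [dD dM] := dd.
pose B (p : mpoly m L) := d (meval v p) = \sum_i meval v (mderiv i p) * d (v i).
have BM p r : B p -> B r -> B (p * r).
  rewrite /B => Bp Br; rewrite mevalM dM Bp Br mulr_suml mulr_sumr -big_split.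
  by apply: eq_bigr => i _ /=; rewrite mderivM mevalD !mevalM; ring.
have B1 : B 1.
  rewrite /B meval1 derivation1 // big1 // => i _.
  by rewrite -mpolyC1 mderivC meval0 mul0r.
have BX i : B (mvar i).
  rewrite /B mevalXU (bigD1 i) //= big1 => [|k ki]; last first.
    by rewrite mderivX mnm1E eq_sym (negPf ki) scale0r meval0 mul0r.
  rewrite mderivX mnm1E eqxx scale1r (_ : mnm_sub _ _ = mnm0) ?mpolyX0 ?meval1 ?mul1r ?addr0 //.
  by apply/mnmP => k; rewrite mnmBE subnn mnm0E.
have Bm e : B (mpolyX L e).
  rewrite mpolyXE_id; apply: (big_ind B) => // i _.
  by elim: (e i) => [|k IH]; [rewrite expr0|rewrite exprS; apply: BM].
have e1 := mpolyE P; rewrite [in LHS]e1 (big_morph _ (mevalD v) (meval0 v)) derivation_sum //.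
transitivity (\sum_(e <- msupp P) \sum_i mcoeff e P * (meval v (mderiv i (mpolyX L e)) * d (v i))).
  apply: eq_bigr => e _; rewrite mevalZ dM dP mul0r add0r Bm.
  by rewrite mulr_sumr.
rewrite exchange_big; apply: eq_bigr => i _ /=; rewrite [in RHS]e1.
rewrite (big_morph _ (mderivD i) (mderiv0 _ i)) (big_morph _ (mevalD v) (meval0 v)) mulr_suml.
by apply: eq_bigr => e _; rewrite mderivZ mevalZ mulrA.
Qed.

(* The extreme indices a and b at which the relation has a nonzero derivative give
   recursions of order b - a in both directions. *)
Lemma orbit_relation m (P : mpoly m L) (g : L) (tg : L -> L) :
    P != 0 -> (forall e, C (mcoeff e P)) ->
    meval (fun i : 'I_m => iter i tg g) P = 0 ->
  exists a b : nat, [/\ (a <= b)%N,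
    forall d, derivation d -> (forall x, C x -> d x = 0) ->
      (forall i, (a <= i)%N -> (i < b)%N -> d (iter i tg g) = 0) ->
      d (iter b tg g) = 0
    & forall d, derivation d -> (forall x, C x -> d x = 0) ->
      (forall i, (a < i)%N -> (i <= b)%N -> d (iter i tg g) = 0) -> d (iter a tg g) = 0].
Proof.
move=> P0 PC vP.
have [Q [QC vQ [i0 Qi0] Qi]] := minimal_relation P0 PC vP.
have := @arg_minnP _ i0 (fun i => mderiv i Q != 0) val Qi0.
have := @arg_maxnP _ i0 (fun i => mderiv i Q != 0) val Qi0.
case=> b Qb bmax; case=> a Qa amin; exists a, b; split; first exact: amin.
- move=> d dd dC dab.
  have := derivation_meval (fun i : 'I_m => iter i tg g) dd (fun e => dC _ (QC e)).
  rewrite vQ (derivation0 dd) (bigD1 b) //= big1 ?addr0 => [/esym/eqP|i ib].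
    by rewrite mulf_eq0 (negPf (Qi _ Qb)) => /eqP.
  have [->|Q_i] := eqVneq (mderiv i Q) 0; first by rewrite meval0 mul0r.
  rewrite dab ?mulr0 //; first exact: amin.
  by rewrite ltn_neqAle ib; apply: bmax.
move=> d dd dC dab.
have := derivation_meval (fun i : 'I_m => iter i tg g) dd (fun e => dC _ (QC e)).
rewrite vQ (derivation0 dd) (bigD1 a) //= big1 ?addr0 => [/esym/eqP|i ia].
  by rewrite mulf_eq0 (negPf (Qi _ Qa)) => /eqP.
have [->|Q_i] := eqVneq (mderiv i Q) 0; first by rewrite meval0 mul0r.
rewrite dab ?mulr0 //; last exact: bmax.
by rewrite ltn_neqAle eq_sym ia; apply: amin.
Qed.
End AlgebraicRelation.

(** * Derivations and the fields F(z^(1/j)) *)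

Section StarDerivations.
Variable F : fieldType.
Local Notation K := {fraction {poly F}}.
Local Notation L := (puiseux F).
Local Notation tofrac := (@FracField.tofrac {poly F}).
Hypothesis char0 : forall n, n.+1%:R != 0 :> F.

Lemma derivationX (E : comNzRingType) (d : E -> E) x n : derivation d ->
  d (x ^+ n.+1) = n.+1%:R * x ^+ n * d x.
Proof.
move=> [dD dM]; elim: n => [|n IH]; first by rewrite !expr1 expr0 !mul1r.
rewrite exprS dM IH -[n.+2%:R]natr1 exprS; ring.
Qed.

Lemma ratfun_puiseux_generators s (f : {rmorphism K -> L}) :
  (forall p r, f (tofrac p) r = \sum_(i < size p) (if r == i%:R * s then p`_i else 0)) ->
  (forall a, f (tofrac a%:P) = const_puiseux a) /\ f (tofrac 'X) = pmonom 1 s.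
Proof.
move=> fE; split=> [a|]; apply: puiseuxP => r; rewrite fE pmonom_coef.
  rewrite size_polyC; have [->|a0] := eqVneq a 0; first by rewrite big_ord0; case: eqP.
  by rewrite big_ord_recl big_ord0 mul0r addr0 coefC.
by rewrite size_polyX big_ord_recl big_ord_recl big_ord0 !coefX /= mul1r addr0; case: eqP;
  case: eqP; rewrite ?add0r ?addr0.
Qed.

(** In characteristic 0, (z^(1/j))^j = z and d z = 0 give d z^(1/j) = 0; so d vanishes on the
    polynomials in z^(1/j) and on their quotients. *)
Lemma star_derivation (iota : {rmorphism K -> L}) (d : L -> L) :
  iota =1 @ratfun_to_puiseux F 1 -> derivation d -> (forall x, d (iota x) = 0) ->
  forall x, ratfun_star x -> d x = 0.
Proof.
move=> iotaE dd d0 _ [j /= j0] [x _ <-]; have [dD dM] := dd.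
have j0' : (j%:R : rat)^-1 != 0 by rewrite invr_eq0 pnatr_eq0 -lt0n.
have [i1 [i1E i1P _]] := ratfun_puiseux F (oner_neq0 rat).
have i1i y : i1 y = iota y by rewrite i1E iotaE /ratfun_to_puiseux invr1.
have [i1C i1X] := ratfun_puiseux_generators i1P.
have [f [fE fP _]] := ratfun_puiseux F j0'; rewrite /ratfun_to_puiseux -fE.
have [fC fX] := ratfun_puiseux_generators fP.
have dC a : d (const_puiseux a) = 0 by rewrite -i1C i1i.
have dw : d (pmonom 1 j%:R^-1) = 0.
  have [k jk] : exists k, j = k.+1 by case: (j) j0 => // k _; exists k.
  have := derivationX (pmonom 1 j%:R^-1) k dd; rewrite -jk pmonomX divff; last first.
    by rewrite pnatr_eq0 -lt0n.
  rewrite -i1X i1i d0 => /esym/eqP; rewrite !mulf_eq0 => /orP[/orP[|]|/eqP //].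
    have [c _] := const_puiseux_morphism F.
    by rewrite -(rmorph_nat c) fmorph_eq0 jk (negPf (char0 k)).
  by rewrite expf_eq0 (negPf (pmonom_neq0 _ (oner_neq0 F))) andbF.
have dp (p : {poly F}) : d (f (tofrac p)) = 0.
  elim/poly_ind: p => [|p a IH]; first by rewrite !rmorph0 derivation0.
  by rewrite !rmorphD !rmorphM /= dD dM IH fX dw mul0r mulr0 !add0r fC dC.
have := congr1 (fun y => d (f y)) (frac_numden x); rewrite rmorphM dM !dp mulr0 addr0.
by move/eqP; rewrite mulf_eq0 fmorph_eq0 tofrac_eq0 (negPf (denom_neq0 x)) orbF => /eqP.
Qed.

Lemma starMn x k : ratfun_star x -> ratfun_star (x *+ k : L).
Proof.
move=> [j j0 [y _ <-]]; exists j => //.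
have [f [fE _ _]] : exists f : {rmorphism K -> L}, [/\ f =1 @ratfun_to_puiseux F j, True & True].
  have j0' : (j%:R : rat)^-1 != 0 by rewrite invr_eq0 pnatr_eq0 -lt0n.
  by have [f [fE _ _]] := ratfun_puiseux F j0'; exists f.
by exists (y *+ k) => //; rewrite -!fE raddfMn.
Qed.
End StarDerivations.

(** * Difference Galois groups *)

Section PicardVessiot.
Variables (F : fieldType) (q : F) (n : nat).
Local Notation K := {fraction {poly F}}.
Variables (A : 'M[K]_n) (S : comUnitAlgType K) (sigma : {rmorphism S -> S}) (U : 'M[S]_n).
Hypothesis PV : is_picard_vessiot q A sigma U.
Local Notation j := (in_alg S).
Let V := invmx U.

Lemma picard_vessiot_inverse : U *m V = 1%:M.
Proof. by rewrite mulmxV // (pv_unit PV). Qed.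
Let UV := picard_vessiot_inverse.

Lemma picard_vessiot_generation (B : set S) : (forall k, B (j k)) ->
  (forall x y, B x -> B y -> B (x + y)) -> (forall x y, B x -> B y -> B (x * y)) ->
  (forall k l, B (U k l)) -> (forall k l, B (V k l)) -> forall x, B x.
Proof.
move=> Bj BD BM BU BV x; suff -> : B = setT by [].
apply: (pv_gen PV) => //; rewrite -det_inv /determinant -/V.
have B0 : B 0 by have := Bj 0; rewrite rmorph0.
have B1 : B 1 by have := Bj 1; rewrite rmorph1.
apply: (big_ind B) => // s _; apply: (BM); last by apply: (big_ind B) => // i _; exact: BV.
by have := Bj ((-1) ^+ perm.odd_perm s); rewrite rmorphXn rmorphN rmorph1.
Qed.

Lemma picard_vessiot_simple : sigma_simple sigma.
Proof.
move=> I [I0 IL] Is [x Ix x0]; case: (pv_simple PV (I := I)) => // [IE|->//].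
by move: Ix x0; rewrite IE => -> /eqP.
Qed.

Lemma picard_vessiot_countable : countably_spanned j.
Proof.
pose N := (n * n + n * n)%N.
pose h (k : 'I_N) := match fintype.split k with inl a => mxvec U 0 a | inr a => mxvec V 0 a end.
have [f [fC fX]] : exists f : {rmorphism mpoly N K -> S},
    (forall a, f (mpolyC N a) = j a) /\ forall i, f (mvar i) = h i.
  exists (mmap j h : {rmorphism _ -> _}); split=> [a|i]; [exact: mmapC|exact: mmap_var].
have countK : countably_spanned (idfun : {rmorphism K -> K}).
  exists (fun=> 1) => B B0 BL B1 x; have := BL x 1 0 (B1 0%N) B0; by rewrite addr0 mulr1.
have surj y : exists p, y = f p.
  move: y; apply: (picard_vessiot_generation (B := [set y | exists p, y = f p])).
  - by move=> k; exists (mpolyC N k).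
  - by move=> _ _ [p1 ->] [p2 ->]; exists (p1 + p2); rewrite rmorphD.
  - by move=> _ _ [p1 ->] [p2 ->]; exists (p1 * p2); rewrite rmorphM.
  - move=> k l; exists (mvar (lshift (n * n) (mxvec_index k l))); rewrite fX /h.
    by rewrite (unsplitK (inl _)) mxvecE.
  move=> k l; exists (mvar (rshift (n * n) (mxvec_index k l))); rewrite fX /h.
  by rewrite (unsplitK (inr _)) mxvecE.
have := countably_spanned_poly surj countK.
by congr countably_spanned; apply/funext => a /=; rewrite fC.
Qed.

Lemma picard_vessiot_det : \det A != 0.
Proof.
have /(congr1 determinant) := pv_eq PV; rewrite det_map_mx det_mulmx det_map_mx => e.
have uU : \det U \is a GRing.unit by have := pv_unit PV; rewrite unitmxE.
have := rmorph_unit sigma uU; rewrite e unitrM => /andP[uA _].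
by apply: contraTneq uA => ->; rewrite rmorph0 unitr0.
Qed.

Variables (Q : comUnitAlgType K) (iota : {lrmorphism S -> Q}) (sigmaQ : {rmorphism Q -> Q}).
Hypotheses (TQ : is_total_quotient_ring iota)
  (sigmaQE : forall x, sigmaQ (iota x) = iota (sigma x)).
Variable c : {rmorphism F -> K}.
Hypothesis cE : c =1 @const_ratfun F.

(** By generation the image of alpha lies in that of beta, so beta^-1 alpha is an endomorphism of S.
    The pairs (phi iota, iota) and (iota, phi iota) give it for a Galois automorphism phi and for
    its inverse. *)
Lemma lift_endo_matrix (alpha beta : {rmorphism S -> Q}) (M : 'M[F]_n) :
  injective beta -> (forall k, alpha (j k) = beta (j k)) ->
  (forall x, alpha (sigma x) = sigmaQ (alpha x)) ->
  (forall x, beta (sigma x) = sigmaQ (beta x)) -> M \in unitmx ->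
  map_mx alpha U = map_mx beta (U *m constant_mx c j M) -> endo_matrix c j sigma U M.
Proof.
move=> binj aj asg bsg uM aU.
have aV : map_mx alpha V = map_mx beta (constant_mx c j (invmx M) *m V).
  have h : map_mx alpha V *m map_mx alpha U = 1%:M.
    by rewrite -map_mxM mulVmx ?map_mx1 // (pv_unit PV).
  have h' : map_mx alpha U *m map_mx beta (constant_mx c j (invmx M) *m V) = 1%:M.
    rewrite aU -map_mxM -mulmxA (mulmxA (constant_mx _ _ _)) -[_ *m constant_mx _ _ _]map_mxM.
    by rewrite mulmxV // map_mx1 mul1mx UV map_mx1.
  by rewrite -[RHS]mul1mx -h -mulmxA h' mulmx1.
have /choice[f fE] : forall x, exists y, alpha x = beta y.
  apply: (picard_vessiot_generation (B := [set x | exists y, alpha x = beta y])).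
  - by move=> k; exists (j k).
  - by move=> x y [x' xE] [y' yE]; exists (x' + y'); rewrite !rmorphD xE yE.
  - by move=> x y [x' xE] [y' yE]; exists (x' * y'); rewrite !rmorphM xE yE.
  - by move=> k l; have := congr1 (fun X : 'M_n => X k l) aU; rewrite mxE [RHS]mxE; eexists; eassumption.
  by move=> k l; have := congr1 (fun X : 'M_n => X k l) aV; rewrite mxE [RHS]mxE; eexists; eassumption.
have [g gE] : exists g : {rmorphism S -> S}, g =1 f.
  apply: rmorphism_pack => [x y|]; first by apply: binj; rewrite rmorphB -!fE rmorphB.
  by split=> [|x y]; apply: binj; rewrite -fE ?rmorph1 // !rmorphM -!fE.
exists g; split=> [k|x|].
- by apply: binj; rewrite gE -fE aj.
- by apply: binj; rewrite bsg !gE -!fE asg.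
apply/matrixP => k l; apply: binj; have := congr1 (fun X : 'M_n => X k l) aU.
by rewrite !mxE gE -fE => ->.
Qed.

(** Endomorphisms alone give a monoid of matrices; the condition on the inverse makes it a group,
    which can then be compared with the derived subgroup. *)
Definition endo_group : set 'M[F]_n := [set M | [/\ M \in unitmx,
  endo_matrix c j sigma U M & endo_matrix c j sigma U (invmx M)]].

Lemma endo_matrixM M N : endo_matrix c j sigma U M -> endo_matrix c j sigma U N ->
  endo_matrix c j sigma U (M *m N).
Proof.
move=> [f [fj fs fU]] [g [gj gs gU]]; exists (f \o g); split=> [k|x|] /=.
- by rewrite gj fj.
- by rewrite gs fs.
have -> : map_mx (f \o g) U = map_mx f (map_mx g U) by rewrite map_mx_comp.
rewrite gU map_mxM fU -mulmxA /constant_mx map_mxM; congr (_ *m (_ *m _)).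
by apply/matrixP => k l; rewrite !mxE /= fj.
Qed.

Lemma endo_group_group : is_matrix_group endo_group.
Proof.
have endo1 : endo_matrix c j sigma U 1%:M.
  exists idfun; split=> //; rewrite /constant_mx map_mx1 mulmx1.
  by apply/matrixP => k l; rewrite mxE.
split.
- by move=> M [].
- by split; rewrite ?unitmx1 ?invmx1.
- move=> M N [uM M1 M2] [uN N1 N2]; split; first by rewrite unitmx_mul uM.
    exact: endo_matrixM.
  have -> : invmx (M *m N) = invmx N *m invmx M; last exact: endo_matrixM.
  have uMN : M *m N \in unitmx by rewrite unitmx_mul uM.
  rewrite -[RHS](mulKmx uMN) -[_ *m (_ *m invmx M)]mulmxA (mulKVmx uN) mulmxV //.
  by rewrite mulmx1.
by move=> M [uM M1 M2]; split; rewrite ?unitmx_inv ?invmxK.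
Qed.

Lemma galois_endo : galois_matrices sigmaQ (map_mx iota U) `<=` endo_group.
Proof.
move=> M [uM [phi [[psi phiK psiK] phis phiU]]].
have iota_inj := tq_inj TQ.
have cU : map_mx (phi \o iota) U = map_mx iota (U *m constant_mx c j M).
  rewrite map_mx_comp phiU map_mxM; congr (_ *m _); apply/matrixP => k l.
  by rewrite !mxE /= cE linearZ /= rmorph1.
have jE k : phi (iota (j k)) = iota (j k) by rewrite /= !linearZ /= !rmorph1.
have inj : injective (phi \o iota) by move=> x y /= /(can_inj phiK)/iota_inj.
split=> //.
  apply: (@lift_endo_matrix (phi \o iota) iota) => // x /=.
    by rewrite -sigmaQE phis.
  by rewrite sigmaQE.
apply: (@lift_endo_matrix iota (phi \o iota) _ inj).
- by move=> k; apply/esym/jE.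
- by move=> x /=; rewrite sigmaQE.
- by move=> x /=; rewrite -sigmaQE phis.
- by rewrite unitmx_inv.
rewrite [RHS]map_mxM cU map_mxM -mulmxA.
have -> : map_mx (phi \o iota) (constant_mx c j (invmx M)) =
    map_mx iota (constant_mx c j (invmx M)).
  by apply/matrixP => k l; rewrite !mxE [LHS]jE.
have cc : constant_mx c j M *m constant_mx c j (invmx M) = 1%:M.
  by rewrite -map_mxM mulmxV // map_mx1.
by rewrite -map_mxM cc map_mx1 mulmx1.
Qed.

(** The derived subgroup lies in every matrix group containing the commutators, in particular in
    [endo_group], which contains the neutral component. *)
Lemma derived_tangents (G : set 'M[F]_n) : G = galois_matrices sigmaQ (map_mx iota U) ->
  unipotent_tangents (derived_subgroup (neutral_component G)) `<=` tangent c j sigma U.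
Proof.
move=> GE e [e2 [[h1 h2 h3 h4] De]]; exists e2; split=> t; last first.
  by rewrite curve_add // subrr curve0.
have [] // := De t endo_group _; split; first exact: endo_group_group.
have sub M : neutral_component G M -> endo_group M.
  by move=> /connected_component_sub; rewrite GE => /galois_endo.
have [_ _ gM gV] := endo_group_group.
by move=> M N /sub GM /sub GN; apply: (gM); [apply: (gM); [apply: gM|]|]; try exact: gV.
Qed.
End PicardVessiot.

(** * Uncountability *)

Section Uncountable.
Variable R : realType.

(* Of m disjoint closed subintervals one misses a fiber having fewer than m points. *)
Lemma avoiding_subinterval (h : R -> nat) N m (a b : R) : a < b ->
  (forall l, uniq l -> size l = m -> ~ forall x, x \in l -> h x = N) ->
  exists a' b', [/\ a <= a', a' < b', b' <= b & forall x, a' <= x <= b' -> h x <> N].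
Proof.
move=> ab noN; have m0 : (0 < m)%N.
  by case: m noN => // /(_ [::] isT erefl); case=> x; rewrite in_nil.
have [d [d0 dE]] : exists d, 0 < d /\ b - a = (2 * m)%:R * d.
  have m2 : 0 < (2 * m)%:R :> R by rewrite ltr0n muln_gt0.
  exists ((b - a) / (2 * m)%:R); split; first by rewrite divr_gt0 // subr_gt0.
  by rewrite mulrC divfK // gt_eqF.
apply: contrapT => none.
have hit (i : 'I_m) : exists x, a + (2 * i)%:R * d <= x <= a + (2 * i).+1%:R * d /\ h x = N.
  apply: contrapT => nohit; apply: none; exists (a + (2 * i)%:R * d), (a + (2 * i).+1%:R * d).
  split.
  - by rewrite lerDl mulr_ge0 // ltW.
  - by rewrite ltrD2l ltr_pM2r // ltr_nat.
  - rewrite -lerBrDl dE ler_pM2r // ler_nat; have := ltn_ord i; lia.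
  by move=> x xi xN; apply: nohit; exists x.
have [x xP] := choice hit.
have xlt (i k : 'I_m) : (i < k)%N -> x i < x k.
  move=> ik; have [/andP[_ xi] _] := xP i; have [/andP[xk _] _] := xP k.
  apply: le_lt_trans xi _; apply: lt_le_trans xk; rewrite ltrD2l ltr_pM2r // ltr_nat; lia.
apply: (noN [seq x i | i <- enum 'I_m]).
- rewrite map_inj_uniq ?enum_uniq // => i k xik; apply: val_inj; apply/eqP.
  by case: (ltngtP i k) => // /xlt; rewrite xik ltxx.
- by rewrite size_map size_enum_ord.
by move=> _ /mapP[i _ ->]; case: (xP i).
Qed.

(** Nested intervals: if every fiber had bounded size, the interval of rank N + 1 could be chosen to
    avoid the fiber of N, and a common point of all intervals would lie in no fiber. *)
Lemma real_large_fiber (h : R -> nat) : exists N, forall m,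
  exists l : seq R, [/\ uniq l, size l = m & forall a, a \in l -> h a = N].
Proof.
apply: contrapT => none.
have small N : exists m, forall l, uniq l -> size l = m -> ~ forall x, x \in l -> h x = N.
  apply: contrapT => H; apply: none; exists N => m; apply: contrapT => H'.
  by apply: H; exists m => l ul sl lN; apply: H'; exists l.
have step (u : nat * (R * R)) : exists v : R * R, u.2.1 < u.2.2 ->
    [/\ u.2.1 <= v.1, v.1 < v.2, v.2 <= u.2.2 & forall x, v.1 <= x <= v.2 -> h x <> u.1].
  have [ab|] := pselect (u.2.1 < u.2.2); last by exists (0, 0).
  have [m mP] := small u.1; have [a' [b' abP]] := avoiding_subinterval ab mP.
  by exists (a', b').
have [F FP] := choice step.
pose I := fix I n := if n is n'.+1 then F (n', I n') else (0, 1).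
have Ilt n : (I n).1 < (I n).2.
  by elim: n => [|n IH] /=; [exact: ltr01|case: (FP (n, I n) IH)].
have Istep n := FP (n, I n) (Ilt n).
have mono n k : (I n).1 <= (I (n + k)%N).1 /\ (I (n + k)%N).2 <= (I n).2.
  elim: k => [|k [IH1 IH2]]; first by rewrite addn0.
  rewrite addnS; have [h1 _ h2 _] := Istep (n + k)%N.
  by split; [apply: le_trans h1|apply: le_trans IH2].
have cross n k : (I n).1 <= (I k).2.
  have [h1 _] := mono n k; have [_ h2] := mono k n.
  apply: le_trans h1 _; apply: le_trans h2; rewrite addnC ltW //; exact: Ilt.
pose E := [set (I n).1 | n in setT].
have E0 : E (I 0%N).1 by exists 0%N.
have Eub k : ubound E (I k).2 by move=> _ [n _ <-]; exact: cross.
pose x := sup E.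
have xl n : (I n).1 <= x by apply: ub_le_sup; [exists (I 0%N).2; exact: Eub|exists n].
have xr n : x <= (I n).2 by apply: ge_sup; [exists (I 0%N).1|exact: Eub].
have [_ _ _ /(_ x)] := Istep (h x); apply=> //.
by rewrite (xl (h x).+1) (xr (h x).+1).
Qed.

Lemma complex_large_fiber (h : R[i] -> nat) : exists N, forall m,
  exists l : seq R[i], [/\ uniq l, size l = m & forall a, a \in l -> h a = N].
Proof.
have [N NP] := real_large_fiber (h \o real_complex R); exists N => m.
have [l [ul sl lN]] := NP m; exists (map (real_complex R) l); split.
- by rewrite map_inj_uniq //; exact: fmorph_inj.
- by rewrite size_map.
by move=> _ /mapP[x xl ->]; exact: lN.
Qed.
End Uncountable.

(** * Characters from root systems *)

Section RootPowers.
Variables (F : fieldType) (q : F) (qs : nat -> F).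
Hypotheses (q0 : q != 0) (qsP : root_system q qs).

Lemma root_system_neq0 j : (0 < j)%N -> qs j != 0.
Proof.
move=> j0; have [h _] := qsP; apply: contraNneq q0 => qj.
by rewrite -(h j j0) qj expr0n gtn_eqF.
Qed.

(** The roots of level j and of level d, the reduced denominator, are compared through the level d
    j. *)
Lemma root_pow_frac (k : int) j : (0 < j)%N -> root_pow qs (k%:~R / j%:R) = qs j ^ k.
Proof.
move=> j0; set r := _ / _; pose d := `|denq r|%N.
have d0 : (0 < d)%N by rewrite absz_gt0 denq_eq0.
have dE : (d%:R : rat) = (denq r)%:~R by rewrite /d -[in RHS](gtz0_abs (denq_gt0 r)).
have j0' : (j%:R : rat) != 0 by rewrite pnatr_eq0 -lt0n.
have d0' : (d%:R : rat) != 0 by rewrite pnatr_eq0 -lt0n.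
have kE : j%:Z * numq r = d%:Z * k.
  apply/eqP; rewrite -(eqr_int rat) !rmorphM /=; apply/eqP.
  have rE : r * d%:R = (numq r)%:~R by rewrite dE -[X in X * _]divq_num_den divfK // -dE.
  by rewrite -rE mulrA [_ * r]mulrC /r divfK // mulrC.
have [_ coh] := qsP.
rewrite /root_pow -/d -(coh d j) // -(coh j d) // mulnC.
by rewrite -![_ ^+ _]/(_ ^ Posz _) !exprz_exp kE.
Qed.

Lemma root_pow_int (k : int) : root_pow qs k%:~R = q ^ k.
Proof.
have := @root_pow_frac k 1 isT; rewrite divr1 => ->.
by have [h _] := qsP; rewrite -(h 1%N) // expr1.
Qed.

Lemma root_pow_character : character (root_pow qs).
Proof.
split=> [|r s]; first by have := root_pow_int 0; rewrite expr0z.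
pose d x := `|denq x|%N.
have d0 x : (0 < d x)%N by rewrite absz_gt0 denq_eq0.
have dE x : ((d x)%:R : rat) = (denq x)%:~R by rewrite /d -[in RHS](gtz0_abs (denq_gt0 x)).
have d0' x : ((d x)%:R : rat) != 0 by rewrite pnatr_eq0 -lt0n.
have xE x : x = (numq x)%:~R / (d x)%:R by rewrite dE divq_num_den.
have j0 : (0 < d r * d s)%N by rewrite muln_gt0 !d0.
have rE : r = (numq r * (d s)%:Z)%:~R / (d r * d s)%:R.
  rewrite {1}(xE r) rmorphM natrM /=; have := d0' r; have := d0' s.
  by move=> h1 h2; field; rewrite h1 h2.
have sE : s = (numq s * (d r)%:Z)%:~R / (d r * d s)%:R.
  rewrite {1}(xE s) rmorphM natrM /=; have := d0' r; have := d0' s.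
  by move=> h1 h2; field; rewrite h1 h2.
have -> : r + s = (numq r * (d s)%:Z + numq s * (d r)%:Z)%:~R / (d r * d s)%:R.
  by rewrite rmorphD mulrDl -rE -sE.
rewrite [in RHS]rE [X in _ * root_pow _ X]sE !root_pow_frac //.
by rewrite expfzDr // root_system_neq0.
Qed.

Lemma root_pow1 : root_pow qs 1 = q.
Proof. by have := root_pow_int 1; rewrite expr1z. Qed.
End RootPowers.

(** Raising to a common multiple of the denominators reduces the claim to integer exponents. *)
Lemma root_pow_independent (F : fieldType) (q p : F) (qs ps : nat -> F) :
  q != 0 -> p != 0 -> root_system q qs -> root_system p ps ->
  (forall l m : int, q ^ l * p ^ m = 1 -> l = 0 /\ m = 0) ->
  forall x y, root_pow qs x * root_pow ps y = 1 -> x = 0 /\ y = 0.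
Proof.
move=> q0 p0 qsP psP indep x y xy.
pose d x := `|denq x|%N.
have dE z : ((d z)%:R : rat) = (denq z)%:~R by rewrite /d -[in RHS](gtz0_abs (denq_gt0 z)).
have d0 z : ((d z)%:R : rat) != 0 by rewrite dE intr_eq0 denq_eq0.
have zE z : z * (d z)%:R = (numq z)%:~R by rewrite dE -[X in X * _]divq_num_den divfK // -dE.
have xE : x * (d x * d y)%:R = (numq x * (d y)%:Z)%:~R by rewrite natrM mulrA zE rmorphM.
have yE : y * (d x * d y)%:R = (numq y * (d x)%:Z)%:~R.
  by rewrite mulnC natrM mulrA zE rmorphM.
have := congr1 (fun a => a ^+ (d x * d y)) xy; rewrite expr1n exprMn.
rewrite (characterX _ _ (root_pow_character q0 qsP)) (characterX _ _ (root_pow_character p0 psP)).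
rewrite xE yE (root_pow_int qsP) (root_pow_int psP) => /indep[xd yd].
split; [apply: (mulIf (d0 x))|apply: (mulIf (d0 y))]; rewrite mul0r zE; apply/eqP; rewrite intr_eq0.
  move/eqP: xd; rewrite mulf_eq0 => /orP[//|dy]; have := d0 y.
  by rewrite -[_%:R]/((d y)%:Z%:~R) (eqP dy) eqxx.
move/eqP: yd; rewrite mulf_eq0 => /orP[//|dx]; have := d0 x.
by rewrite -[_%:R]/((d x)%:Z%:~R) (eqP dx) eqxx.
Qed.

(** * Transcendence *)

Lemma cancel_lead (E : fieldType) (x y z : E) : x != 0 -> x * (- y / x * z) = - (y * z).
Proof. by move=> x0; field. Qed.

Section CompanionOrbit.
Variables (F : fieldType) (n : nat).
Local Notation K := {fraction {poly F}}.
Local Notation L := (puiseux F).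
Variables (a : 'I_n.+1 -> K) (g : L) (iota : {rmorphism K -> L}) (sg : {rmorphism L -> L}).
Hypothesis lead_neq0 : a ord_max != 0.
Hypothesis g_sol : \sum_(i < n.+1) iota (a i) * iter i sg g = 0.

Lemma companion_orbit :
  map_mx sg (orbit_col sg n g) = map_mx iota (companion a) *m orbit_col sg n g.
Proof.
apply/matrixP => i l; rewrite ord1 !mxE -iterS.
have [iN|iN] := eqVneq i.+1 n; last first.
  have iN' : (i.+1 < n)%N by rewrite ltn_neqAle iN ltn_ord.
  rewrite (bigD1 (Ordinal iN')) //= !mxE (negPf iN) eqxx rmorph1 mul1r big1 ?addr0 // => k ki.
  rewrite !mxE (negPf iN) (_ : (_ == _) = false) ?rmorph0 ?mul0r //.
  by apply/negbTE; apply: contraNneq ki => ik; apply/eqP/val_inj.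
have an0 : iota (a ord_max) != 0 by rewrite fmorph_eq0.
apply: (mulfI an0); rewrite iN mulr_sumr; move/eqP: g_sol; rewrite big_ord_recr /= addr_eq0 => /eqP e.
rewrite -[LHS]opprK -e -sumrN; apply: eq_bigr => k _.
rewrite !mxE iN eqxx rmorphM rmorphN fmorphV.
exact/esym/cancel_lead.
Qed.
End CompanionOrbit.

Section Transcendence.
Variable F : closedFieldType.
Local Notation K := {fraction {poly F}}.
Local Notation L := (puiseux F).
Local Notation tofrac := (@FracField.tofrac {poly F}).
Hypotheses (char0 : forall n, n.+1%:R != 0 :> F).
Hypothesis F_uncountable : forall h : F -> nat, exists N, forall m,
  exists l : seq F, [/\ uniq l, size l = m & forall a, a \in l -> h a = N].
Variables (q p : F) (qs ps : nat -> F).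
Hypotheses (q0 : q != 0) (p0 : p != 0)
  (indep : forall l m : int, q ^ l * p ^ m = 1 -> l = 0 /\ m = 0)
  (qsP : root_system q qs) (psP : root_system p ps).
Variables (n : nat) (a : 'I_n.+1 -> K) (G : set 'M[F]_n) (g : L).
Hypotheses (n_gt1 : (1 < n)%N) (lead_neq0 : a ord_max != 0)
  (GP : is_difference_galois_group q (companion a) G)
  (irrG : irreducible (unipotent_tangents (derived_subgroup (neutral_component G))))
  (g_neq0 : g != 0)
  (g_sol : \sum_(i < n.+1) ratfun_to_puiseux 1 (a i) * iter i (sigma_puiseux qs) g = 0).

Lemma dilation_commute (s t : {rmorphism K -> K}) (b d : F) :
  (forall f, s (tofrac f) = tofrac (f \Po (b *: 'X))) ->
  (forall f, t (tofrac f) = tofrac (f \Po (d *: 'X))) -> forall x, s (t x) = t (s x).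
Proof.
move=> sE tE; apply: (@frac_hom_ext F K (s \o t) (t \o s)) => f /=.
rewrite sE tE sE tE; congr (tofrac _); apply/polyP => i.
by rewrite !comp_dilation_coef mulrCA.
Qed.

Lemma large_group_transcendental : sigma_transcendental ps g.
Proof.
move=> k P PC Pg; apply/eqP; apply: contraTT isT => P0.
have ch := root_pow_character q0 qsP; have cp := root_pow_character p0 psP.
have chi1 := root_pow1 qsP; have psi1 := root_pow1 psP.
have xi := root_pow_independent q0 p0 qsP psP indep.
have fch : faithful (root_pow qs).
  by move=> r h; have [] := xi r 0; rewrite ?h ?mul1r ?(proj1 cp).
have [sg sgE] := twist_morphism ch; have [tg tgE] := twist_morphism cp.
have sgS : sigma_puiseux qs = sg by apply/funext => f; apply: puiseuxP => r; rewrite sgE.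
have tgS : sigma_puiseux ps = tg by apply/funext => f; apply: puiseuxP => r; rewrite tgE.
have [sg' [sgK sgK'] sg'E] := twist_bijective ch sgE.
have [tg' [tgK tgK'] tg'E] := twist_bijective cp tgE.
have q0' : q^-1 != 0 by rewrite invr_eq0.
have p0' : p^-1 != 0 by rewrite invr_eq0.
have [sK [sKS sKE]] := sigma_ratfun_morphism q0.
have [sK' [_ sK'E]] := sigma_ratfun_morphism q0'.
have [tK [_ tKE]] := sigma_ratfun_morphism p0.
have [tK' [_ tK'E]] := sigma_ratfun_morphism p0'.
have sKK' : cancel sK' sK by apply: (dilationK q0' sK'E) => f; rewrite invrK.
have tKK : cancel tK tK' := dilationK p0 tKE tK'E.
have stK' := dilation_commute sKE tK'E.
have stg x : sg (tg x) = tg (sg x).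
  by apply: puiseuxP => r; rewrite sgE !tgE sgE mulrCA.
have [iota [iotaE iotaP _]] := ratfun_puiseux F (oner_neq0 rat).
have iotaS : iota =1 @ratfun_to_puiseux F 1.
  by move=> x; rewrite iotaE /ratfun_to_puiseux invr1.
have sgi := dilation_embedding ch chi1 sKE sgE iotaP.
have tgi := dilation_embedding cp psi1 tKE tgE iotaP.
have psiV1 : (root_pow ps 1)^-1 = p^-1 by rewrite psi1.
have tg'i := dilation_embedding (characterV cp) psiV1 tK'E tg'E iotaP.
have [c cE] := const_ratfun_morphism F.
have sK_fix := dilation_fixed ch chi1 sKE sgE iotaP (oner_neq0 rat) fch cE.
have sKc x : sK (c x) = c x by rewrite cE /const_ratfun sKE comp_polyC.
have sY0 : map_mx sg (orbit_col sg n g) = map_mx iota (companion a) *m orbit_col sg n g.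
  apply: companion_orbit => //; rewrite -[RHS]g_sol; apply: eq_bigr => i _.
  by rewrite iotaS sgS.
have [S [Q [sigma [U [j [sigmaQ [PV TQ sigmaQE GE]]]]]]] := GP.
have UV := picard_vessiot_inverse PV; have genS := picard_vessiot_generation PV.
have simpleS := picard_vessiot_simple PV; have countS := picard_vessiot_countable PV.
have sj x : sigma (in_alg S x) = in_alg S (sK x) by rewrite /= (pv_ext PV) sKS.
have sU := pv_eq PV.
have irr : irreducible (tangent c (in_alg S) sigma U).
  exact: irreducible_sub (derived_tangents PV TQ sigmaQE cE GE) irrG.
have n_gt0 : (0 < n)%N by apply: ltnW.
have constS := simple_constants sKc sK_fix F_uncountable sj simpleS countS.
have Y0 : orbit_col sg n g != 0.
  apply: contraNneq g_neq0 => /matrixP/(_ (Ordinal n_gt0) 0).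
  by rewrite !mxE /= => ->.
have AA' : companion a *m invmx (companion a) = 1%:M.
  have uA : companion a \in unitmx by rewrite unitmxE unitfE; exact: (picard_vessiot_det PV).
  exact: (mulmxV uA).
have [e1 [e2 [Te1 Te2 e12]]] := irreducible_noncommuting irr n_gt0 n_gt1.
have sU0 : map_mx sigma U = map_mx (in_alg S) (map_mx (iter 0 tK) (companion a)) *m U.
  by rewrite sU; congr (map_mx _ _ *m _); apply/matrixP => i l; rewrite !mxE.
have lie := lie_algebra_nonzero char0 sKc sK_fix F_uncountable sj simpleS countS
  (orbit_inverse tK AA') sU0 UV genS sgi (orbit_equation tgi stg sY0) Te1 Te2 e12.
have char0L i : i.+1%:R != 0 :> L.
  by have [cc _] := const_puiseux_morphism F; rewrite -(rmorph_nat cc) fmorph_eq0.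
have vP : meval (fun i : 'I_k => iter i tg g) P = 0 by rewrite -tgS.
have [b [b' [bb' fwd bwd]]] := orbit_relation char0L (@starMn F) P0 PC vP.
have iter0 (h : {rmorphism L -> L}) i : iter i h 0 = 0 by elim: i => //= i ->; rewrite rmorph0.
have tg_eq0 i x : iter i tg x = 0 -> x = 0.
  by move=> /(congr1 (iter i tg')); rewrite (iter_cancel i tgK) iter0.
(* The recursions concern the window from b to b'; conjugation by tau^b moves it to the window from
   0 to b' - b. *)
have conj d : field_derivation iota d ->
    derivation (fun x => iter b tg (d (iter b tg' x))) /\
    forall x, ratfun_star x -> iter b tg (d (iter b tg' x)) = 0.
  move=> dd; have [d1 d2] := field_derivation_conj_iter b tgK' tg'i dd.
  by split=> //; exact: (star_derivation char0 iotaS d1 d2).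
have back i : (b <= i)%N -> iter b tg' (iter i tg g) = iter (i - b) tg g.
  by move=> bi; rewrite -{1}(subnKC bi) iterD (iter_cancel b tgK).
exfalso; apply: (@recursive_orbit_absurd _ _ _ _ _ _ _ _ _ _ _ sKK' tKK sgK sgK' tgK tgK' sgi tgi tg'i stg stK'
  _ _ _ _ AA' sY0 (b' - b)%N).
- move=> d dd d0; have [d1 d2] := conj d dd.
  have := fwd _ d1 d2; rewrite back // => h; apply: (tg_eq0 b); apply: h => i bi ib.
  by rewrite back // d0 ?iter0 // ltn_sub2r // (leq_ltn_trans bi).
- move=> d dd d0; have [d1 d2] := conj d dd.
  have := bwd _ d1 d2; rewrite back // subnn => h; apply: (tg_eq0 b); apply: h => i bi ib.
  have ib0 : (0 < i - b)%N by rewrite subn_gt0.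
  by rewrite back 1?ltnW // -(prednK ib0) d0 ?iter0 // prednK // leq_sub2r.
- move=> r; exact: (solution_entries_free char0 sj simpleS constS sU UV irr sgi sY0 Y0).
- move=> M mu; exact: (no_rank_one char0 sj simpleS constS sU UV n_gt0 irr).
- exact: lie.
(* The shift of sequences applies tau^-1 to matrices, so the consistent pair belongs to the
   parameters q and p^-1. *)
have xi' x y : root_pow qs x * (root_pow ps y)^-1 = 1 -> x = 0 /\ y = 0.
  by rewrite -(characterN y cp) => /xi[-> /eqP]; rewrite oppr_eq0 => /eqP.
move=> r; apply: (consistent_eigenvector ch (characterV cp) chi1 psiV1 xi' sKE sK'E tK'E).
by move=> f; rewrite invrK.
Qed.
End Transcendence.

Theorem corollary8p2 (R : realType) (q p : R[i]) (qs ps : nat -> R[i])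
    (q_neq0 : q != 0) (p_neq0 : p != 0)
    (q_norm : `|q| != 1) (p_norm : `|p| != 1)
    (indep : forall l m : int, q ^ l * p ^ m = 1 -> l = 0 /\ m = 0)
    (qsP : root_system q qs) (psP : root_system p ps)
    (n : nat) (n_gt0 : (1 <= n)%N)
    (a : 'I_n.+1 -> {fraction {poly R[i]}})
    (a_neq0 : a ord0 * a ord_max != 0)
    (G : set 'M[R[i]]_n)
    (GP : is_difference_galois_group q (companion a) G)
    (G_large :
      [\/ (2 <= n)%N /\
            derived_subgroup (neutral_component G) = @SL R[i] n,
          (3 <= n)%N /\
            derived_subgroup (neutral_component G) = @SO R[i] n
        | ~~ odd n /\
            derived_subgroup (neutral_component G) = @Sp R[i] n])
    (g : puiseux R[i]) (g_neq0 : g != 0)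
    (g_sol : \sum_(i < n.+1)
       ratfun_to_puiseux 1 (a i) * iter i (sigma_puiseux qs) g = 0) :
  sigma_transcendental ps g.
Proof.
have char0 k : k.+1%:R != 0 :> R[i] by rewrite pnatr_eq0.
(* The square root of -1 from which the isotropic vectors of the orthogonal case are formed. *)
have iP : ('i%C : R[i]) * 'i%C = -1 by rewrite -expr2 sqr_i.
have [n1 irr] : (1 < n)%N /\ irreducible (unipotent_tangents (derived_subgroup (neutral_component G))).
  case: G_large => [[n2 ->]|[n3 ->]|[en ->]].
  - by split=> //; exact: SL_irreducible.
  - by split; [exact: ltnW|exact: (SO_irreducible (char0 1%N) iP n3)].
  split; last exact: (Sp_irreducible (char0 1%N) en).
  by case: (n) n_gt0 en => [|[|]].
have an : a ord_max != 0 by apply: contraNneq a_neq0 => ->; rewrite mulr0.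
exact: (large_group_transcendental char0 (@complex_large_fiber R) q_neq0 p_neq0 indep qsP psP
  n1 an GP irr g_neq0 g_sol).
Qed.
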